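(* Let $q$ be a fixed positive integer. Consider $n$ sensors, each independently receiving a key ring of $K_n$ distinct keys chosen uniformly at random among all $K_n$-subsets of a pool of $P_n$ keys, and placed independently and uniformly at random on the unit-area torus $\mathcal{T}=[0,1)^2$; two sensors have a secure link iff their key rings share at least $q$ keys and their toroidal distance is at most $r_n$. An adversary captures a uniformly random set of $m=m(n)<n$ sensors, and let $\mathbb{H}_q(n,m,K_n,P_n,r_n,\mathcal{T})$ be the graph of secure links among the $n-m$ non-captured sensors. Let $p_s$ be the probability that two key rings share at least $q$ keys. Assume $r_n\le\frac12$, $K_n=\omega(\ln n)$, $\frac{K_n^2}{P_n}=o(1)$, $\frac{K_n}{P_n}=o\!\left(\frac1n\right)$, and $$p_s\cdot\pi r_n^2\sim a\cdot\frac{\ln(n-m)}{n-m}$$ for some constant $a>0$. Then, as $n\to\infty$, the probability that $\mathbb{H}_q(n,m,K_n,P_n,r_n,\mathcal{T})$ is connected tends to $0$ if $a<1$ and tends to $1$ if $a>1$.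
   Context: Asymptotics are as $n\to\infty$: $x_n=o(y_n)$ means $x_n/y_n\to0$, $x_n=\omega(y_n)$ means $x_n/y_n\to\infty$, and $x_n\sim y_n$ means $x_n/y_n\to1$. $K_n,P_n,r_n$ are functions of $n$ with $q\le K_n\le P_n$. *)

(* Defs.v *)
From HB Require Import structures.
From mathcomp Require Import all_boot all_order all_algebra.
From mathcomp Require Import all_classical all_reals all_analysis.
Set Implicit Arguments. Unset Strict Implicit. Unset Printing Implicit Defensive.
Import Order.TTheory GRing.Theory Num.Theory.
Import numFieldNormedType.Exports.
Local Open Scope classical_set_scope.
Local Open Scope ring_scope.

Section Model.
Variable R : realType.

Definition torus_coord_dist (u v : R) : R :=
  Num.min `|u - v| (1 - `|u - v|).
Definition torus_dist (x y : R * R) : R :=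
  Num.sqrt (torus_coord_dist x.1 y.1 ^+ 2 + torus_coord_dist x.2 y.2 ^+ 2).

Definition secure_link (q n P : nat) (r : R) (rings : {ffun 'I_n -> {set 'I_P}})
  (pos : nat -> R * R) (i j : 'I_n) : bool :=
  [&& i != j, (q <= #|rings i :&: rings j|)%N & torus_dist (pos i) (pos j) <= r].

Definition H_edge (q n P : nat) (r : R) (S : {set 'I_n})
  (rings : {ffun 'I_n -> {set 'I_P}}) (pos : nat -> R * R) : rel 'I_n :=
  fun i j => [&& i \notin S, j \notin S & secure_link q r rings pos i j].

Definition H_connected (q n P : nat) (r : R) (S : {set 'I_n})
  (rings : {ffun 'I_n -> {set 'I_P}}) (pos : nat -> R * R) : bool :=
  [forall i : 'I_n, forall j : 'I_n,
     (i \notin S) ==> (j \notin S) ==> connect (H_edge q r S rings pos) i j].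

Definition rings_ok (n K P : nat) (rings : {ffun 'I_n -> {set 'I_P}}) : bool :=
  [forall i, #|rings i| == K].

(* Conditional probability of connectivity given positions: average over the
   uniformly random capture set S (|S| = m) and the independent uniform
   K-subset key rings. *)
Definition conn_given_pos (q n m K P : nat) (r : R) (pos : nat -> R * R) : R :=
  (\sum_(S : {set 'I_n} | #|S| == m)
     \sum_(rings : {ffun 'I_n -> {set 'I_P}} | rings_ok K rings)
        (H_connected q r S rings pos)%:R)
  / (#|[set S : {set 'I_n} | #|S| == m]|%:R
     * #|[set rings : {ffun 'I_n -> {set 'I_P}} | rings_ok K rings]|%:R).

(* Iterated integral over independent uniform positions of sensors 0..k-1
   on [0,1)^2 (Lebesgue measure). *)
Fixpoint torus_int (k : nat) (F : (nat -> R * R) -> \bar R) : \bar R :=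
  match k with
  | 0 => F (fun _ => (0, 0))
  | k'.+1 =>
      (\int[@lebesgue_measure R]_(x in `[0%R, 1%R[)
         \int[@lebesgue_measure R]_(y in `[0%R, 1%R[)
            torus_int k' (fun g => F (fun i => if i == k' then (x, y) else g i)))%E
  end.

Definition prob_H_connected (q n m K P : nat) (r : R) : \bar R :=
  torus_int n (fun pos => (conn_given_pos q n m K P r pos)%:E).

Definition p_s (q K P : nat) : R :=
  #|[set AB : {set 'I_P} * {set 'I_P} |
       [&& #|AB.1| == K, #|AB.2| == K & (q <= #|AB.1 :&: AB.2|)%N]]|%:R
  / (#|[set A : {set 'I_P} | #|A| == K]|%:R ^+ 2).

End Model.

(* Main.v *)
(* Write N = n - m, p = p_s, s = p pi r^2 and L = ln N, and condition on the captured set.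

   If a < 1, the number X of isolated sensors has mean mu = N (1 - s)^(N-1), which tends to infinity, and
   E X^2 / mu^2 tends to 1, so X > 0 with high probability. Two sensors interact only if they are
   within 2r of each other, which has probability at most 16 r^2. Given their rings A and B, a third ring
   meets both A and B in at least q keys with probability at most p (p + (q+1) |A n B| / K), and
   E exp(theta |A n B|) is close to 1 since K^2/P tends to 0.

   If a > 1, cut the torus into M^2 cells with 3 <= r M <= 4. With high probability all position
   degrees are at least (1 - delta) of their mean and all cells contain about the mean number u = N/M^2 of
   sensors, where u is much larger than L because p tends to 0. As n K / P tends to 0 and K / ln n tends to
   infinity, with high probability each ring has at most e K keys in common with all the previous ones,
   so the rings are essentially disjoint and the absence of a family of F links costs about (1 - p)^F,
   by negative association. If the graph is disconnected, then either two sets of G ~ gamma u sensors in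
   neighbouring cells have no link between them, and the union bound 4^(O(u)) over such pairs loses against
   (1 - p)^(G^2) because p u^2 is much larger than u; or some set A of sensors with fewer than G members in
   every cell has no link to its complement. In the second case each member of A has nearly all of its
   neighbours outside A, and the union bound is the sum over A of x^|A|, which is (1 + x)^N - 1 with
   x = exp(-(1 + delta) L). *)

(* The captured set enters only through [N]: all bounds are uniform in it, and [n] itself matters
   only for the rings, all of which are revealed. The obstacle in both halves is that links sharing
   a ring are dependent. Two facts about a uniform [K]-subset overcome this: overlaps with disjoint
   sets are negatively associated, and a given key of a ring takes part in an overlap of size at
   least [q] with probability at most [(q + 1) p / K]. The growth of [K / ln n] is spent twice, on
   keeping [theta = 4 N s (q + 1) / K] bounded and on making the tail [exp(- e K / 2)] of ring
   overlaps beat [n]. The radius may or may not tend to 0; since [p r^2 <= s], the factor [r^2] of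
   close pairs compensates [p] and no case distinction arises. For [a > 1] a union bound over all
   cuts is too expensive; the dichotomy by cells leaves either subsets of two cells, of entropy
   [O(u)], or sparse sets of entropy [|A| ln N], paid for by their degrees, which is where [a > 1]
   acts. Independence is used throughout as an identity: replacing one ring or one position by a
   fresh one does not change a mean. *)
Require Import Defs.
From HB Require Import structures.
From mathcomp Require Import all_boot all_order all_algebra.
From mathcomp Require Import zify ring lra.
Set Implicit Arguments. Unset Strict Implicit. Unset Printing Implicit Defensive.
Import Order.TTheory GRing.Theory Num.Theory.
Local Open Scope ring_scope.

(** * Counting [K]-subsets: layers of down-sets and negative association *)

Section UniformSubsets.
Variable T : finType.
Implicit Types (A B W X Y Z : {set T}) (phi psi : pred {set T}) (K s q : nat).

Definition cnt K phi : nat := #|[set X : {set T} | (#|X| == K) && phi X]|.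

(** A [K]-set amounts to its trace on [A] and its trace outside [A]; taking the union of the two is
    the bijection. *)
Lemma cnt_split A s K phi psi : (s <= K)%N ->
  cnt K (fun X => [&& #|X :&: A| == s, phi (X :&: A) & psi (X :\: A)]) =
  (#|[set Y : {set T} | [&& Y \subset A, #|Y| == s & phi Y]]| *
   #|[set Z : {set T} | [&& Z \subset ~: A, #|Z| == (K - s)%N & psi Z]]|)%N.
Proof.
move=> sK; rewrite -cardsX.
have inj : {in setX [set Y : {set T} | [&& Y \subset A, #|Y| == s & phi Y]]
      [set Z : {set T} | [&& Z \subset ~: A, #|Z| == (K - s)%N & psi Z]] &,
    injective (fun YZ : {set T} * {set T} => YZ.1 :|: YZ.2)}.
  move=> [Y Z] [Y' Z']; rewrite !inE /= -!andbA.
  move=> /and5P[YA _ _ ZA _] /and5P[Y'A _ _ Z'A _] E.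
  have E1 (U V : {set T}) : U \subset A -> V \subset ~: A -> (U :|: V) :&: A = U.
    move=> UA VA; rewrite setIUl (setIidPl UA); apply/setUidPl.
    apply/fintype.subsetP => x; rewrite inE => /andP[xV xA].
    by move/fintype.subsetP: VA => /(_ x xV); rewrite inE xA.
  have E2 (U V : {set T}) : U \subset A -> V \subset ~: A -> (U :|: V) :\: A = V.
    move=> UA VA; rewrite setDUl; have -> : U :\: A = set0 by apply/eqP; rewrite setD_eq0.
    by rewrite set0U setDE; apply/setIidPl.
  have /= E' := E; congr (_, _).
    by rewrite -(E1 _ _ YA ZA) E' E1.
  by rewrite -(E2 _ _ YA ZA) E' E2.
rewrite -(card_in_imset inj); apply: eq_card => X; rewrite !inE.
apply/idP/imsetP => [/and4P[/eqP XK /eqP Xs p1 p2]|[[Y Z]]].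
  exists (X :&: A, X :\: A); last by rewrite /= setID.
  rewrite !inE /= subsetIr Xs eqxx p1 p2 /= subDset setUCr finset.subsetT /= andbT.
  by rewrite cardsD XK Xs.
rewrite !inE /= -!andbA => /and5P[YA /eqP Ys p1 ZA /andP[/eqP Zs p2]] ->.
have E1 : (Y :|: Z) :&: A = Y.
    rewrite setIUl (setIidPl YA); apply/setUidPl.
    apply/fintype.subsetP => x; rewrite inE => /andP[xV xA].
    by move/fintype.subsetP: ZA => /(_ x xV); rewrite inE xA.
have E2 : (Y :|: Z) :\: A = Z.
  rewrite setDUl; have -> : Y :\: A = set0 by apply/eqP; rewrite setD_eq0.
  by rewrite set0U setDE; apply/setIidPl.
rewrite E1 E2 Ys eqxx p1 p2 !andbT -(cardsID A) E1 E2 Ys Zs /=.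
by rewrite subnKC.
Qed.

Lemma eq_cnt K phi psi : (forall X, #|X| = K -> phi X = psi X) -> cnt K phi = cnt K psi.
Proof.
move=> h; apply: eq_card => X; rewrite !inE.
by case: eqP => //= XK; rewrite h.
Qed.

Lemma cnt_le K phi psi : (forall X, #|X| = K -> phi X -> psi X) -> (cnt K phi <= cnt K psi)%N.
Proof.
move=> h; apply: subset_leq_card; apply/fintype.subsetP => X; rewrite !inE.
by case/andP => /eqP XK pX; rewrite XK eqxx h.
Qed.

Lemma cnt_or K phi psi : (cnt K (fun X => phi X || psi X) <= cnt K phi + cnt K psi)%N.
Proof.
rewrite /cnt; apply: leq_trans (leq_card_setU _ _).
by apply: subset_leq_card; apply/fintype.subsetP => X; rewrite !inE -andb_orr.
Qed.

Lemma cntC K phi : (cnt K phi + cnt K (fun X => ~~ phi X) = 'C(#|T|, K))%N.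
Proof.
rewrite -card_draws -(cardsID [set X | phi X]) /cnt; congr (_ + _)%N;
  by apply: eq_card => X; rewrite !inE // andbC.
Qed.

Lemma cntID K phi psi :
  (cnt K phi = cnt K (fun X => phi X && psi X) + cnt K (fun X => phi X && ~~ psi X))%N.
Proof.
rewrite /cnt -(cardsID [set X | psi X]); congr (_ + _)%N;
  apply: eq_card => X; rewrite !inE; case: (#|X| == K); case: (phi X); case: (psi X) => //.
Qed.

Lemma cnt_true K : cnt K xpredT = 'C(#|T|, K).
Proof. by rewrite -card_draws; apply: eq_card => X; rewrite !inE andbT. Qed.

Lemma cnt_sum A K phi :
  cnt K phi = (\sum_(s < K.+1) cnt K (fun X => (#|X :&: A| == s) && phi X))%N.
Proof.
rewrite /cnt -sum1_card (partition_big (fun X : {set T} => inord #|X :&: A| : 'I_K.+1) predT) //=.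
apply: eq_bigr => s _; rewrite -sum1_card; apply: eq_bigl => X; rewrite !inE.
case: eqP => //= XK.
have h : (#|X :&: A| < K.+1)%N by rewrite ltnS -XK subset_leq_card // subsetIl.
by rewrite -(inj_eq val_inj) /= inordK // andbC.
Qed.

Definition downset phi := forall X Y, X \subset Y -> phi Y -> phi X.

Definition lay A k psi : nat := #|[set Z : {set T} | [&& Z \subset A, #|Z| == k & psi Z]]|.

Lemma lay_true A k : lay A k xpredT = 'C(#|A|, k).
Proof. by rewrite -cards_draws; apply: eq_card => X; rewrite !inE andbT. Qed.

(** The local LYM inequality: deleting a marked element maps marked members of layer [k.+1]
    injectively to members of layer [k] with a mark outside them, because a down-set survives
    deletion. *)
Lemma lay_step A k psi : downset psi ->
  (lay A k.+1 psi * k.+1 <= lay A k psi * (#|A| - k))%N.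
Proof.
move=> dpsi.
pose S := [set Z : {set T} | [&& Z \subset A, #|Z| == k.+1 & psi Z]].
pose S' := [set Z : {set T} | [&& Z \subset A, #|Z| == k & psi Z]].
pose P1 := [set p : {set T} * T | (p.1 \in S) && (p.2 \in p.1)].
pose P2 := [set p : {set T} * T | (p.1 \in S') && (p.2 \in A :\: p.1)].
have c1 : #|P1| = (#|S| * k.+1)%N.
  rewrite -sum1_card (partition_big fst (mem S)) /=; last by case=> Z x; rewrite inE => /andP[].
  rewrite -sum_nat_const.
  apply: eq_bigr => Z ZS.
  have -> : k.+1 = #|Z| by move: ZS; rewrite !inE => /and3P[_ /eqP].
  rewrite -sum1_card (reindex_onto (fun x => (Z, x)) snd) /=; last first.
    by case=> Y x /andP[_ /eqP] /= ->.
  by apply: eq_bigl => x; rewrite inE /= !eqxx !andbT ZS.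
have c2 : #|P2| = (#|S'| * (#|A| - k))%N.
  rewrite -sum1_card (partition_big fst (mem S')) /=; last by case=> Z x; rewrite inE => /andP[].
  rewrite -sum_nat_const; apply: eq_bigr => Z ZS.
  have -> : (#|A| - k = #|A :\: Z|)%N.
    by move: ZS; rewrite !inE => /and3P[ZA /eqP <- _]; rewrite cardsD (setIidPr ZA).
  rewrite -sum1_card (reindex_onto (fun x => (Z, x)) snd) /=; last first.
    by case=> Y x /andP[_ /eqP] /= ->.
  by apply: eq_bigl => x; rewrite inE /= !eqxx !andbT ZS.
rewrite -[lay A k.+1 psi]/(#|S|) -[lay A k psi]/(#|S'|) -c1 -c2.
have inj : {in P1 &, injective (fun p : {set T} * T => (p.1 :\ p.2, p.2))}.
  move=> [Z x] [Z' x']; rewrite !inE /= => /andP[_ xZ] /andP[_ xZ'] [E1 E2].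
  by rewrite -E2 in xZ' E1 *; rewrite -(setD1K xZ) E1 setD1K.
rewrite -(card_in_imset inj); apply: subset_leq_card; apply/fintype.subsetP => p.
case/imsetP => -[Z x]; rewrite !inE /= => /andP[/and3P[ZA /eqP Zk pZ] xZ] -> /=.
rewrite (subset_trans (subD1set _ _) ZA) setD11 /= (fintype.subsetP ZA) // andbT.
rewrite (dpsi _ _ (subD1set _ _) pZ) andbT.
by have := cardsD1 x Z; rewrite xZ Zk add1n => -[<-].
Qed.

(** By [lay_step] and [mul_bin_left], the density of [psi] in a layer, its count over the binomial,
    does not increase with the layer. The cross-multiplied form also covers empty layers. *)
Lemma lay_anti A k l psi : downset psi -> (k <= l)%N ->
  (lay A l psi * 'C(#|A|, k) <= lay A k psi * 'C(#|A|, l))%N.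
Proof.
move=> dpsi; elim: l => [|l IH]; first by rewrite leqn0 => /eqP ->.
rewrite leq_eqVlt => /orP[/eqP -> //|]; rewrite ltnS => kl.
have aC : (lay A l.+1 psi <= 'C(#|A|, l.+1))%N.
  rewrite -lay_true; apply: subset_leq_card; apply/fintype.subsetP => X.
  by rewrite !inE => /and3P[-> ->].
have h2 := IH kl; have h1 := lay_step A l dpsi; have E := mul_bin_left #|A| l.
move: aC h1 h2 E; move: (lay A l.+1 psi) (lay A l psi) (lay A k psi) (#|A| - l)%N.
move: 'C(#|A|, l.+1) 'C(#|A|, k) 'C(#|A|, l) => e f g a b c d ae h1 h2 E.
(* The binomial of layer [l] can be cancelled only if it is positive; otherwise layer [l.+1] is
   empty as well. *)
case: (posnP g) => [g0|gp].
  have e0 : e = 0%N by move: E; rewrite g0 muln0 => /eqP; rewrite muln_eq0 /= => /eqP.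
  by move: ae; rewrite e0 leqn0 => /eqP ->.
rewrite -(leq_pmul2l gp) -(@leq_pmul2l l.+1) //.
have h3 : (a * l.+1 * (f * g) <= b * d * (f * g))%N by rewrite leq_mul2r h1 orbT.
have h4 : (b * f * (d * g) <= c * g * (d * g))%N by rewrite leq_mul2r h2 orbT.
have -> : (l.+1 * (g * (a * f)) = a * l.+1 * (f * g))%N by ring.
have -> : (l.+1 * (g * (c * e)) = c * g * (l.+1 * e))%N by ring.
rewrite E; apply: leq_trans h3 (leq_trans (eq_leq _) h4); ring.
Qed.

(* Given [#|X :&: B| = s], the conditional probability of [psi] grows with [s] (lemma [lay_anti]);
   the claim is then Chebyshev's sum inequality. *)
Lemma cnt_neg_assoc B K q psi : downset psi ->
  (cnt K (fun X => (#|X :&: B| < q)%N && psi (X :\: B)) * 'C(#|T|, K) <=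
   cnt K (fun X => (#|X :&: B| < q)%N) * cnt K (fun X => psi (X :\: B)))%N.
Proof.
move=> dpsi.
pose a s := lay B s xpredT.
pose n s := lay (~: B) (K - s)%N psi.
pose c s := lay (~: B) (K - s)%N xpredT.
have Ew chi ps : (forall X, chi X = ps X) -> cnt K chi = cnt K ps by move=> h; apply: eq_cnt.
have Sn (g : pred nat) : cnt K (fun X => g #|X :&: B| && psi (X :\: B)) =
    (\sum_(s < K.+1 | g s) a s * n s)%N.
  rewrite (cnt_sum B) [RHS]big_mkcond; apply: eq_bigr => s _.
  rewrite -cnt_split; last by rewrite -ltnS.
  case: ifP => gs; first by apply: Ew => X; case: eqP => //= ->; rewrite gs.
  by apply/eqP; rewrite cards_eq0; apply/eqP/setP => X; rewrite !inE; case: eqP => //= _; case: eqP => //= ->; rewrite gs.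
have Sc (g : pred nat) : cnt K (fun X => g #|X :&: B|) = (\sum_(s < K.+1 | g s) a s * c s)%N.
  rewrite (cnt_sum B) [RHS]big_mkcond; apply: eq_bigr => s _.
  rewrite -cnt_split; last by rewrite -ltnS.
  case: ifP => gs; first by apply: Ew => X; case: eqP => //= ->; rewrite gs.
  by apply/eqP; rewrite cards_eq0; apply/eqP/setP => X; rewrite !inE; case: eqP => //= _; case: eqP => //= ->; rewrite gs.
have -> : 'C(#|T|, K) = (\sum_(s < K.+1) a s * c s)%N by rewrite -cnt_true (Sc xpredT).
have -> : cnt K (fun X => psi (X :\: B)) = (\sum_(s < K.+1) a s * n s)%N.
  by rewrite -(Sn xpredT).
rewrite (Sn (fun s => s < q)%N) (Sc (fun s => s < q)%N).
(* Splitting both totals at [q] cancels the block with both indices below [q]. What remains pairs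
   [s < q] with [t >= q], and [lay_anti] compares the outside layers [K - t <= K - s]. *)
rewrite [X in (_ * X <= _)%N](bigID (fun s : 'I_K.+1 => (s < q)%N)) /=.
rewrite [X in (_ <= _ * X)%N](bigID (fun s : 'I_K.+1 => (s < q)%N)) /=.
rewrite !mulnDr [X in (X + _ <= _)%N]mulnC leq_add2l.
rewrite big_distrlr [leqRHS]big_distrlr /=.
apply: leq_sum => s sq; apply: leq_sum => t tq.
have h := @lay_anti (~: B) (K - t)%N (K - s)%N psi dpsi.
have : (n s * c t <= c s * n t)%N.
  rewrite /c !lay_true mulnC [leqRHS]mulnC mulnC; apply: h; rewrite leq_sub2l //.
  by rewrite -leqNgt in tq; apply: leq_trans (ltnW sq) tq.
move=> h2; have -> : (a s * n s * (a t * c t) = (a s * a t) * (n s * c t))%N by ring.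
have -> : (a s * c s * (a t * n t) = (a s * a t) * (c s * n t))%N by ring.
by rewrite leq_mul2l h2 orbT.
Qed.

End UniformSubsets.

(** * The binomial theorem over the subsets of a set *)

Section SubsetGeneratingFunction.
Variables (R : comRingType) (T : finType).

(** The binomial theorem with subsets collected by size. It yields exponential moments of overlaps
    and, later, the union bound over sparse sets. *)
Lemma sum_subsets_exp (A : {set T}) (y : R) :
  \sum_(Y : {set T} | Y \subset A) y ^+ #|Y| = (1 + y) ^+ #|A|.
Proof.
rewrite exprDn (partition_big (fun Y : {set T} => inord #|Y| : 'I_#|A|.+1) predT) //=.
apply: eq_bigr => k _; rewrite expr1n mul1r -[X in _ *+ X]cards_draws.
rewrite -[X in _ *+ X]sum1_card -[RHS]mulr_natr natr_sum mulr_sumr.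
under [RHS]eq_bigr do rewrite mulr1.
apply: eq_big => Y.
  rewrite !inE; case: (boolP (Y \subset A)) => //= YA.
  have h : (#|Y| < #|A|.+1)%N by rewrite ltnS subset_leq_card.
  by rewrite -(inj_eq val_inj) /= inordK.
case/andP => YA /eqP <-; rewrite inordK // ltnS subset_leq_card //.
Qed.

End SubsetGeneratingFunction.

(** * Overlap probabilities for one uniform [K]-subset *)

Section UniformSubsetProbability.
Variables (R : realFieldType) (T : finType).
Implicit Types (A B W X Y Z : {set T}) (phi psi : pred {set T}) (K s q : nat).

Definition Ek K (f : {set T} -> R) : R :=
  (\sum_(X : {set T} | #|X| == K) f X) / 'C(#|T|, K)%:R.

Definition Pk K phi : R := Ek K (fun X => (phi X)%:R).

Lemma PkE K phi : Pk K phi = (cnt K phi)%:R / 'C(#|T|, K)%:R.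
Proof.
rewrite /Pk /Ek; congr (_ / _); rewrite /cnt -sum1_card natr_sum.
rewrite [RHS](eq_bigl (fun X : {set T} => (#|X| == K) && phi X)); last by move=> X; rewrite inE.
by rewrite big_mkcondr; apply: eq_bigr => X _; case: (phi X).
Qed.

Lemma Pk_ge0 K phi : 0 <= Pk K phi.
Proof. by rewrite PkE divr_ge0 ?ler0n. Qed.

Lemma Pk_le K phi psi : (forall X, #|X| = K -> phi X -> psi X) -> Pk K phi <= Pk K psi.
Proof. by move=> h; rewrite !PkE ler_wpM2r ?invr_ge0 ?ler0n // ler_nat cnt_le. Qed.

Lemma eq_Pk K phi psi : (forall X, #|X| = K -> phi X = psi X) -> Pk K phi = Pk K psi.
Proof. by move=> h; rewrite !PkE (eq_cnt h). Qed.

Lemma Pk_or K phi psi : Pk K (fun X => phi X || psi X) <= Pk K phi + Pk K psi.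
Proof. by rewrite !PkE -mulrDl ler_wpM2r ?invr_ge0 ?ler0n // -natrD ler_nat cnt_or. Qed.

Lemma PkID K phi psi : Pk K phi = Pk K (fun X => phi X && psi X) + Pk K (fun X => phi X && ~~ psi X).
Proof. by rewrite !PkE -mulrDl -natrD -cntID. Qed.

Lemma Pk_has K (I : Type) (s : seq I) (phi : I -> pred {set T}) :
  Pk K (fun X => has (phi^~ X) s) <= \sum_(i <- s) Pk K (phi i).
Proof.
elim: s => [|i s IH] /=.
  by rewrite big_nil PkE (_ : cnt _ _ = 0%N) ?mul0r //; apply/eqP; rewrite cards_eq0;
    apply/eqP/setP => X; rewrite !inE andbF.
by rewrite big_cons (le_trans (Pk_or _ _ _)) // lerD2l.
Qed.

Lemma Ek_le K (f g : {set T} -> R) : (forall X, #|X| = K -> f X <= g X) -> Ek K f <= Ek K g.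
Proof.
move=> h; rewrite ler_wpM2r ?invr_ge0 ?ler0n //; apply: ler_sum => X /eqP; exact: h.
Qed.

Lemma Pk_markov K phi (f : {set T} -> R) (c : R) : 0 < c ->
  (forall X, 0 <= f X) -> (forall X, #|X| = K -> phi X -> c <= f X) -> Pk K phi <= Ek K f / c.
Proof.
move=> c0 f0 h; rewrite ler_pdivlMr // /Pk /Ek mulrAC ler_wpM2r ?invr_ge0 ?ler0n //.
rewrite mulr_suml; apply: ler_sum => X /eqP XK.
by case: (boolP (phi X)) => pX; rewrite ?mul0r // mul1r h.
Qed.

Section Size.
Variable K : nat.
Hypothesis KT : (K <= #|T|)%N.

Lemma bin_gt0R : 0 < 'C(#|T|, K)%:R :> R.
Proof. by rewrite ltr0n bin_gt0. Qed.

Lemma Ek_cst (c : R) : Ek K (fun=> c) = c.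
Proof.
rewrite /Ek sumr_const -card_draws.
rewrite (_ : #|_| = #|[set A : {set T} | #|A| == K]|); last by apply: eq_card => X; rewrite inE.
by rewrite card_draws -[c *+ _]mulr_natr mulfK // gt_eqF // bin_gt0R.
Qed.

Lemma PkC phi : Pk K (fun X => ~~ phi X) = 1 - Pk K phi.
Proof.
rewrite -[1](@divff _ 'C(#|T|, K)%:R) ?gt_eqF ?bin_gt0R // !PkE -mulrBl.
by rewrite -(cntC K phi) natrD addrAC subrr add0r.
Qed.

Lemma Pk_le1 phi : Pk K phi <= 1.
Proof. by rewrite -subr_ge0 -PkC Pk_ge0. Qed.

Lemma Pk_neg_assoc B q psi : downset psi ->
  Pk K (fun X => (#|X :&: B| < q)%N && psi (X :\: B)) <=
  Pk K (fun X => (#|X :&: B| < q)%N) * Pk K (fun X => psi (X :\: B)).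
Proof.
move=> dpsi; rewrite !PkE mulrA ler_wpM2r ?invr_ge0 ?ler0n //.
rewrite mulrAC ler_pdivlMr ?bin_gt0R // -!natrM ler_nat.
exact: cnt_neg_assoc.
Qed.

(** Complementing both events leaves their covariance unchanged, so the sign in [Pk_neg_assoc]
    carries over. *)
Lemma Pk_neg_assoc_up B q psi : downset psi ->
  Pk K (fun X => (q <= #|X :&: B|)%N && ~~ psi (X :\: B)) <=
  Pk K (fun X => (q <= #|X :&: B|)%N) * Pk K (fun X => ~~ psi (X :\: B)).
Proof.
move=> dpsi; have := Pk_neg_assoc B q dpsi.
have e1 : Pk K (fun X => (q <= #|X :&: B|)%N) = 1 - Pk K (fun X => (#|X :&: B| < q)%N).
  by rewrite -PkC; apply: eq_Pk => X _; rewrite -leqNgt.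
have e2 := PkID K (fun X => ~~ psi (X :\: B)) (fun X => (#|X :&: B| < q)%N).
have e3 := PkID K (fun X => (#|X :&: B| < q)%N) (fun X => psi (X :\: B)).
have e4 := PkC (fun X => psi (X :\: B)).
have e5 : Pk K (fun X => ~~ psi (X :\: B) && ~~ (#|X :&: B| < q)%N) =
  Pk K (fun X => (q <= #|X :&: B|)%N && ~~ psi (X :\: B)).
  by apply: eq_Pk => X _; rewrite -leqNgt andbC.
have e6 : Pk K (fun X => ~~ psi (X :\: B) && (#|X :&: B| < q)%N) =
  Pk K (fun X => (#|X :&: B| < q)%N && ~~ psi (X :\: B)).
  by apply: eq_Pk => X _; rewrite andbC.
rewrite e5 e6 in e2; move: e1 e2 e3 e4.
set a := Pk K (fun X => (q <= #|X :&: B|)%N).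
set b := Pk K (fun X => (#|X :&: B| < q)%N).
set c := Pk K (fun X => psi (X :\: B)).
set d := Pk K (fun X => ~~ psi (X :\: B)).
set e := Pk K (fun X => (#|X :&: B| < q)%N && ~~ psi (X :\: B)).
set f := Pk K (fun X => (q <= #|X :&: B|)%N && ~~ psi (X :\: B)).
set g := Pk K (fun X => (#|X :&: B| < q)%N && psi (X :\: B)).
move=> -> E2 E3 E4; have -> : f = 1 - c - (b - g) by lra.
by rewrite E4; nra.
Qed.

(** Induction on [s]: by disjointness the remaining constraints see only [X :\: B i], and they pass
    to subsets, so one factor splits off by negative association. *)
Lemma Pk_all_lt (I : eqType) (s : seq I) (B : I -> {set T}) q : uniq s ->
  {in s &, forall i j, i != j -> [disjoint B i & B j]} ->
  Pk K (fun X => all (fun i => #|X :&: B i| < q)%N s) <=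
  \prod_(i <- s) Pk K (fun X => #|X :&: B i| < q)%N.
Proof.
elim: s => [|i s IH] /=; first by rewrite big_nil Pk_le1.
case/andP => is_ us dB; rewrite big_cons.
pose psi Y := all (fun j => #|Y :&: B j| < q)%N s.
have dpsi : downset psi.
  move=> X Y XY /allP h; apply/allP => j js; apply: leq_ltn_trans (h j js).
  by apply: subset_leq_card; apply: setSI.
have e X : all (fun j => #|X :&: B j| < q)%N s = psi (X :\: B i).
  apply: eq_in_all => j js; congr (_ < _)%N; apply: eq_card => x; rewrite !inE.
  case: (boolP (x \in B j)) => xj; rewrite ?andbF // !andbT.
  have ij : j != i by apply: contraNneq is_ => <-.
  have := dB j i; rewrite !inE eqxx js orbT => /(_ isT isT ij) /disjointFr -> //.
under eq_Pk do rewrite e.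
apply: le_trans (Pk_neg_assoc (B i) q dpsi) _.
apply: ler_wpM2l; first exact: Pk_ge0.
under eq_Pk do rewrite -e.
apply: IH => // j k js ks; apply: dB; rewrite inE ?js ?ks orbT //.
Qed.

(** By disjointness the overlap with [B] is that of [X :\: A], and its being below [r] defines a
    down-set. *)
Lemma Pk_both_ge A B q r : [disjoint A & B] ->
  Pk K (fun X => (q <= #|X :&: A|) && (r <= #|X :&: B|))%N <=
  Pk K (fun X => q <= #|X :&: A|)%N * Pk K (fun X => r <= #|X :&: B|)%N.
Proof.
move=> dAB; pose psi Y := (#|Y :&: B| < r)%N.
have dpsi : downset psi.
  move=> X Y XY; apply: leq_ltn_trans.
  by apply: subset_leq_card; apply: setSI.
have e X : (r <= #|X :&: B|)%N = ~~ psi (X :\: A).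
  rewrite /psi -leqNgt; congr (_ <= _)%N; apply: eq_card => x; rewrite !inE.
  case: (boolP (x \in B)) => xj; rewrite ?andbF // !andbT.
  by rewrite (disjointFl dAB).
rewrite (eq_Pk (fun X _ => e X)).
apply: le_trans (Pk_neg_assoc_up A q dpsi); apply: Pk_le => X _.
by rewrite e.
Qed.

Lemma Pk_mem x : Pk K (fun X => x \in X) = K%:R / #|T|%:R.
Proof.
have T0 : (0 < #|T|)%N by apply/card_gt0P; exists x.
case: (posnP K) => [K0|K0].
  rewrite K0 mul0r PkE (_ : cnt _ _ = 0%N) ?mul0r //; apply/eqP; rewrite cards_eq0.
  apply/eqP/setP => X; rewrite !inE cards_eq0.
  by case: eqP => //= ->; rewrite inE.
rewrite PkE.
have -> : cnt K (fun X => x \in X) = 'C(#|T|.-1, K.-1).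
  have := @cnt_split _ [set x] 1 K xpredT xpredT K0.
  rewrite -[X in (_ = X * _)%N]/(lay [set x] 1 xpredT) -[X in (_ = _ * X)%N]/(lay (~: [set x]) (K - 1)%N xpredT).
  rewrite !lay_true cards1 cardsC1 bin1 mul1n subn1 => <-; apply: eq_cnt => X _.
  rewrite !andbT; apply/idP/idP => [xX|].
    by rewrite (_ : X :&: [set x] = [set x]) ?cards1 //; apply/setIidPr; rewrite sub1set.
  by apply: contraTT => xX; rewrite (_ : X :&: [set x] = set0) ?cards0 //;
   apply/setP => y; rewrite !inE; apply/negbTE; apply: contra xX => /andP[yX /eqP <-].
have C0 : 'C(#|T|, K)%:R != 0 :> R by rewrite gt_eqF ?bin_gt0R.
have T0R : #|T|%:R != 0 :> R by rewrite gt_eqF ?ltr0n.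
apply/eqP; rewrite eqr_div // -!natrM eqr_nat; apply/eqP.
by have := mul_bin_diag #|T| K.-1; rewrite prednK // mulnC => ->; rewrite mulnC.
Qed.

(** One key at a time: containing [x] is negatively associated with containing the other keys, so
    independent inclusion with density [K / #|T|] is an upper bound. *)
Lemma Pk_subset Y : Pk K (fun X => Y \subset X) <= (K%:R / #|T|%:R) ^+ #|Y|.
Proof.
move: {2}#|Y| (erefl #|Y|) => k; elim: k Y => [|k IH] Y Yk.
  by rewrite Yk expr0 Pk_le1.
have [x xY] : exists x, x \in Y by apply/card_gt0P; rewrite Yk.
have Yk' : #|Y :\ x| = k by have := cardsD1 x Y; rewrite xY Yk add1n => -[].
rewrite Yk exprS -[X in _ ^+ X]Yk'; apply: le_trans (ler_wpM2l _ (IH _ Yk')); last first.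
  by rewrite divr_ge0 ?ler0n.
pose psi Z := ~~ (Y :\ x \subset Z).
have dpsi : downset psi.
  by move=> X Z XZ; apply: contra => h; apply: (fintype.subset_trans h XZ).
have e1 X : (Y :\ x \subset X) = ~~ psi (X :\: [set x]).
  by rewrite /psi negbK subsetD1 setD11 andbT.
have e2 X : (x \in X) = (1 <= #|X :&: [set x]|)%N.
  apply/idP/idP => [xX|].
    by rewrite (_ : X :&: [set x] = [set x]) ?cards1 //; apply/setIidPr; rewrite sub1set.
  by move/card_gt0P => [y]; rewrite !inE => /andP[yX /eqP <-].
rewrite -(Pk_mem x); under [in leRHS]eq_Pk do rewrite e2.
under [X in _ * X]eq_Pk do rewrite e1.
apply: le_trans (Pk_neg_assoc_up [set x] 1 dpsi); apply: Pk_le => X _ YX.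
by rewrite -e1 -e2 (fintype.subsetP YX) //= (fintype.subset_trans _ YX) // subsetDl.
Qed.

(** Expanding the power over the subsets of the overlap and applying [Pk_subset] dominates the
    overlap by a binomial variable with [#|W|] trials, whose generating function is the right-hand
    side. *)
Lemma Ek_expr_inter W (y : R) : 0 <= y ->
  Ek K (fun X => (1 + y) ^+ #|X :&: W|) <= (1 + y * (K%:R / #|T|%:R)) ^+ #|W|.
Proof.
move=> y0; rewrite -sum_subsets_exp /Ek.
under [X in X / _ <= _]eq_bigr do rewrite -sum_subsets_exp.
have -> : \sum_(X : {set T} | #|X| == K) \sum_(Y : {set T} | Y \subset X :&: W) y ^+ #|Y| =
   \sum_(Y : {set T} | Y \subset W) y ^+ #|Y| * \sum_(X : {set T} | #|X| == K) (Y \subset X)%:R.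
  rewrite (exchange_big_dep (fun Y : {set T} => Y \subset W)) /=; last first.
    by move=> X Y _; rewrite subsetI => /andP[].
  apply: eq_bigr => Y YW; rewrite mulr_sumr [RHS]big_mkcond [LHS]big_mkcond /=.
  apply: eq_bigr => X _; rewrite subsetI YW andbT; case: (#|X| == K) => //=.
  by case: (Y \subset X); rewrite ?mulr1 ?mulr0.
rewrite mulr_suml; apply: ler_sum => Y YW.
by rewrite -mulrA exprMn ler_wpM2l ?exprn_ge0 // -/(Ek K _) -/(Pk K _) Pk_subset.
Qed.

(** The overlap with a set is hypergeometric, so its law depends on the size of that set alone. This
    makes the key-sharing probability one constant for all rings. *)
Lemma Pk_card_ge (A B : {set T}) q : #|A| = #|B| ->
  Pk K (fun X => (q <= #|X :&: A|)%N) = Pk K (fun X => (q <= #|X :&: B|)%N).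
Proof.
have h (C : {set T}) : cnt K (fun X => (q <= #|X :&: C|)%N) =
  (\sum_(s < K.+1 | q <= s) 'C(#|C|, s) * 'C(#|T| - #|C|, K - s))%N.
  rewrite (cnt_sum C) [RHS]big_mkcond; apply: eq_bigr => s _.
  have [qs|qs] := boolP (q <= s)%N.
    have -> : (#|T| - #|C| = #|~: C|)%N by rewrite [RHS]cardsCs setCK.
    rewrite -(lay_true C) -(lay_true (~: C)) -cnt_split; last by rewrite -ltnS.
    by apply: eq_cnt => X _; case: eqP => //= ->; rewrite qs.
  by apply/eqP; rewrite cards_eq0; apply/eqP/setP => X; rewrite !inE; case: eqP => //= _;
    case: eqP => //= ->; rewrite (negbTE qs).
by move=> AB; rewrite !PkE !h AB.
Qed.

(** Given an overlap of size [q], the trace on [A] is a uniform [q]-subset of [A], which contains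
    [x] with probability [q / #|A|]. *)
Lemma Pk_mem_layer A q x : x \in A -> (0 < q)%N -> (q <= K)%N ->
  #|A|%:R * Pk K (fun X => (x \in X) && (#|X :&: A| == q)) = q%:R * Pk K (fun X => #|X :&: A| == q).
Proof.
move=> xA q0 qK; rewrite !PkE !mulrA -!natrM; congr (_%:R / _).
have A0 : (0 < #|A|)%N by apply/card_gt0P; exists x.
have := @cnt_split _ A q K xpredT xpredT qK.
have := @cnt_split _ A q K (fun Y => x \in Y) xpredT qK.
set e := #|[set Y : {set T} | [&& Y \subset A, #|Y| == q & x \in Y]]|.
rewrite -[X in _ -> (_ = X * _)%N -> _]/(lay A q xpredT) lay_true => E1 E2.
have -> : cnt K (fun X => #|X :&: A| == q) = cnt K (fun X => [&& #|X :&: A| == q, xpredT (X :&: A) & xpredT (X :\: A)]).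
  by apply: eq_cnt => X _; rewrite !andbT.
have -> : cnt K (fun X => (x \in X) && (#|X :&: A| == q)) =
   cnt K (fun X => [&& #|X :&: A| == q, x \in (X :&: A) & xpredT (X :\: A)]).
  by apply: eq_cnt => X _; rewrite !inE xA !andbT andbC.
rewrite E1 E2 !mulnA; congr (_ * _)%N.
have := mul_bin_diag #|A| q.-1; rewrite prednK // mulnC => <-; rewrite mulnC; congr (_ * _)%N.
have <- : #|A :\ x| = #|A|.-1 by rewrite (cardsD1 x A) xA.
rewrite -cards_draws.
have inj : {in [set Y : {set T} | Y \subset A :\ x & #|Y| == q.-1] &, injective (fun Y => x |: Y)}.
  move=> Y Z; rewrite !inE !subsetD1 => /andP[/andP[_ Yx] _] /andP[/andP[_ Zx] _] E.
  by rewrite -(setU1K Yx) -(setU1K Zx) E.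
rewrite -(card_in_imset inj); apply: eq_card => Y; rewrite !inE.
apply/idP/imsetP => [/and3P[YA /eqP Yq xY]|[Z]].
  exists (Y :\ x); last by rewrite setD1K.
  by rewrite inE setSD //= -Yq (cardsD1 x Y) xY.
rewrite inE subsetD1 => /andP[/andP[ZA Zx] /eqP Zq] ->.
by rewrite subUset sub1set xA ZA cardsU1 Zx Zq add1n prednK // eqxx setU11.
Qed.

(** Either the overlap has exactly [q] keys and contains [x] with conditional probability [q / K],
    or [A] without [x] is still met in [q] keys. The latter is negatively associated with [x \in X],
    whose probability [K / #|T|] is at most [1 / K]. The two shares add up to [(q + 1) / K]. *)
Lemma Pk_mem_ge A q x : #|A| = K -> x \in A -> (0 < q)%N -> (K ^ 2 <= #|T|)%N ->
  Pk K (fun X => (x \in X) && (q <= #|X :&: A|)%N) <=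
  q.+1%:R / K%:R * Pk K (fun X => (q <= #|X :&: A|)%N).
Proof.
move=> AK xA q0 KP.
have K0 : (0 < K)%N by rewrite -AK; apply/card_gt0P; exists x.
have T0 : (0 < #|T|)%N by apply: leq_trans KT.
have hp : Pk K (fun X => (q <= #|X :&: (A :\ x)|)%N) <= Pk K (fun X => (q <= #|X :&: A|)%N).
  apply: Pk_le => X _; move/leq_trans; apply; apply: subset_leq_card; apply: setIS; exact: subsetDl.
set p := Pk K (fun X => (q <= #|X :&: A|)%N) in hp *.
have h1 : Pk K (fun X => (x \in X) && (q <= #|X :&: (A :\ x)|)%N) <= K%:R^-1 * p.
  rewrite (@eq_Pk _ _ (fun X => (1 <= #|X :&: [set x]|) && (q <= #|X :&: (A :\ x)|))%N); last first.
    move=> X _; congr (_ && _); rewrite lt0n cards_eq0; apply/idP/set0Pn => [xX|[y]].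
      by exists x; rewrite !inE xX eqxx.
    by rewrite !inE => /andP[yX /eqP <-].
  apply: le_trans (Pk_both_ge _ _ _) _; first by rewrite disjoints1 setD11.
  rewrite (@eq_Pk _ _ (fun X => (x \in X))); last first.
    move=> X _; rewrite lt0n cards_eq0; apply/set0Pn/idP => [[y]|xX].
      by rewrite !inE => /andP[yX /eqP <-].
    by exists x; rewrite !inE xX eqxx.
  rewrite Pk_mem; apply: ler_pM => //; rewrite ?Pk_ge0 ?divr_ge0 ?ler0n //.
  rewrite ler_pdivrMr ?ltr0n // mulrC ler_pdivlMr ?ltr0n // -natrM ler_nat mulnn //.
have h2 : Pk K (fun X => (x \in X) && (#|X :&: A| == q)) <= q%:R / K%:R * p.
  case: (leqP q K) => qK; last first.
    suff -> : Pk K (fun X => (x \in X) && (#|X :&: A| == q)) = 0.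
      by apply: mulr_ge0; [rewrite divr_ge0 ?ler0n|exact: Pk_ge0].
    rewrite PkE (_ : cnt _ _ = 0%N) ?mul0r //; apply/eqP; rewrite cards_eq0; apply/eqP/setP => X.
    rewrite !inE; apply/negbTE/negP => /and3P[/eqP XK _ /eqP E].
    by move: qK; rewrite -E -XK ltnNge subset_leq_card // subsetIl.
  rewrite mulrAC ler_pdivlMr ?ltr0n // mulrC -[X in X%:R * _]AK Pk_mem_layer // ler_wpM2l ?ler0n //.
  by apply: Pk_le => X _ /eqP ->.
have -> : q.+1%:R / K%:R * p = K%:R^-1 * p + q%:R / K%:R * p by rewrite -natr1; ring.
apply: le_trans (lerD h1 h2); apply: le_trans (Pk_or _ _ _); apply: Pk_le => X _ /andP[xX h].
rewrite xX /=; move: h; rewrite leq_eqVlt => /orP[/eqP ->|h]; first by rewrite eqxx orbT.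
apply/orP; left; have := cardsD1 x (X :&: A); rewrite !inE xX xA /= add1n.
by rewrite -setIDA => h'; rewrite h' ltnS in h.
Qed.

(** A set that meets [A] but not [B] in [q] keys contains a key of [A :\: B]. There are at most
    [e K] such keys, and each costs a share [(q + 1) / K] by [Pk_mem_ge]. *)
Lemma Pk_ge_private A B q (e : R) : #|A| = K -> (0 < q)%N -> (0 < K)%N -> (K ^ 2 <= #|T|)%N ->
  #|A :\: B|%:R <= e * K%:R ->
  (1 - e * q.+1%:R) * Pk K (fun X => (q <= #|X :&: A|)%N) <= Pk K (fun X => (q <= #|X :&: B|)%N).
Proof.
move=> AK q0 K0 KP eK.
set p := Pk K (fun X => (q <= #|X :&: A|)%N).
have p0 : 0 <= p by exact: Pk_ge0.
have h : p <= Pk K (fun X => (q <= #|X :&: B|)%N) + \sum_(x <- enum (A :\: B)) q.+1%:R / K%:R * p.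
  apply: (@le_trans _ _ (Pk K (fun X => (q <= #|X :&: B|)%N) +
     \sum_(x <- enum (A :\: B)) Pk K (fun X => (x \in X) && (q <= #|X :&: A|)%N))); last first.
    rewrite lerD2l !big_enum /=; apply: ler_sum => x; rewrite inE => /andP[_ xA].
    exact: Pk_mem_ge.
  apply: le_trans (lerD (lexx _) (Pk_has _ _ _)); apply: le_trans (Pk_or _ _ _).
  apply: Pk_le => X _ qA.
  have [//|qB] := boolP (q <= #|X :&: B|)%N; rewrite /= .
  have : ~~ (X :&: A \subset X :&: B).
    by apply: contra qB => /subset_leq_card; apply: leq_trans.
  case/subsetPn => x; rewrite !inE => /andP[xX xA]; rewrite xX /= => xB.
  by apply/hasP; exists x; rewrite ?mem_enum ?inE ?xB ?xX.
have h2 : \sum_(x <- enum (A :\: B)) q.+1%:R / K%:R * p <= e * q.+1%:R * p.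
  rewrite big_enum /= sumr_const -[leLHS]mulr_natl mulrA; apply: ler_wpM2r => //.
  rewrite mulrA mulrAC; apply: ler_wpM2r => //; rewrite ?ler0n //.
  by rewrite ler_pdivrMr ?ltr0n.
rewrite mulrBl mul1r; lra.
Qed.

(** Either [A :\: B] alone is met in [q] keys, which is negatively associated with the overlap with
    [B], or [X] contains a common key of [A] and [B], each of which is charged by [Pk_mem_ge]. *)
Lemma Pk_both_le A B q : #|A| = K -> #|B| = K -> (0 < q)%N -> (0 < K)%N -> (K ^ 2 <= #|T|)%N ->
  Pk K (fun X => (q <= #|X :&: A|)%N && (q <= #|X :&: B|)%N) <=
  Pk K (fun X => (q <= #|X :&: A|)%N) * (Pk K (fun X => (q <= #|X :&: A|)%N) + q.+1%:R / K%:R * #|B :&: A|%:R).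
Proof.
move=> AK BK q0 K0 KP; set p := Pk K (fun X => (q <= #|X :&: A|)%N).
have p0 : 0 <= p by exact: Pk_ge0.
have h1 : Pk K (fun X => (q <= #|X :&: (A :\: B)|)%N && (q <= #|X :&: B|)%N) <= p * p.
  apply: le_trans (Pk_both_ge _ _ _) _.
    by rewrite disjoint_sym disjoints_subset setDE setCI setCK finset.subsetUr.
  apply: ler_pM; rewrite ?Pk_ge0 //; last by rewrite (@Pk_card_ge B A q) // BK AK.
  apply: Pk_le => X _ h; apply: leq_trans h _; apply: subset_leq_card; apply: setIS; exact: subsetDl.
have h2 : \sum_(x <- enum (B :&: A)) Pk K (fun X => (x \in X) && (q <= #|X :&: A|)%N) <=
   p * (q.+1%:R / K%:R * #|B :&: A|%:R).
  rewrite !big_enum /=; apply: (@le_trans _ _ (\sum_(x in B :&: A) q.+1%:R / K%:R * p)).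
    by apply: ler_sum => x; rewrite inE => /andP[_ xA]; exact: Pk_mem_ge.
  by rewrite sumr_const -[leLHS]mulr_natr [leRHS]mulrA (mulrC p) lexx.
rewrite mulrDr; apply: le_trans (lerD h1 h2); apply: le_trans (lerD (lexx _) (Pk_has _ _ _)).
apply: le_trans (Pk_or _ _ _); apply: Pk_le => X _ /andP[qA qB]; rewrite qB andbT.
have [//|nq] := boolP (q <= #|X :&: (A :\: B)|)%N; rewrite /=.
have : ~~ (X :&: A \subset X :&: (A :\: B)).
  by apply: contra nq => /subset_leq_card; apply: leq_trans.
case/subsetPn => x; rewrite !inE => /andP[xX xA]; rewrite xX xA /= andbT negbK => xB.
by apply/hasP; exists x; rewrite ?mem_enum ?inE ?xB ?xX ?xA.
Qed.

(** As [q >= 1], some key of [A] must be shared, and each of the [K] candidates has probability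
    [K / #|T|]. This is what sends [p_s] to 0 with [K ^ 2 / P]. *)
Lemma Pk_ge_le_sq A q : #|A| = K -> (0 < q)%N ->
  Pk K (fun X => (q <= #|X :&: A|)%N) <= K%:R ^+ 2 / #|T|%:R.
Proof.
move=> AK q0.
apply: (@le_trans _ _ (\sum_(x <- enum A) Pk K (fun X => x \in X))).
  apply: le_trans (Pk_has _ _ _); apply: Pk_le => X _ h.
  have /card_gt0P[x] : (0 < #|X :&: A|)%N by apply: leq_trans h.
  by rewrite inE => /andP[xX xA]; apply/hasP; exists x; rewrite ?mem_enum.
under eq_bigr do rewrite Pk_mem.
by rewrite big_enum /= sumr_const AK -[leLHS]mulr_natl mulrA expr2.
Qed.

End Size.
End UniformSubsetProbability.

(** * Independent key rings: resampling, sequential revelation, absence of links *)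

Section KeyRings.
Variables (R : realFieldType) (T : finType) (n K : nat).
Hypothesis KT : (K <= #|T|)%N.
Notation rings := {ffun 'I_n -> {set T}}.
Implicit Types (f : rings) (i j k : 'I_n) (x : {set T}).

Definition ok f := [forall i, #|f i| == K].

Definition Er (Phi : rings -> R) : R := (\sum_(f | ok f) Phi f) / 'C(#|T|, K)%:R ^+ n.

Lemma ErE Phi : Er Phi = (\sum_(f | ok f) Phi f) / 'C(#|T|, K)%:R ^+ n.
Proof. by []. Qed.

Definition upd f i x : rings := [ffun j => if j == i then x else f j].

Lemma updE f i x : upd f i x i = x.
Proof. by rewrite ffunE eqxx. Qed.

Lemma updN f i x j : j != i -> upd f i x j = f j.
Proof. by rewrite ffunE => /negbTE ->. Qed.

Let C0 : 0 < 'C(#|T|, K)%:R :> R. Proof. exact: bin_gt0R. Qed.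

Lemma Er_ext Phi Psi : (forall f, ok f -> Phi f = Psi f) -> Er Phi = Er Psi.
Proof. by move=> h; congr (_ / _); apply: eq_bigr. Qed.

Lemma Er_le Phi Psi : (forall f, ok f -> Phi f <= Psi f) -> Er Phi <= Er Psi.
Proof.
by move=> h; rewrite ler_wpM2r ?invr_ge0 ?exprn_ge0 ?ler0n //; apply: ler_sum.
Qed.

Lemma Er_ge0 Phi : (forall f, ok f -> 0 <= Phi f) -> 0 <= Er Phi.
Proof. by move=> h; rewrite divr_ge0 ?exprn_ge0 ?ler0n // sumr_ge0. Qed.

Lemma Er_sum (I : Type) (s : seq I) (P : pred I) (Phi : I -> rings -> R) :
  Er (fun f => \sum_(i <- s | P i) Phi i f) = \sum_(i <- s | P i) Er (Phi i).
Proof. by rewrite /Er exchange_big /= mulr_suml. Qed.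

Lemma ErD Phi Psi : Er (fun f => Phi f + Psi f) = Er Phi + Er Psi.
Proof. by rewrite /Er big_split mulrDl. Qed.

Lemma ErZ c Phi : Er (fun f => c * Phi f) = c * Er Phi.
Proof. by rewrite /Er -mulr_sumr mulrA. Qed.

Lemma card_ok : #|[set f | ok f]| = ('C(#|T|, K) ^ n)%N.
Proof.
rewrite -card_draws -[n in RHS]card_ord -card_ffun_on; apply: eq_card => f.
rewrite !inE; apply/forallP/ffun_onP => h i; last by have := h i; rewrite inE.
by rewrite inE.
Qed.

Lemma Er_cst c : Er (fun=> c) = c.
Proof.
rewrite /Er sumr_const (_ : #|_| = #|[set f | ok f]|); last by apply: eq_card => f; rewrite inE.
by rewrite card_ok -[c *+ _]mulr_natr natrX mulfK // expf_neq0 // gt_eqF.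
Qed.

Lemma ok_upd f i x : ok f -> #|x| = K -> ok (upd f i x).
Proof.
move=> /forallP h xK; apply/forallP => j; rewrite ffunE.
by case: (j == i); rewrite ?xK ?h.
Qed.

(** Independence and uniformity of ring [i] in a single identity, from which the later
    factorisations follow. *)
Lemma Er_resample i Phi : Er Phi = Er (fun f => Ek K (fun x => Phi (upd f i x))).
Proof.
suff E : \sum_(f | ok f) \sum_(x : {set T} | #|x| == K) Phi (upd f i x) =
    'C(#|T|, K)%:R * \sum_(f | ok f) Phi f.
  rewrite /Er /Ek; congr (_ / _); rewrite -mulr_suml E mulrAC mulfV ?mul1r //.
  by rewrite gt_eqF.
rewrite pair_big /=.
(* Exchanging ring [i] with the fresh ring is an involution of the pairs, so it preserves the sum
   over all of them. *)
pose h (p : rings * {set T}) := (upd p.1 i p.2, p.1 i).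
have hh : involutive h.
  case=> f x; rewrite /h /= updE; congr (_, _); apply/ffunP => j; rewrite !ffunE.
  by case: eqP => // ->.
rewrite (reindex_inj (inv_inj hh)) /=.
rewrite (eq_big (fun p : rings * {set T} => ok p.1 && (#|p.2| == K)) (fun p => Phi p.1)); first last.
- case=> f x _ /=; congr (Phi _); apply/ffunP => j; rewrite !ffunE.
  by case: eqP => // ->.
- case=> f x /=; apply/andP/andP => -[/forallP a /eqP b]; split.
  + apply/forallP => j; case: (eqVneq j i) => [->|ji]; first by rewrite b.
    by have := a j; rewrite updN.
  + by have := a i; rewrite updE.
  + by apply: ok_upd => //; apply/forallP.
  + exact: a.
rewrite -(pair_big_dep (fun f => ok f) (fun _ x => #|x| == K) (fun f _ => Phi f)) /=.
rewrite mulr_sumr; apply: eq_bigr => f _.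
by rewrite -[in RHS](Ek_cst KT (Phi f)) /Ek mulrCA mulfV ?mulr1 // gt_eqF.
Qed.

Lemma EkZ (c : R) (g : {set T} -> R) : Ek K (fun x => c * g x) = c * Ek K g.
Proof. by rewrite /Ek -mulr_sumr mulrA. Qed.

Lemma eq_Ek (g h : {set T} -> R) : (forall x, #|x| = K -> g x = h x) -> Ek K g = Ek K h.
Proof. by move=> e; congr (_ / _); apply: eq_bigr => x /eqP; exact: e. Qed.

(** The rings in [J] are averaged one by one: [G] and the second argument of [phi] may read other
    rings, but by the two invariance hypotheses none in [J]. *)
Lemma Er_prod_out (J : seq 'I_n) (G : rings -> R) (phi : 'I_n -> rings -> {set T} -> R) :
  uniq J -> (forall f i x, i \in J -> G (upd f i x) = G f) ->
  (forall f i j x y, i \in J -> j \in J -> phi j (upd f i x) y = phi j f y) ->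
  Er (fun f => G f * \prod_(j <- J) phi j f (f j)) =
  Er (fun f => G f * \prod_(j <- J) Ek K (phi j f)).
Proof.
elim: J G => [|j s IH] G /=; first by move=> _ _ _; apply: Er_ext => f _; rewrite !big_nil.
case/andP => js us hG hphi; rewrite (Er_resample j).
transitivity (Er (fun f => (G f * Ek K (phi j f)) * \prod_(k <- s) phi k f (f k))).
  apply: Er_ext => f _; rewrite mulrAC -EkZ; apply: eq_Ek => x _.
  rewrite big_cons hG ?mem_head // updE hphi ?mem_head // -[RHS]mulrA [X in _ = _ * X]mulrC.
  congr (_ * (_ * _)); apply: eq_big_seq => k ks.
  rewrite hphi ?mem_head ?inE ?ks ?orbT // updN //.
  by apply: contraNneq js => <-.
rewrite IH //; last 2 first.
- move=> f i x is_; rewrite hG ?inE ?is_ ?orbT //; congr (_ * _); apply: eq_Ek => y _.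
  by rewrite hphi ?mem_head ?inE ?is_ ?orbT.
- by move=> f i k x y is_ ks; rewrite hphi ?inE ?is_ ?ks ?orbT.
by apply: Er_ext => f _; rewrite big_cons mulrA.
Qed.

Lemma Er_one i (g : {set T} -> R) : Er (fun f => g (f i)) = Ek K g.
Proof.
rewrite (Er_resample i) -[RHS]Er_cst; apply: Er_ext => f _.
by apply: eq_Ek => x _; rewrite updE.
Qed.

Lemma Er_two i k (g : {set T} -> {set T} -> R) : i != k ->
  Er (fun f => g (f i) (f k)) = Ek K (fun x => Ek K (g x)).
Proof.
move=> ik; rewrite (Er_resample k) -(Er_one i); apply: Er_ext => f _.
by apply: eq_Ek => x _; rewrite updE updN.
Qed.

(** A supermartingale-type bound: averaging the last ring costs at most [c i], and the earlier
    factors do not see it. The conditional bound is required only where all earlier factors are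
    nonzero, so it may assume that the earlier steps succeeded. *)
Lemma Er_seq_prod (phi : 'I_n -> rings -> R) (c : 'I_n -> R) (m : nat) :
  (forall i, 0 <= c i) ->
  (forall i f, ok f -> 0 <= phi i f) ->
  (forall i j f x, (i < j)%N -> phi i (upd f j x) = phi i f) ->
  (forall i f, ok f -> (forall l : 'I_n, (l < i)%N -> phi l f != 0) ->
     Ek K (fun x => phi i (upd f i x)) <= c i) ->
  (m <= n)%N ->
  Er (fun f => \prod_(i < n | (i < m)%N) phi i f) <= \prod_(i < n | (i < m)%N) c i.
Proof.
move=> c0 phi0 hphi hc; elim: m => [|m IH] mn.
  by rewrite big_pred0 //; under [Er _](Er_ext) => f _ do rewrite big_pred0 //; rewrite Er_cst.
pose i := Ordinal mn.
have E (F : 'I_n -> R) : \prod_(j < n | (j < m.+1)%N) F j = F i * \prod_(j < n | (j < m)%N) F j.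
  rewrite (bigD1 i) //=; congr (_ * _); apply: eq_bigl => j.
  by rewrite ltnS ltn_neqAle andbC -(inj_eq val_inj).
rewrite E; apply: le_trans (ler_wpM2l (c0 i) (IH (ltnW mn))); rewrite -ErZ.
rewrite (Er_resample i); apply: Er_le => f okf.
rewrite [leLHS](@eq_Ek _ (fun x => (\prod_(j < n | (j < m)%N) phi j f) * phi i (upd f i x))); last first.
  move=> x _; rewrite E mulrC; congr (_ * _); apply: eq_bigr => j jm; exact: hphi.
rewrite EkZ mulrC.
have P0 : 0 <= \prod_(j < n | (j < m)%N) phi j f by apply: prodr_ge0 => j _; exact: phi0.
have [->|/prodf_neq0 nz] := eqVneq (\prod_(j < n | (j < m)%N) phi j f) 0.
  by rewrite !mulr0.
by apply: ler_wpM2r => //; apply: hc => // l lm; apply: nz.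
Qed.

Definition prev_keys f i := \bigcup_(l < n | (l < i)%N) f l.

Definition good_rings (e : R) f := [forall i, #|f i :&: prev_keys f i|%:R <= e * K%:R].

Variable q : nat.
Hypotheses (q0 : (0 < q)%N) (K0 : (0 < K)%N) (KP : (K ^ 2 <= #|T|)%N).

(* Reveal the rings in increasing order of index: on good rings the private part of each earlier ring
   has at least [(1 - e) K] keys, and the private parts are disjoint, so negative association applies. *)
Lemma Er_no_edge (p e : R) (F : 'I_n -> {set 'I_n}) :
  (forall A : {set T}, #|A| = K -> Pk R K (fun X => (q <= #|X :&: A|)%N) = p) ->
  0 <= e -> e * q.+1%:R <= 1 ->
  (forall i j, j \in F i -> (j < i)%N) ->
  Er (fun f => (good_rings e f && [forall i, forall j in F i, (#|f i :&: f j| < q)%N])%:R) <=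
  (1 - (1 - e * q.+1%:R) * p) ^+ (\sum_i #|F i|).
Proof.
move=> hp e0 eq1 Flt.
(* Goodness of step [i] is built into its factor, so nonzero earlier factors certify that the
   earlier rings have large private parts. *)
pose phi i f : R := ((#|f i :&: prev_keys f i|%:R <= e * K%:R) &&
   [forall j in F i, (#|f i :&: f j| < q)%N])%:R.
have p01 : 0 <= p <= 1.
  have [A AK] : exists A : {set T}, #|A| = K.
    have : (0 < #|[set A : {set T} | #|A| == K]|)%N by rewrite card_draws bin_gt0.
    by case/card_gt0P => A; rewrite inE => /eqP ?; exists A.
  by rewrite -(hp _ AK) Pk_ge0 Pk_le1.
pose c := 1 - (1 - e * q.+1%:R) * p.
have eq0 : 0 <= e * q.+1%:R by rewrite mulr_ge0 ?ler0n.
have c0 : 0 <= c by rewrite /c; case/andP: p01 => p0 p1; nra.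
have upd_prev f i j x : (i <= j)%N -> prev_keys (upd f j x) i = prev_keys f i.
  move=> ij; apply: eq_bigr => l li; rewrite updN //.
  by apply: contraTneq li => ->; rewrite -leqNgt.
have updF f i j k x : (i <= j)%N -> k \in F i -> upd f j x k = f k.
  move=> ij ki; rewrite updN //; apply: contraTneq ki => -> .
  by apply/negP => /Flt; rewrite ltnNge ij.
have main : Er (fun f => \prod_(i < n | (i < n)%N) phi i f) <= \prod_(i < n | (i < n)%N) c ^+ #|F i|.
  apply: Er_seq_prod => //.
  - by move=> i; exact: exprn_ge0.
  - move=> i j f x ij; rewrite /phi upd_prev ?(ltnW ij) // updN; last first.
      by apply: contraTneq ij => ->; rewrite ltnn.
    congr ((_ && _)%:R); apply: eq_forallb_in => k ki; by rewrite (updF f i j) // ltnW.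
  - move=> i f okf hl.
    pose S := enum (F i).
    (* The rings themselves may intersect; the keys that ring [j] is the first to use are disjoint
       for distinct [j]. *)
    pose B j := f j :\: prev_keys f j.
    have dB : {in S &, forall j k, j != k -> [disjoint B j & B k]}.
      move=> j k _ _; rewrite -(inj_eq val_inj) /= neq_ltn.
      have D (u v : 'I_n) : (u < v)%N -> [disjoint B u & B v].
        move=> uv; rewrite disjoints_subset; apply/fintype.subsetP => y; rewrite !inE.
        case/andP => _ yu; rewrite negb_and negbK; apply/orP; left.
        by apply/bigcupP; exists u.
      by case/orP => h; [exact: D|rewrite disjoint_sym; exact: D].
    have := Pk_all_lt R KT q (enum_uniq _) dB.
    rewrite /S big_enum /= => h.
    apply: (@le_trans _ _ (\prod_(j in F i) Pk R K (fun X => (#|X :&: B j| < q)%N))).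
      apply: le_trans h; apply: Ek_le => x xK; rewrite ler_nat /phi updE.
      case: (boolP (_ && _)) => // /andP[_ /forall_inP hx].
      rewrite lt0b; apply/allP => j; rewrite mem_enum => jF.
      have := hx j jF; rewrite (updF f i i j) //.
      apply: leq_ltn_trans; apply: subset_leq_card; apply: setIS; exact: subsetDl.
    rewrite -prodr_const; apply: ler_prod => j jF; rewrite Pk_ge0 /=.
    have fjK : #|f j| = K by move/forallP: okf => /(_ j)/eqP.
    have := Pk_ge_private KT fjK q0 K0 KP (B := B j) (e := e).
    rewrite (hp _ fjK) => /(_ _).
    have -> : Pk R K (fun X => (#|X :&: B j| < q)%N) = 1 - Pk R K (fun X => (q <= #|X :&: B j|)%N).
      by rewrite -PkC //; apply: eq_Pk => X _; rewrite -ltnNge.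
    rewrite /c => hh; rewrite lerD2l lerN2; apply: hh.
    rewrite /B setDDr setDv set0U.
    have := hl j (Flt _ _ jF); rewrite /phi pnatr_eq0 eqb0 negbK => /andP[h1 _].
    exact: h1.
have en := @ltn_ord n : (fun i : 'I_n => (i < n)%N) =1 xpredT.
move: main; rewrite (eq_bigl _ _ en) prodrXr; apply: le_trans.
apply: Er_le => f okf; rewrite (eq_bigl _ _ en).
case: (boolP (_ && _)) => [/andP[/forallP g /forallP h]|_]; last by apply: prodr_ge0 => i _; rewrite ler0n.
by rewrite big1 // => i _; rewrite /phi g h.
Qed.

(** Given the earlier rings, ring [i] is uniform and faces a fixed set of at most [n K] keys; the
    factor [n] is the union bound over [i]. *)
Lemma Er_bad_rings (e : R) (b : R) :
  (forall W : {set T}, (#|W| <= n * K)%N -> Pk R K (fun X => ~~ (#|X :&: W|%:R <= e * K%:R)) <= b) ->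
  Er (fun f => (~~ good_rings e f)%:R) <= n%:R * b.
Proof.
move=> hb.
apply: (@le_trans _ _ (Er (fun f => \sum_(i < n) (~~ (#|f i :&: prev_keys f i|%:R <= e * K%:R))%:R))).
  apply: Er_le => f _; case: (boolP (good_rings e f)) => /= [_|]; first by rewrite sumr_ge0.
  rewrite negb_forall => /existsP[i hi]; rewrite (bigD1 i) //= hi lerDl sumr_ge0 //.
rewrite Er_sum; apply: (@le_trans _ _ (\sum_(i < n) b)); last by rewrite sumr_const card_ord -[leLHS]mulr_natl.
apply: ler_sum => i _; rewrite (Er_resample i).
rewrite -[leRHS](Er_cst b); apply: Er_le => f okf.
have E x : prev_keys (upd f i x) i = prev_keys f i.
  apply: eq_bigr => l li; rewrite updN //; apply: contraTneq li => ->; by rewrite ltnn.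
rewrite (@eq_Ek _ (fun x => (~~ (#|x :&: prev_keys f i|%:R <= e * K%:R))%:R)).
  apply: hb; apply: leq_trans (_ : \sum_(l < n) #|f l| <= _)%N.
    rewrite /prev_keys big_mkcond /=; elim/big_ind2: _ => //.
    - by rewrite cards0.
    - move=> A a' B' b' h1 h2; apply: leq_trans (leq_card_setU _ _) (leq_add h1 h2).
    - by move=> l _; case: ifP => // _; rewrite cards0.
  rewrite (eq_bigr (fun=> K)) ?sum_nat_const ?card_ord //.
  by move=> l _; move/forallP: okf => /(_ l)/eqP.
by move=> x _; rewrite E updE.
Qed.

End KeyRings.

From mathcomp Require Import all_classical all_reals all_analysis.
From mathcomp Require Import measurable_realfun.
Import numFieldNormedType.Exports.
Local Open Scope ring_scope.

(** * Bounded measurable functions and their integrals *)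

Section BoundedMeasurable.
Local Open Scope classical_set_scope.
Local Open Scope ring_scope.
Context {R : realType} d (X : measurableType d).

(** Every integrand below is of this kind. The class is closed under the operations in use, and
    against a probability measure integrability is automatic. *)
Definition bmeas (F : X -> R) :=
  measurable_fun setT F /\ exists M, forall x, `|F x| <= M.

Lemma bmeas_cst c : bmeas (fun=> c).
Proof. by split => //; exists `|c|. Qed.

Lemma bmeasD F G : bmeas F -> bmeas G -> bmeas (fun x => F x + G x).
Proof.
move=> [mF [M hM]] [mG [N hN]]; split; first exact: measurable_funD.
by exists (M + N) => x; rewrite (le_trans (ler_normD _ _)) // lerD.
Qed.

Lemma bmeasM F G : bmeas F -> bmeas G -> bmeas (fun x => F x * G x).
Proof.
move=> [mF [M hM]] [mG [N hN]]; split; first exact: measurable_funM.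
by exists (M * N) => x; rewrite normrM ler_pM.
Qed.

Lemma bmeasB F G : bmeas F -> bmeas G -> bmeas (fun x => F x - G x).
Proof.
move=> bF bG; apply: bmeasD => //.
have := bmeasM (bmeas_cst (-1)) bG.
by congr bmeas; apply/funext => x; rewrite mulN1r.
Qed.

Lemma bmeas_sum (I : Type) (s : seq I) (P : pred I) (F : I -> X -> R) :
  (forall i, bmeas (F i)) -> bmeas (fun x => \sum_(i <- s | P i) F i x).
Proof.
move=> bF; elim: s => [|i s IH].
  by under eq_fun do rewrite big_nil; exact: bmeas_cst.
under eq_fun do rewrite big_cons.
by case: (P i) => //; exact: bmeasD.
Qed.

Lemma bmeas_prod (I : Type) (s : seq I) (P : pred I) (F : I -> X -> R) :
  (forall i, bmeas (F i)) -> bmeas (fun x => \prod_(i <- s | P i) F i x).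
Proof.
move=> bF; elim: s => [|i s IH].
  by under eq_fun do rewrite big_nil; exact: bmeas_cst.
under eq_fun do rewrite big_cons.
by case: (P i) => //; exact: bmeasM.
Qed.

Lemma bmeasX F n : bmeas F -> bmeas (fun x => F x ^+ n).
Proof.
move=> bF; elim: n => [|n IH]; first exact: (bmeas_cst 1).
by under eq_fun do rewrite exprS; exact: bmeasM.
Qed.

Lemma bmeas_bool (b : X -> bool) : measurable_fun setT b -> bmeas (fun x => (b x)%:R).
Proof.
move=> mb; split; last by exists 1 => x; case: (b x); rewrite ?normr1 ?normr0.
rewrite (_ : (fun x => (b x)%:R) = (fun x => if b x then 1 else 0)); last first.
  by apply/funext => x; case: (b x).
exact: measurable_fun_ifT.
Qed.

Lemma bmeas_comp d' (Y : measurableType d') (g : Y -> X) F :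
  measurable_fun setT g -> bmeas F ->
  measurable_fun setT (F \o g) /\ exists M, forall x, `|F (g x)| <= M.
Proof.
move=> mg [mF [M hM]]; split; first exact: measurableT_comp.
by exists M.
Qed.

Variable P : probability X R.

Lemma bmeas_integrable F : bmeas F -> P.-integrable setT (EFin \o F).
Proof.
move=> [mF [M hM]]; apply: measurable_bounded_integrable => //; last first.
  exists M; split; first exact: num_real.
  by move=> x Mx y _ /=; apply: le_trans (hM y) (ltW Mx).
by apply: le_lt_trans (probability_le1 P measurableT) _; rewrite ltry.
Qed.

Lemma Rint_cst c : \int[P]_x c = c :> R.
Proof. by rewrite Rintegral_cst //= probability_setT /= mulr1. Qed.

Lemma Rint_le F G : bmeas F -> bmeas G -> (forall x, F x <= G x) ->
  \int[P]_x F x <= \int[P]_x G x.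
Proof. by move=> bF bG h; apply: le_Rintegral => //; exact: bmeas_integrable. Qed.

Lemma Rint_sum (I : Type) (s : seq I) (Q : pred I) (F : I -> X -> R) :
  (forall i, bmeas (F i)) ->
  \int[P]_x (\sum_(i <- s | Q i) F i x) = \sum_(i <- s | Q i) \int[P]_x F i x.
Proof.
move=> bF; elim: s => [|i s IH].
  by under eq_Rintegral do rewrite big_nil; rewrite Rint_cst big_nil.
under eq_Rintegral do rewrite big_cons.
rewrite big_cons; case: (Q i) => //.
by rewrite RintegralD ?IH //; apply: bmeas_integrable => //; exact: bmeas_sum.
Qed.

Lemma Rint_Zl F c : bmeas F -> \int[P]_x (c * F x) = c * \int[P]_x F x.
Proof. by move=> bF; rewrite RintegralZl //; exact: bmeas_integrable. Qed.

Lemma Rint_abs_le F M : bmeas F -> (forall x, `|F x| <= M) -> `|\int[P]_x F x| <= M.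
Proof.
move=> bF hM; have := le_normr_Rintegral measurableT (bmeas_integrable bF).
move/le_trans; apply; rewrite -[leRHS](Rint_cst M); apply: Rint_le => //.
  have [mF [N hN]] := bF; split; first exact: measurableT_comp.
  by exists N => x; rewrite normr_id.
exact: bmeas_cst.
Qed.

Lemma EFin_Rint F : bmeas F -> (\int[P]_x (F x)%:E)%E = (\int[P]_x F x)%:E.
Proof.
move=> bF; rewrite /Rintegral fineK //; apply: integrable_fin_num => //; exact: bmeas_integrable.
Qed.

End BoundedMeasurable.

(** * Fubini for bounded functions *)

Section BoundedFubini.
Local Open Scope classical_set_scope.
Local Open Scope ring_scope.
Context {R : realType} d1 d2 (X : measurableType d1) (Y : measurableType d2).
Variables (P : probability X R) (Q : probability Y R).

Lemma bmeas_sect1 (F : X * Y -> R) x : bmeas F -> bmeas (fun y => F (x, y)).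
Proof.
move=> bF; have := @bmeas_comp R _ _ _ _ (fun y => (x, y)) F _ bF; apply.
exact: measurable_pair1.
Qed.

Lemma bmeas_sect2 (F : X * Y -> R) y : bmeas F -> bmeas (fun x => F (x, y)).
Proof.
move=> bF; have := @bmeas_comp R _ _ _ _ (fun x => (x, y)) F _ bF; apply.
exact: measurable_pair2.
Qed.

Lemma bmeas_int (F : X * Y -> R) : bmeas F -> bmeas (fun x => \int[Q]_y F (x, y)).
Proof.
move=> bF; have iF := bmeas_integrable (P \x Q)%E bF; split.
  have := @measurable_fubini_F _ _ _ _ _ P Q (EFin \o F) iF.
  move=> h; apply: (measurableT_comp (f := fine)) => //.
have [mF [M hM]] := bF; exists M => x; apply: Rint_abs_le => //.
exact: bmeas_sect1.
Qed.

Lemma Rint_fubini1 (F : X * Y -> R) : bmeas F ->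
  \int[(P \x Q)%E]_z F z = \int[P]_x \int[Q]_y F (x, y).
Proof.
move=> bF; have iF := bmeas_integrable (P \x Q)%E bF.
rewrite {1}/Rintegral -(integral12_prod_meas1 iF); congr fine.
apply: eq_integral => x _; rewrite /= /fubini_F -EFin_Rint //; exact: bmeas_sect1.
Qed.

Lemma Rint_fubini2 (F : X * Y -> R) : bmeas F ->
  \int[(P \x Q)%E]_z F z = \int[Q]_y \int[P]_x F (x, y).
Proof.
move=> bF; have iF := bmeas_integrable (P \x Q)%E bF.
rewrite {1}/Rintegral -(integral21_prod_meas1 iF); congr fine.
apply: eq_integral => x _; rewrite /= /fubini_G -EFin_Rint //; exact: bmeas_sect2.
Qed.

Lemma Rint_swap (F : X * Y -> R) : bmeas F ->
  \int[P]_x \int[Q]_y F (x, y) = \int[Q]_y \int[P]_x F (x, y).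
Proof. by move=> bF; rewrite -Rint_fubini1 // Rint_fubini2. Qed.

End BoundedFubini.

(** * The probability space of sensor positions *)

Section Positions.
Local Open Scope classical_set_scope.
Local Open Scope ring_scope.
Variable R : realType.
Notation point := (measurableTypeR R * measurableTypeR R)%type.

(** Generators of the product sigma-algebra. Sequences over all of [nat] are used because
    [torus_int] integrates functions of such sequences. *)
Definition cylinders : set (set (nat -> point)) :=
  [set A | exists i (B : set point), measurable B /\ A = (fun w => w i) @^-1` B].

Definition config := g_sigma_algebraType cylinders.

Definition setpos (w : nat -> R * R) k x : nat -> R * R := fun i => if i == k then x else w i.

Lemma measurable_pos i : measurable_fun setT (fun w : config => w i).
Proof.
move=> _ B mB; rewrite setTI; apply: sub_sigma_algebra; by exists i, B.
Qed.

Lemma measurable_config d (X : measurableType d) (f : X -> config) :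
  (forall i, measurable_fun setT (fun x => f x i)) -> measurable_fun setT f.
Proof.
move=> mf; apply: (@measurability _ _ _ _ _ f cylinders) => //.
move=> _ [_ [i [B [mB ->]]] <-]; rewrite setTI.
have := mf i measurableT B mB; by rewrite setTI.
Qed.

Lemma measurable_setpos k :
  measurable_fun setT (fun p : point * config => setpos p.2 k p.1 : config).
Proof.
apply: measurable_config => i; rewrite /setpos; case: (i == k); first exact: measurable_fst.
exact: (measurableT_comp (measurable_pos i)).
Qed.

Definition unif1 : probability _ R := uniform_prob (@ltr01 R).

Definition unif2 : probability _ R := (unif1 \x unif1)%E.

(** The model integrates over the half-open interval, [uniform_prob] over the closed one; the
    endpoint is a null set. *)
Lemma unif1E (g : measurableTypeR R -> R) : bmeas g -> (forall x, 0 <= g x) ->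
  (\int[@lebesgue_measure R]_(x in `[0%R, 1%R[) (g x)%:E)%E = (\int[unif1]_x g x)%:E.
Proof.
move=> bg g0; rewrite -EFin_Rint //.
have mg : measurable_fun setT (EFin \o g) by apply/measurable_EFinP; case: bg.
rewrite (integral_uniform ltr01 mg); last by move=> x; rewrite lee_fin.
rewrite subr0 invr1 mul1e -integral_itv_bndo_bndc //.
exact: measurable_funTS.
Qed.

Lemma torus_int_unif (F : point -> R) : bmeas F -> (forall x, 0 <= F x) ->
  (\int[@lebesgue_measure R]_(x in `[0%R, 1%R[)
         \int[@lebesgue_measure R]_(y in `[0%R, 1%R[) (F (x, y))%:E)%E = (\int[unif2]_x F x)%:E.
Proof.
move=> bF F0.
under eq_integral => x _ do rewrite (unif1E (bmeas_sect1 x bF)) //.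
have bI := bmeas_int unif1 unif1 bF.
rewrite (unif1E bI); last by move=> x; apply: Rintegral_ge0.
by rewrite /unif2 Rint_fubini1.
Qed.

Lemma setpos_bmeas k (F : config -> R) : bmeas F ->
  bmeas (fun p : point * config => F (setpos p.2 k p.1)).
Proof. by move=> bF; apply: (bmeas_comp (@measurable_setpos k)). Qed.

Lemma setpos_bmeas' k (F : config -> R) : bmeas F ->
  bmeas (fun p : config * point => F (setpos p.1 k p.2)).
Proof.
move=> bF; have := bmeas_comp (@measurable_swap _ _ config point) (setpos_bmeas k bF).
exact.
Qed.

Lemma resample_bmeas k (F : config -> R) : bmeas F ->
  bmeas (fun w : config => \int[unif2]_x F (setpos w k x)).
Proof.
(* [bmeas_int] asks for a probability on the first factor, while the conclusion does not mention it;
   a Dirac mass serves. *)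
move=> bF; pose D : probability config R := dirac ((fun=> (0, 0)) : config).
exact: (bmeas_int D unif2 (setpos_bmeas' k bF)).
Qed.

(* Realizes the iterated integral as one expectation; the second property replaces independence. *)
Lemma positions_exist n : exists P : probability config R,
  (forall F : config -> R, bmeas F -> (forall w, 0 <= F w) ->
     torus_int n (fun w => (F w)%:E) = (\int[P]_w F w)%:E) /\
  (forall (F : config -> R) j, (j < n)%N -> bmeas F ->
     \int[P]_w F w = \int[P]_w \int[unif2]_x F (setpos w j x)).
Proof.
elim: n => [|k [P [Pint Pres]]].
  exists (dirac ((fun=> (0, 0)) : config)); split => // F bF F0 /=.
  rewrite -EFin_Rint // integral_dirac //.
    by rewrite diracT mul1e.
  by apply/measurable_EFinP; case: bF.
pose phi (p : point * config) : config := setpos p.2 k p.1.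
have mphi : measurable_fun setT phi by exact: measurable_setpos.
pose phim : {mfun _ >-> config} := HB.pack phi (isMeasurableFun.Build _ _ _ _ _ mphi).
(* The law of a configuration of [k] sensors after coordinate [k] is overwritten by a fresh uniform
   point, as the outermost integral of [torus_int] does. *)
pose Q : probability config R := distribution (unif2 \x P)%E phim.
have QE F : bmeas F -> \int[Q]_w F w = \int[unif2]_x \int[P]_w F (setpos w k x).
  move=> bF; rewrite -(Rint_fubini1 unif2 P (setpos_bmeas k bF)) /Rintegral; congr fine.
  rewrite /Q /distribution integral_pushforward //=.
  - by case: bF => mF _; exact/measurable_EFinP.
  - exact: (bmeas_integrable (unif2 \x P)%E (setpos_bmeas k bF)).
exists Q; split => [F bF F0|F j jk bF].
  rewrite (QE F bF) [LHS]/= -torus_int_unif; last 2 first.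
  - by have := bmeas_int unif2 P (setpos_bmeas k bF).
  - by move=> x; apply: Rintegral_ge0.
  apply: eq_integral => x _; apply: eq_integral => y _.
  rewrite -Pint //; exact: (bmeas_sect1 (x, y) (setpos_bmeas k bF)).
rewrite (QE F bF) (QE _ (resample_bmeas j bF)).
(* For [j = k] the second overwriting erases the first; for [j < k] the two overwritings commute and
   the induction hypothesis applies. *)
move: jk; rewrite ltnS leq_eqVlt => /orP[/eqP ->|jk].
  rewrite (Rint_swap unif2 P (setpos_bmeas k bF)).
  under [RHS]eq_Rintegral => x _.
    under eq_Rintegral => w _.
      under eq_Rintegral => y _.
        rewrite (_ : setpos (setpos w k x) k y = setpos w k y); last first.
          by apply/funext => i; rewrite /setpos; case: eqP.
        over.
      over.
    over.
  by rewrite Rint_cst.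
apply: eq_Rintegral => x _; rewrite (Pres _ _ jk); last exact: (bmeas_sect1 x (setpos_bmeas k bF)).
apply: eq_Rintegral => w _; apply: eq_Rintegral => y _; congr F.
apply/funext => i; rewrite /setpos; case: (eqVneq i j) => // ->.
by rewrite (ltn_eqF jk).
Qed.

End Positions.

(** * The area of a torus disc from its chords *)

Section CircleArea.
Local Open Scope classical_set_scope.
Local Open Scope ring_scope.
Variable R : realType.
Notation mu := (@lebesgue_measure R).

Lemma derive0_cst (f : R -> R) (a b : R) : a <= b ->
  (forall x, a <= x <= b -> {for x, continuous f}) ->
  (forall x, a < x < b -> is_derive x 1 f 0) -> f a = f b.
Proof.
move=> ab cf df.
have d0 x : x \in `]a, b[ -> is_derive x 1 f 0 by rewrite in_itv /=; exact: df.
have c0 : {within `[a, b], continuous f}.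
  by apply/continuous_in_subspaceT => z /[1!inE]; rewrite /= in_itv /=; exact: cf.
have [c _ /eqP] := MVT_segment ab d0 c0.
by rewrite mul0r subr_eq0 => /eqP.
Qed.

Variable r : R.
Hypotheses (r0 : 0 <= r) (r1 : r <= 1 / 2).

(* Length of the vertical chord of the disc of radius [r] at horizontal torus distance
   min(|s|, 1-|s|); [Num.sqrt] of a negative number is [0]. *)
Definition chord (s : R) : R := 2 * Num.sqrt (r ^+ 2 - (Num.min `|s| (1 - `|s|)) ^+ 2).

Lemma chord_continuous : continuous chord.
Proof.
move=> x.
have c1 : {for x, continuous (fun s : R => Num.min `|s| (1 - `|s|))}.
  apply: (@continuous_min _ _ (fun s : R => `|s|) (fun s : R => 1 - `|s|)).
    exact: norm_continuous.
  apply: cvgB; [exact: cvg_cst|exact: norm_continuous].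
apply: cvgM; first exact: cvg_cst.
apply: (continuous_comp (f := fun s : R => r ^+ 2 - (Num.min `|s| (1 - `|s|)) ^+ 2) (g := Num.sqrt)).
  apply: cvgB; first exact: cvg_cst.
  by under eq_fun do rewrite expr2; exact: cvgM.
exact: sqrt_continuous.
Qed.

(** The base point [-2] lies strictly below every point at which this primitive is differentiated,
    so the fundamental theorem applies in the interior. *)
Definition chord_int (t : R) : R := \int[mu]_(s in `[-2, t]) chord s.

Lemma is_derive_chord_int (t : R) : -2 < t -> is_derive t 1 chord_int (chord t).
Proof.
move=> t2.
have i1 : t < t + 1 by rewrite ltrDl.
have i2 : mu.-integrable `[-2, t + 1] (EFin \o chord).
  apply: continuous_compact_integrable; first exact: segment_compact.
  by apply: continuous_subspaceT; exact: chord_continuous.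
have [d e] := continuous_FTC1_closed i1 i2 t2 (@chord_continuous t).
by apply: DeriveDef d _; rewrite -derive1E.
Qed.

Lemma chord_int_continuous (t : R) : -2 < t -> {for t, continuous chord_int}.
Proof.
move=> /is_derive_chord_int [h _]; exact/differentiable_continuous/derivable1_diffP.
Qed.

(** On [[0, 1]] one has [chord x = chord (x - 1)], so the integral over a unit window has derivative
    0 in the position of the window. This is why the area does not depend on the centre. *)
Lemma chord_int_shift (u : R) : 0 <= u <= 1 ->
  chord_int u - chord_int (u - 1) = chord_int (1 / 2) - chord_int (- (1 / 2)).
Proof.
have H (a b : R) : 0 <= a -> a <= b -> b <= 1 ->
   chord_int a - chord_int (a - 1) = chord_int b - chord_int (b - 1).
  move=> a0 ab b1.
  have dc (x : R) : 0 <= x <= 1 -> is_derive x 1 (fun x => chord_int x - chord_int (x - 1)) 0.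
    move=> /andP[x0 x1].
    have d1 : is_derive x 1 chord_int (chord x) by apply: is_derive_chord_int; lra.
    have d2 : is_derive (x - 1) 1 chord_int (chord (x - 1)) by apply: is_derive_chord_int; lra.
    have d3 : is_derive x 1 (chord_int \o (fun x => x - 1)) (chord (x - 1) * 1).
      by apply: is_derive1_comp; apply: is_derive_eq; rewrite subr0.
    rewrite (_ : 0 = chord x - chord (x - 1) * 1); first exact: is_deriveB.
    rewrite mulr1; apply/esym/eqP; rewrite subr_eq0; apply/eqP; rewrite /chord.
    rewrite ger0_norm // ler0_norm; last by lra.
    by rewrite opprB subKr [in RHS]minC.
  apply: (@derive0_cst (fun x => chord_int x - chord_int (x - 1)) a b ab).
    move=> x /andP[xa xb]; have [|h _] := dc x; first by lra.
    exact/differentiable_continuous/derivable1_diffP.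
  by move=> x /andP[xa xb]; apply: dc; lra.
move=> /andP[u0 u1].
rewrite (_ : - (1 / 2) = 1 / 2 - 1); last by lra.
by have [h|h] := lerP u (1 / 2); [apply: H|apply/esym; apply: H]; lra.
Qed.

Lemma chord_int_out (a b : R) : -2 < a -> a <= b ->
  (forall s, a < s < b -> chord s = 0) -> chord_int a = chord_int b.
Proof.
move=> a2 ab h; apply: derive0_cst => // x /andP[ax xb].
  by apply: chord_int_continuous; lra.
by rewrite -(h x); [apply: is_derive_chord_int; lra | apply/andP].
Qed.

(** The substitution [s = r sin t]: on [[-pi/2, pi/2]] the function [f] compares the integral with
    the primitive [r^2 (t + sin t cos t)] of [2 r^2 cos^2 t], and its derivative vanishes. *)
Lemma chord_int_in : chord_int r - chord_int (- r) = pi * r ^+ 2.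
Proof.
have pi0 := pi_gt0 R.
pose f (t : R) := chord_int (r * sin t) - r ^+ 2 * (t + sin t * cos t).
have ab : - (pi / 2) <= (pi / 2 : R) by lra.
have range (t : R) : -(1/2) <= r * sin t <= 1/2.
  have := sin_max t; rewrite ler_norml => /andP[s1 s2].
  have h1 := ler_wpM2l r0 s1; have h2 := ler_wpM2l r0 s2; have h3 := r1; apply/andP; split; lra.
have df (t : R) : is_derive t 1 f (chord (r * sin t) * (r * cos t) -
       r ^+ 2 * (1 + (sin t * - sin t + cos t * cos t))).
  have h := range t.
  have d1 : is_derive (r * sin t) 1 chord_int (chord (r * sin t)).
    by apply: is_derive_chord_int; lra.
  have d3 : is_derive t 1 (chord_int \o (fun x => r * sin x)) (chord (r * sin t) * (r * cos t)).
    by apply: is_derive1_comp; apply: is_derive_eq; rewrite /GRing.scale /= ?mulr0 ?addr0.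
  have d4 : is_derive t 1 (fun t => r ^+ 2 * (t + sin t * cos t))
      (r ^+ 2 * (1 + (sin t * - sin t + cos t * cos t))).
    by apply: is_derive_eq; rewrite /GRing.scale /=; ring.
  exact: is_deriveB.
have := @derive0_cst f _ _ ab.
have cf (x : R) : {for x, continuous f}.
  have [h _] := df x; exact/differentiable_continuous/derivable1_diffP.
move=> /(_ (fun x _ => cf x)) => E.
have {E} : f (- (pi / 2)) = f (pi / 2).
  apply: E => t tp; have := df t; congr is_derive.
  have c0 : 0 <= cos t by apply: cos_ge0_pihalf; case/andP: tp => a b; rewrite !ltW.
  have /andP[h1 h2] := range t.
  rewrite /chord min_l; last first.
    have : `|r * sin t| <= 1/2 by rewrite ler_norml h1 h2.
    by move=> h3; lra.
  rewrite real_normK ?num_real //.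
  have -> : r ^+ 2 - (r * sin t) ^+ 2 = (r * cos t) ^+ 2 by rewrite !exprMn cos2sin2; ring.
  rewrite sqrtr_sqr ger0_norm ?mulr_ge0 //.
  have := cos2Dsin2 t; nra.
rewrite /f cosN sinN sin_pihalf cos_pihalf !mulr0 mulr1 mulrN1 !addr0.
lra.
Qed.

(** Between distance [r] and [1 / 2] the radicand is at most 0, where [Num.sqrt] returns 0. *)
Lemma chord_total : chord_int (1 / 2) - chord_int (- (1 / 2)) = pi * r ^+ 2.
Proof.
rewrite -chord_int_in; have r0' := r0; have r1' := r1.
have h (s : R) : r <= `|s| -> `|s| <= 1 / 2 -> chord s = 0.
  move=> h1 h2; rewrite /chord min_l; last by lra.
  by rewrite ler0_sqrtr ?mulr0 // subr_le0 ler_pXn2r // nnegrE.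
rewrite (@chord_int_out r (1 / 2)) ?(@chord_int_out (- (1/2)) (- r)) //; try lra.
- by move=> s hs; apply: h; [rewrite ler0_norm; lra|rewrite ler_norml; lra].
- by move=> s hs; apply: h; [rewrite ger0_norm; lra|rewrite ler_norml; lra].
Qed.

Lemma chord_int_torus (u : R) : 0 <= u <= 1 ->
  (\int[mu]_(v in `[0%R, 1%R]) (chord (u - v))%:E = (pi * r ^+ 2)%:E)%E.
Proof.
move=> /andP[u0 u1].
pose F (v : R) := - chord_int (u - v).
have dF (v : R) : v < 2 -> is_derive v 1 F (chord (u - v)).
  move=> v1; have d1 : is_derive (u - v) 1 chord_int (chord (u - v)).
    by apply: is_derive_chord_int; lra.
  have d3 : is_derive v 1 (chord_int \o (fun x => u - x)) (chord (u - v) * -1).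
    by apply: is_derive1_comp; apply: is_derive_eq; rewrite add0r mul1r.
  have := @is_deriveN _ _ _ _ _ _ _ d3; rewrite mulrN1 opprK; exact.
have cF (v : R) : v < 2 -> {for v, continuous F}.
  move=> v1; have [h _] := dF v v1; exact/differentiable_continuous/derivable1_diffP.
rewrite (@continuous_FTC2 R (fun v => chord (u - v)) F 0 1) //.
- rewrite -EFinB /F subr0 opprK addrC; congr EFin.
  by rewrite chord_int_shift ?u0 // chord_total.
- apply: continuous_subspaceT => x; apply: (continuous_comp (f := fun v => u - v)).
    apply: cvgB; [exact: cvg_cst|exact: cvg_id].
  exact: chord_continuous.
- split.
  + move=> x; rewrite in_itv /= => /andP[x0 x1]; have x2 : x < 2 by lra.
    by have [h _] := dF x x2.
  + by apply: cvg_at_right_filter; apply: cF; lra.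
  + by apply: cvg_at_left_filter; apply: cF; lra.
- move=> x; rewrite in_itv /= => /andP[x0 x1]; rewrite derive1E.
  have x2 : x < 2 by lra.
  by have [_ h] := dF x x2.
Qed.

End CircleArea.

(** * Arcs, discs and squares on the torus *)

Section TorusGeometry.
Local Open Scope classical_set_scope.
Local Open Scope ring_scope.
Variable R : realType.
Notation point := (measurableTypeR R * measurableTypeR R)%type.
Notation mu := (@lebesgue_measure R).
Notation td := (@torus_coord_dist R).

(* Reads a position outside [0,1) as 0, so that the torus formulas hold everywhere. *)
Definition clamp (x : measurableTypeR R) : measurableTypeR R := if 0 <= x < 1 then x else 0.

Lemma clamp_range x : 0 <= clamp x < 1.
Proof. by rewrite /clamp; case: ifP => // _; rewrite lexx ltr01. Qed.

Lemma clamp_id x : 0 <= x < 1 -> clamp x = x.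
Proof. by rewrite /clamp => ->. Qed.

Lemma measurable_clamp : measurable_fun setT clamp.
Proof.
apply: measurable_fun_ifT => //.
by apply: measurable_and; [exact: measurable_fun_ler|exact: measurable_fun_ltr].
Qed.

Lemma measurable_td d (X : measurableType d) (f g : X -> measurableTypeR R) :
  measurable_fun setT f -> measurable_fun setT g ->
  measurable_fun setT (fun x => td (f x) (g x) : measurableTypeR R).
Proof.
move=> mf mg.
have m : measurable_fun setT (fun x => `|f x - g x| : measurableTypeR R).
  by apply: measurableT_comp => //; exact: measurable_funB.
by apply: measurable_minr => //; exact: measurable_funB.
Qed.

(** The arc around [u] wraps at 0, wraps at 1, or does not wrap. In the first two cases its
    complement in the unit interval is one open gap of length [1 - 2 t]. *)
Lemma torus_interval (u t : R) : 0 <= u < 1 -> 0 <= t <= 1 / 2 ->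
  mu (`[0%R, 1%R]%classic `&` [set v | td u v <= t]) = (2 * t)%:E.
Proof.
move=> /andP[u0 u1] /andP[t0 t1].
have m01 : mu `[0%R, 1%R] = 1%E :> \bar R by rewrite lebesgue_measure_itv /= lte_fin ltr01 sube0.
have gap (a b : R) : 0 <= a -> a <= b -> b <= 1 -> b - a = 1 - 2 * t ->
    (forall v, 0 <= v <= 1 -> (td u v <= t) = ~~ (a < v < b)) ->
    mu (`[0%R, 1%R]%classic `&` [set v | td u v <= t]) = (2 * t)%:E.
  move=> a0 ab b1 e h.
  have -> : `[0%R, 1%R]%classic `&` [set v | td u v <= t] = `[0%R, 1%R]%classic `\` `]a, b[%classic.
    apply/seteqP; split => v /=; rewrite !in_itv /= => -[v01].
      by rewrite h // => /negP.
    by move=> /negP nv; split => //; rewrite h.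
  rewrite measureD //; last by rewrite [ltLHS]m01 ltry.
  have -> : `[0%R, 1%R]%classic `&` `]a, b[%classic = `]a, b[%classic.
    apply/setIidPr => v /=; rewrite !in_itv /= => /andP[av vb]; apply/andP; split; lra.
  rewrite [X in (X - _)%E]m01 /= lebesgue_measure_itv /= lte_fin.
  move: ab; rewrite le_eqVlt => /orP[/eqP E|ab].
    by rewrite E ltxx sube0; congr EFin; move: e; rewrite E; lra.
  by rewrite ab -!EFinB; congr EFin; lra.
have [ut|ut] := lerP u t.
  apply: (gap (u + t) (u + 1 - t)); try lra.
  move=> v /andP[v0 v1]; rewrite /torus_coord_dist ge_min.
  case: (ger0P (u - v)) => h;
  apply/idP/idP; rewrite ?negb_and -?leNgt; move=> /orP[] H; lra.
have [ut'|ut'] := lerP (1 - t) u.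
  apply: (gap (u + t - 1) (u - t)); try lra.
  move=> v /andP[v0 v1]; rewrite /torus_coord_dist ge_min.
  case: (ger0P (u - v)) => h;
  apply/idP/idP; rewrite ?negb_and -?leNgt; move=> /orP[] H; lra.
have -> : `[0%R, 1%R]%classic `&` [set v | td u v <= t] = `[u - t, u + t]%classic.
  apply/seteqP; split => v /=; rewrite !in_itv /= /torus_coord_dist ge_min;
   case: (ger0P (u - v)) => h.
  - by move=> [/andP[v0 v1] /orP[] H]; apply/andP; split; lra.
  - by move=> [/andP[v0 v1] /orP[] H]; apply/andP; split; lra.
  - by move=> /andP[v0 v1]; split; [apply/andP; split|apply/orP; left]; lra.
  - by move=> /andP[v0 v1]; split; [apply/andP; split|apply/orP; left]; lra.
rewrite lebesgue_measure_itv /= lte_fin.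
move: t0; rewrite le_eqVlt => /orP[/eqP <-|t0]; first by rewrite subr0 addr0 ltxx mulr0.
by rewrite ifT; [rewrite -EFinB; congr EFin; lra|lra].
Qed.

Lemma measurable_bool_td (u t : R) : measurable_fun setT (fun v : measurableTypeR R => (td u (clamp v) : R) <= t).
Proof.
apply: measurable_fun_ler => //; apply: measurable_td => //; exact: measurable_clamp.
Qed.

Lemma unif1_td (u t : R) : 0 <= u < 1 -> 0 <= t <= 1 / 2 ->
  \int[@unif1 R]_v (td u (clamp v) <= t)%R%:R = 2 * t.
Proof.
move=> hu ht; apply: EFin_inj.
have bb : bmeas (fun v : measurableTypeR R => (td u (clamp v) <= t)%R%:R : R).
  exact: (bmeas_bool (measurable_bool_td _ _)).
rewrite -(unif1E bb) //.
rewrite -(torus_interval hu ht).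
have mS : measurable [set v : measurableTypeR R | td u v <= t].
  have mt : measurable_fun setT (fun v : measurableTypeR R => td u v : measurableTypeR R).
    exact: measurable_td.
  have := mt measurableT `]-oo, t]%classic (measurable_itv _); rewrite setTI.
  by congr measurable; apply/seteqP; split => v /=; rewrite in_itv.
rewrite (eq_integral (fun v : measurableTypeR R =>
  (\1_[set v : measurableTypeR R | td u v <= t] v)%:E)); last first.
  move=> v /[!inE] /=; rewrite in_itv /= => hv; rewrite clamp_id // indicE.
  by congr (_%:R%:E); congr nat_of_bool; apply/idP/idP; rewrite inE.
rewrite integral_itv_bndo_bndc; last by apply: measurable_funTS; apply/measurable_EFinP; exact: measurable_indic.
by rewrite integral_indic // setIC.
Qed.

Lemma unif1_td_le (u t : R) : 0 <= u < 1 -> 0 <= t ->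
  \int[@unif1 R]_v (td u (clamp v) <= t)%R%:R <= 2 * t.
Proof.
move=> hu t0; have [h|h] := lerP t (1 / 2); first by rewrite unif1_td // t0 h.
apply: (@le_trans _ _ 1); last by lra.
rewrite -[leRHS](Rint_cst (@unif1 R)); apply: Rint_le; [exact: (bmeas_bool (measurable_bool_td _ _))|exact: bmeas_cst|].
by move=> x; rewrite lern1 leq_b1.
Qed.

Definition clamp2 (x : R * R) : R * R := (clamp x.1, clamp x.2).

Definition gadj (r : R) (x y : R * R) : bool := torus_dist (clamp2 x) (clamp2 y) <= r.

Definition near_coord (t : R) (x y : R * R) : bool :=
  (td (clamp x.1) (clamp y.1) <= t) && (td (clamp x.2) (clamp y.2) <= t).

Lemma measurable_gadj d (X : measurableType d) (r : R) (f g : X -> point) :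
  measurable_fun setT f -> measurable_fun setT g ->
  measurable_fun setT (fun x => gadj r (f x) (g x)).
Proof.
move=> mf mg; apply: measurable_fun_ler => //.
have m h (k : X -> point) : measurable_fun setT h -> measurable_fun setT k ->
   measurable_fun setT (fun x => clamp (h (k x)) : measurableTypeR R).
  by move=> mh mk; apply: measurableT_comp; [exact: measurable_clamp|exact: measurableT_comp].
have ms : measurable_fun setT (Num.sqrt : measurableTypeR R -> measurableTypeR R).
  by apply: continuous_measurable_fun; exact: sqrt_continuous.
apply: (measurableT_comp ms).
by apply: measurable_funD; apply: measurable_funX; apply: measurable_td; apply: m.
Qed.

Lemma measurable_near_coord d (X : measurableType d) (r : R) (f g : X -> point) :
  measurable_fun setT f -> measurable_fun setT g ->
  measurable_fun setT (fun x => near_coord r (f x) (g x)).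
Proof.
move=> mf mg.
have m h (k : X -> point) : measurable_fun setT h -> measurable_fun setT k ->
   measurable_fun setT (fun x => clamp (h (k x)) : measurableTypeR R).
  by move=> mh mk; apply: measurableT_comp; [exact: measurable_clamp|exact: measurableT_comp].
by apply: measurable_and; apply: measurable_fun_ler => //; apply: measurable_td; apply: m.
Qed.

(** Slicing by the first coordinate: at distance [d] the second coordinate ranges over an arc of
    radius [sqrt (r^2 - d^2)], whose measure is the chord, and [chord_int_torus] integrates the
    chords. *)
Lemma gadj_area (r : R) (x : R * R) : 0 <= r -> r <= 1 / 2 ->
  \int[@unif2 R]_y (gadj r x y)%:R = pi * r ^+ 2.
Proof.
move=> r0 r1.
have mg : measurable_fun setT (fun y : point => gadj r x y) by exact: measurable_gadj.
rewrite (Rint_fubini1 (@unif1 R) (@unif1 R) (bmeas_bool mg)).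
set u1 := clamp x.1; set u2 := clamp x.2.
have h v : \int[@unif1 R]_w (gadj r x (v, w))%:R = chord r (u1 - clamp v).
  rewrite /gadj /torus_dist /= -/u1 -/u2 /chord -/(torus_coord_dist u1 (clamp v)).
  set d := td u1 (clamp v).
  (* If [d^2 = r^2] the slice is an arc of radius 0, of measure 0 by [unif1_td]; if [d^2 > r^2] it
     is empty. *)
  have [dn|dp] := lerP (r ^+ 2 - d ^+ 2) 0.
    rewrite ler0_sqrtr // mulr0.
    move: dn; rewrite le_eqVlt => /orP[/eqP E|dn].
      transitivity (\int[@unif1 R]_w (td u2 (clamp w) <= 0)%R%:R : R).
        apply: eq_Rintegral => w _; congr ((_ : bool)%:R).
        have -> : r = Num.sqrt (r ^+ 2) by rewrite sqrtr_sqr ger0_norm.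
        rewrite ler_sqrt ?sqr_ge0 //; have -> : r ^+ 2 = d ^+ 2 by lra.
        rewrite gerDl; apply/idP/idP => [|H].
          rewrite le_eqVlt ltNge sqr_ge0 orbF sqrf_eq0 => /eqP -> //.
        have : 0 <= td u2 (clamp w).
          have /andP[a1 a2] := clamp_range x.2; have /andP[b1 b2] := clamp_range w.
          rewrite /torus_coord_dist le_min normr_ge0 subr_ge0 ler_norml /u2; lra.
        by move=> H2; rewrite (_ : td u2 (clamp w) = 0) ?expr0n //; apply/eqP; rewrite eq_le H H2.
      by rewrite unif1_td ?clamp_range ?mulr0 // lexx; lra.
    rewrite -[RHS](Rint_cst (@unif1 R) 0); apply: eq_Rintegral => w _.
    rewrite -[RHS]/(false%:R); congr ((_ : bool)%:R); apply/negbTE; rewrite -ltNge.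
    have -> : r = Num.sqrt (r ^+ 2) by rewrite sqrtr_sqr ger0_norm.
    rewrite ltr_sqrt; last by have := sqr_ge0 (td u2 (clamp w)); have := sqr_ge0 r; lra.
    have := sqr_ge0 (td u2 (clamp w)); lra.
  rewrite -(unif1_td (u := u2)) ?clamp_range //; last first.
    rewrite sqrtr_ge0 /=; apply: le_trans r1.
    have {2}-> : r = Num.sqrt (r ^+ 2) by rewrite sqrtr_sqr ger0_norm.
    by rewrite ler_sqrt ?sqr_ge0 // gerDl oppr_le0 sqr_ge0.
  apply: eq_Rintegral => w _; congr ((_ : bool)%:R).
  have {1}-> : r = Num.sqrt (r ^+ 2) by rewrite sqrtr_sqr ger0_norm.
  have dd : 0 <= td u2 (clamp w).
    have /andP[a1 a2] := clamp_range x.2; have /andP[b1 b2] := clamp_range w.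
    rewrite /torus_coord_dist le_min normr_ge0 subr_ge0 ler_norml /u2; lra.
  rewrite ler_sqrt ?sqr_ge0 // -lerBrDl.
  have {2}-> : td u2 (clamp w) = Num.sqrt (td u2 (clamp w) ^+ 2) by rewrite sqrtr_sqr ger0_norm.
  by rewrite ler_sqrt // ltW.
under eq_Rintegral => v _ do rewrite h.
apply: EFin_inj.
have mc : measurable_fun setT (chord r : measurableTypeR R -> measurableTypeR R).
  by apply: continuous_measurable_fun; exact: chord_continuous.
have bc : bmeas (fun v : measurableTypeR R => chord r (u1 - clamp v)).
  have := bmeas_int (@unif1 R) (@unif1 R) (bmeas_bool mg).
  by under eq_fun do rewrite h.
rewrite -(unif1E bc); last by move=> v; rewrite mulr_ge0 ?sqrtr_ge0.
rewrite -(chord_int_torus r0 r1 (u := u1)); last by case/andP: (clamp_range x.1) => a b; rewrite a ltW.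
rewrite -integral_itv_bndo_bndc; last first.
  apply: measurable_funTS; apply/measurable_EFinP; apply: (measurableT_comp mc).
  exact: measurable_funB.
apply: eq_integral => v /[!inE] /=; rewrite in_itv /= => hv; by rewrite clamp_id.
Qed.

(** The coordinates are independent and each is close with probability at most [2 t]. With [t = 2 r]
    this is the [16 r^2] of the pair estimate. *)
Lemma near_coord_area (t : R) (x : R * R) : 0 <= t ->
  \int[@unif2 R]_y (near_coord t x y)%:R <= (2 * t) ^+ 2.
Proof.
move=> t0.
have mg : measurable_fun setT (fun y : point => near_coord t x y) by exact: measurable_near_coord.
rewrite (Rint_fubini1 (@unif1 R) (@unif1 R) (bmeas_bool mg)).
have mb u : bmeas (fun w : measurableTypeR R => (td u (clamp w) <= t)%R%:R : R).
  exact: (bmeas_bool (measurable_bool_td _ _)).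
apply: (@le_trans _ _ (\int[@unif1 R]_v ((2 * t) * (td (clamp x.1) (clamp v) <= t)%R%:R))); last first.
  rewrite Rint_Zl // expr2 ler_wpM2l ?mulr_ge0 //; apply: unif1_td_le => //; exact: clamp_range.
apply: Rint_le; first exact: (bmeas_int (@unif1 R) (@unif1 R) (bmeas_bool mg)).
  by apply: bmeasM => //; exact: bmeas_cst.
move=> v; rewrite /near_coord /=; case: (td (clamp x.1) (clamp v) <= t) => /=.
  by rewrite mulr1; apply: unif1_td_le => //; exact: clamp_range.
by rewrite Rint_cst mulr0.
Qed.

Lemma td_triangle (u v w : R) : 0 <= u < 1 -> 0 <= v < 1 -> 0 <= w < 1 ->
  td u v <= td u w + td v w.
Proof.
move=> /andP[u0 u1] /andP[v0 v1] /andP[w0 w1]; rewrite /torus_coord_dist.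
case: (ger0P (u - v)) => h1; case: (ger0P (u - w)) => h2; case: (ger0P (v - w)) => h3;
rewrite ge_min; case: (leP _ (1 - _)) => a; case: (leP _ (1 - _)) => b; apply/orP; lra.
Qed.

Lemma td_le_dist r x y : gadj r x y -> near_coord r x y.
Proof.
move=> h; have r0 : 0 <= r by apply: le_trans h; exact: sqrtr_ge0.
have nn u w : 0 <= u < 1 -> 0 <= w < 1 -> 0 <= td u w.
  move=> /andP[a1 a2] /andP[b1 b2].
  rewrite /torus_coord_dist le_min normr_ge0 subr_ge0 ler_norml; lra.
move: h; rewrite /gadj /torus_dist /= {1}(_ : r = Num.sqrt (r ^+ 2)); last by rewrite sqrtr_sqr ger0_norm.
rewrite ler_sqrt ?sqr_ge0 // => h; rewrite /near_coord.
set a := td _ _ in h *; set b := td (clamp x.2) _ in h *.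
have a0 : 0 <= a by apply: nn; exact: clamp_range.
have b0 : 0 <= b by apply: nn; exact: clamp_range.
have := sqr_ge0 a; have := sqr_ge0 b => sa sb.
by rewrite -(@ler_pXn2r _ 2 _ a) ?nnegrE // -(@ler_pXn2r _ 2 _ b) ?nnegrE //; apply/andP; split; lra.
Qed.

Lemma gadj_near r x y z : gadj r x z -> gadj r y z -> near_coord (2 * r) x y.
Proof.
move=> /td_le_dist/andP[h1 h2] /td_le_dist/andP[h3 h4]; apply/andP; split.
  have := td_triangle (clamp_range x.1) (clamp_range y.1) (clamp_range z.1); lra.
have := td_triangle (clamp_range x.2) (clamp_range y.2) (clamp_range z.2); lra.
Qed.

Lemma gadj_sym r x y : gadj r x y = gadj r y x.
Proof. by rewrite /gadj /torus_dist /torus_coord_dist /= !(distrC (clamp x.1)) !(distrC (clamp x.2)). Qed.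

End TorusGeometry.

(** * Cyclic neighbourhoods in the grid of cells *)

Section CellIndices.
Variable k : nat.
Notation M := k.+1.

(** Cyclic distance at most 5, the last two clauses being the wrap-around. A link spans at most 4
    cell widths when [r M <= 4]; the fifth absorbs the rounding to indices. *)
Definition close_ix (c a : 'I_M) : bool :=
  [|| ((a <= c + 5) && (c <= a + 5))%N, (c + M <= a + 5)%N | (a + M <= c + 5)%N].

Definition near_cells (c : 'I_M * 'I_M) : {set 'I_M * 'I_M} :=
  [set d | close_ix c.1 d.1 && close_ix c.2 d.2].

Lemma card_ix_window (lo len : nat) : (#|[set a : 'I_M | (lo <= a < lo + len)%N]| <= len)%N.
Proof.
case: len => [|len].
  rewrite addn0 leqn0 cards_eq0; apply/eqP/setP => a; rewrite !inE.
  by rewrite leqNgt andbC andbN.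
rewrite -[leqRHS]card_ord.
have inj : {in [set a : 'I_M | (lo <= a < lo + len.+1)%N] &, injective (fun a : 'I_M => inord (a - lo)%N : 'I_len.+1)}.
  move=> a b; rewrite !inE => /andP[a1 a2] /andP[b1 b2] /(congr1 val) /=.
  rewrite !inordK; try lia. move=> h; apply/val_inj => /=; lia.
by rewrite -(card_in_imset inj) max_card.
Qed.

(** One window of 11 around [c] and two of 5 at the ends for the wrap-around. The square of
    [11 + 5 + 5] is the 441 of the degree estimates. *)
Lemma card_close_ix (c : 'I_M) : (#|[set a | close_ix c a]| <= 21)%N.
Proof.
have : [set a | close_ix c a] \subset
   [set a : 'I_M | (c - 5 <= a < (c - 5) + 11)%N] :|: [set a : 'I_M | (M - 5 <= a < (M - 5) + 5)%N]
    :|: [set a : 'I_M | (0 <= a < 0 + 5)%N].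
  apply/fintype.subsetP => a; rewrite !inE /close_ix.
  by have := ltn_ord a; have := ltn_ord c; lia.
move/subset_leq_card/leq_trans; apply.
apply: leq_trans (leq_card_setU _ _) _.
have h1 := card_ix_window 0 5; have h2 := card_ix_window (M - 5)%N 5; have h3 := card_ix_window (c - 5)%N 11.
apply: leq_trans (leq_add (leq_card_setU _ _) h1) _.
by rewrite (leq_add (leq_add h3 h2) (leqnn 5)).
Qed.

Lemma card_near_cells c : (#|near_cells c| <= 441)%N.
Proof.
have -> : near_cells c = finset.setX [set a | close_ix c.1 a] [set a | close_ix c.2 a].
  by apply/setP => -[a b]; rewrite !inE.
by rewrite cardsX (leq_mul (card_close_ix _) (card_close_ix _)).
Qed.

End CellIndices.

(** * Cells of the torus and the range of a link *)

Section Cells.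
Local Open Scope classical_set_scope.
Local Open Scope ring_scope.
Variable R : realType.
Variable k : nat.
Notation M := k.+1.
Notation point := (measurableTypeR R * measurableTypeR R)%type.
Notation mu := (@lebesgue_measure R).

Definition cell1 (u : measurableTypeR R) : 'I_M := inord (Num.truncn (M%:R * clamp u)).

Lemma cell1_bounds u : (cell1 u)%:R <= M%:R * clamp u < (cell1 u)%:R + 1.
Proof.
have /andP[c0 c1] := clamp_range u.
have u0 : 0 <= M%:R * clamp u by rewrite mulr_ge0.
have := truncn_itv u0 => /andP[h1 h2].
rewrite /cell1 inordK ?h1 ?natr1 //.
rewrite -(ltr_nat R); apply: le_lt_trans h1 _.
by rewrite -[ltRHS]mulr1 ltr_pM2l ?ltr0n.
Qed.

Lemma cell1_eq u (a : 'I_M) : (cell1 u == a) = (a%:R <= M%:R * clamp u < a%:R + 1).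
Proof.
have /andP[h1 h2] := cell1_bounds u.
apply/eqP/andP => [<- //|[h3 h4]]; apply/val_inj/eqP; rewrite eqn_leq.
apply/andP; split; rewrite -ltnS -(ltr_nat R) -natr1; lra.
Qed.

Lemma measurable_cell1 (a : 'I_M) : measurable_fun setT (fun u : measurableTypeR R => cell1 u == a).
Proof.
have -> : (fun u : measurableTypeR R => cell1 u == a) =
    (fun u => (a%:R <= M%:R * clamp u < a%:R + 1)%R) by apply/funext => u; exact: cell1_eq.
have mm : measurable_fun setT (fun u : measurableTypeR R => M%:R * clamp u : measurableTypeR R).
  by apply: measurable_funM => //; exact: measurable_clamp.
by apply: measurable_and; [exact: measurable_fun_ler|exact: measurable_fun_ltr].
Qed.

Lemma unif1_cell1 (a : 'I_M) : \int[@unif1 R]_v (cell1 v == a)%:R = M%:R^-1.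
Proof.
apply: EFin_inj.
have bb := bmeas_bool (R := R) (measurable_cell1 a).
rewrite -(unif1E bb) //.
have M0 : (0 : R) < M%:R by rewrite ltr0n.
have aM : a%:R + 1 <= M%:R :> R by rewrite natr1 ler_nat.
rewrite (eq_integral (fun v : measurableTypeR R =>
   (\1_(`[(a%:R / M%:R), (a%:R + 1) / M%:R[%classic : set (measurableTypeR R)) v)%:E)); last first.
  move=> v /[!inE] /=; rewrite in_itv /= => hv; rewrite indicE; congr (_%:R%:E); congr nat_of_bool.
  rewrite cell1_eq clamp_id // ; apply/idP/idP; rewrite inE /= in_itv /= ler_pdivrMr // ltr_pdivlMr //;
  by rewrite (mulrC v).
rewrite integral_indic //.
have -> : `[(a%:R / M%:R), (a%:R + 1) / M%:R[%classic `&` `[0%R, 1%R[%classic =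
   `[(a%:R / M%:R), (a%:R + 1) / M%:R[%classic :> set (measurableTypeR R).
  apply/setIidPl => v /=; rewrite !in_itv /= => /andP[h1 h2]; apply/andP; split.
    by apply: le_trans h1; rewrite divr_ge0 ?ler0n.
  by apply: lt_le_trans h2 _; rewrite ler_pdivrMr // mul1r.
rewrite /= lebesgue_measure_itv /= lte_fin ltr_pM2r ?invr_gt0 // ltrDl ltr01.
by rewrite -EFinB -mulrBl addrAC subrr add0r mul1r.
Qed.

Definition cell (x : R * R) : 'I_M * 'I_M := (cell1 x.1, cell1 x.2).

Lemma measurable_cell (c : 'I_M * 'I_M) : measurable_fun setT (fun x : point => cell x == c).
Proof.
have -> : (fun x : point => cell x == c) = (fun x => (cell1 x.1 == c.1) && (cell1 x.2 == c.2)).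
  by apply/funext => x; rewrite /cell; case: c.
apply: measurable_and; apply: (measurableT_comp (measurable_cell1 _)) => //.
Qed.

Lemma unif2_cell (c : 'I_M * 'I_M) : \int[@unif2 R]_x (cell x == c)%:R = M%:R ^- 2.
Proof.
have bc := bmeas_bool (R := R) (measurable_cell c).
rewrite (Rint_fubini1 (@unif1 R) (@unif1 R) bc).
transitivity (\int[@unif1 R]_v (M%:R^-1 * (cell1 v == c.1)%:R)); last first.
  by rewrite Rint_Zl ?unif1_cell1 ?expr2 ?invfM //; exact: (bmeas_bool (measurable_cell1 _)).
apply: eq_Rintegral => v _; rewrite mulrC -(unif1_cell1 c.2) -Rint_Zl; last exact: (bmeas_bool (measurable_cell1 _)).
apply: eq_Rintegral => w _; rewrite /cell; case: c {bc} => a b /=.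
by rewrite -natrM mulnb.
Qed.

(** Points of adjacent cells differ by at most two cell widths in each coordinate, so their distance
    is at most [sqrt 8 / M], and [8 <= 9 <= (r M)^2]. *)
Lemma gadj_cells (r : R) x y : 3 <= r * M%:R ->
  ((cell x).1 <= (cell y).1.+1)%N -> ((cell y).1 <= (cell x).1.+1)%N ->
  ((cell x).2 <= (cell y).2.+1)%N -> ((cell y).2 <= (cell x).2.+1)%N ->
  gadj r x y.
Proof.
move=> rM h1 h2 h3 h4.
have M0 : (0 : R) < M%:R by rewrite ltr0n.
have r0 : 0 <= r by rewrite -(pmulr_lge0 _ M0); lra.
have td2 u v : (cell1 u <= (cell1 v).+1)%N -> (cell1 v <= (cell1 u).+1)%N ->
   M%:R * torus_coord_dist (clamp u) (clamp v) <= 2 /\ 0 <= torus_coord_dist (clamp u) (clamp v).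
  move=> a b.
  have {}a : (cell1 u)%:R <= (cell1 v)%:R + 1 :> R by rewrite natr1 ler_nat.
  have {}b : (cell1 v)%:R <= (cell1 u)%:R + 1 :> R by rewrite natr1 ler_nat.
  have /andP[u0 u1] := clamp_range u; have /andP[v0 v1] := clamp_range v.
  have /andP[p1 p2] := cell1_bounds u; have /andP[q1 q2] := cell1_bounds v; split.
    apply: (@le_trans _ _ (M%:R * `|clamp u - clamp v|)).
      by apply: ler_wpM2l; [exact: ltW|rewrite /torus_coord_dist ge_min lexx].
    rewrite -[X in X * _](gtr0_norm M0) -normrM ler_norml mulrBr; lra.
  rewrite /torus_coord_dist le_min normr_ge0 subr_ge0 ler_norml; lra.
have [a1 a0] := td2 _ _ h1 h2; have [b1 b0] := td2 _ _ h3 h4.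
rewrite /gadj /torus_dist /clamp2 /=.
set s := torus_coord_dist _ _ in a1 a0 *; set t := torus_coord_dist _ _ in b1 b0 *.
rewrite -(ger0_norm r0) -sqrtr_sqr ler_sqrt ?sqr_ge0 //.
rewrite -(ler_pM2l (exprn_gt0 2 M0)) mulrDr -!exprMn.
have : (M%:R * s) ^+ 2 <= 2 ^+ 2 by rewrite lerXn2r // ?nnegrE ?mulr_ge0 ?ler0n.
have : (M%:R * t) ^+ 2 <= 2 ^+ 2 by rewrite lerXn2r // ?nnegrE ?mulr_ge0 ?ler0n.
have : 3 ^+ 2 <= (M%:R * r) ^+ 2 by rewrite (mulrC _ r) lerXn2r // ?nnegrE ?mulr_ge0 ?ler0n.
lra.
Qed.

Lemma gadj_near_cells (r : R) x y : r * M%:R <= 4 -> gadj r x y -> cell y \in near_cells (cell x).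
Proof.
move=> rM /td_le_dist/andP[h1 h2]; rewrite inE /=.
have M0 : (0 : R) < M%:R by rewrite ltr0n.
have key u v : torus_coord_dist (clamp u) (clamp v) <= r -> close_ix (cell1 u) (cell1 v).
  move=> h; have /andP[p1 p2] := cell1_bounds u; have /andP[q1 q2] := cell1_bounds v.
  have hM : M%:R * torus_coord_dist (clamp u) (clamp v) <= 4.
    by apply: le_trans (_ : M%:R * r <= _); rewrite ?ler_pM2l // mulrC.
  rewrite /close_ix -!(ler_nat R) !natrD.
  move: hM; rewrite /torus_coord_dist (minr_pMr _ _ (ltW M0)) ge_min [M%:R * (1 - _)]mulrBr mulr1.
  have -> : M%:R * `|clamp u - clamp v| = `|M%:R * clamp u - M%:R * clamp v|.
    by rewrite -[X in X * _](gtr0_norm M0) -normrM mulrBr.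
  by case: (ger0P (M%:R * clamp u - M%:R * clamp v)) => hh /orP[] H; lra.
by rewrite !key.
Qed.

End Cells.

(** * Products over independent positions: degrees, cell counts and pairs *)

Section PositionProducts.
Local Open Scope classical_set_scope.
Local Open Scope ring_scope.
Variables (R : realType) (n : nat) (P : probability (config R) R).
Notation point := (measurableTypeR R * measurableTypeR R)%type.
Notation config := (config R).
Hypothesis resample : forall (F : config -> R) j, (j < n)%N -> bmeas F ->
  \int[P]_w F w = \int[P]_w \int[@unif2 R]_x F (setpos w j x).

Lemma bmeas_at (phi : config * point -> R) j : bmeas phi -> bmeas (fun w : config => phi (w, w j)).
Proof.
move=> bphi; have := @bmeas_comp R _ _ _ config (fun w : config => (w, w j)) phi _ bphi; apply.
apply: measurable_fun_pair; [exact: measurable_id|exact: measurable_pos].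
Qed.

Lemma bmeas_avg (phi : config * point -> R) : bmeas phi ->
  bmeas (fun w : config => \int[@unif2 R]_x phi (w, x)).
Proof. by move=> bphi; exact: (bmeas_int P (@unif2 R) bphi). Qed.

(** Positions in [J] are integrated one at a time, as [Er_prod_out] does for rings, with [resample]
    standing for independence. *)
Lemma Rint_prod_out (J : seq 'I_n) (G : config -> R) (phi : 'I_n -> config * point -> R) :
  uniq J -> bmeas G -> (forall j, bmeas (phi j)) ->
  (forall w (i : 'I_n) x, i \in J -> G (setpos w i x) = G w) ->
  (forall w (i j : 'I_n) x y, i \in J -> j \in J -> phi j (setpos w i x : config, y) = phi j (w, y)) ->
  \int[P]_w (G w * \prod_(j <- J) phi j (w, w j)) =
  \int[P]_w (G w * \prod_(j <- J) \int[@unif2 R]_x phi j (w, x)).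
Proof.
move=> + + bphi; elim: J G => [|j s IH] G /=.
  by move=> _ _ _ _; apply: eq_Rintegral => w _; rewrite !big_nil.
case/andP => js us bG hG hphi.
have bprod (s' : seq 'I_n) : bmeas (fun w : config => \prod_(k <- s') phi k (w, w k)).
  by apply: bmeas_prod => k; exact: bmeas_at.
rewrite (resample (ltn_ord j)); last exact: bmeasM.
transitivity (\int[P]_w ((G w * \int[@unif2 R]_x phi j (w, x)) * \prod_(k <- s) phi k (w, w k))).
  apply: eq_Rintegral => w _; rewrite mulrAC -Rint_Zl; last exact: bmeas_sect1.
  apply: eq_Rintegral => x _; rewrite big_cons hG ?mem_head // hphi ?mem_head //.
  rewrite -[RHS]mulrA [X in _ = _ * X]mulrC; congr (_ * (phi j (w, _) * _)).
    by rewrite /setpos eqxx.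
  apply: eq_big_seq => i is_; rewrite hphi ?mem_head ?inE ?is_ ?orbT //; congr (phi i (w, _)).
  by rewrite /setpos ifN // (inj_eq val_inj); apply: contraNneq js => <-.
rewrite IH //; last 3 first.
- by apply: bmeasM => //; exact: bmeas_avg.
- move=> w i x is_; rewrite hG ?inE ?is_ ?orbT //; congr (_ * _); apply: eq_Rintegral => y _.
  by rewrite hphi ?mem_head ?inE ?is_ ?orbT.
- by move=> w i l x y is_ ls; rewrite hphi ?inE ?is_ ?ls ?orbT.
by apply: eq_Rintegral => w _; rewrite big_cons mulrA.
Qed.

Variable r : R.
Hypotheses (r0 : 0 <= r) (r1 : r <= 1 / 2).

Lemma bmeas_gadj i : bmeas (fun p : config * point => (gadj r (p.1 i) p.2)%:R : R).
Proof.
apply: bmeas_bool; apply: measurable_gadj => //.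
exact: (measurableT_comp (measurable_pos i)).
Qed.

Lemma bmeas_gadj1 (x : R * R) : bmeas (fun y : point => (gadj r x y)%:R : R).
Proof. by apply: bmeas_bool; exact: measurable_gadj. Qed.

Lemma bmeas_gadj2 i j : bmeas (fun w : config => (gadj r (w i) (w j))%:R : R).
Proof. exact: (bmeas_at j (bmeas_gadj i)). Qed.

Lemma setposN (w : config) i j x : j != i -> setpos w i x j = w j.
Proof. by rewrite /setpos => /negbTE ->. Qed.

(** Given the position of [i], being in range of it are independent events of probability [pi r^2].
    With [z = - p] this is the chance of isolation, with [z = - t] a Chernoff moment of the
    degree. *)
Lemma Rint_deg_gen (i : 'I_n) (J : seq 'I_n) (z : R) : uniq J -> i \notin J ->
  \int[P]_w \prod_(j <- J) (1 + z * (gadj r (w i) (w j))%:R) = (1 + z * (pi * r ^+ 2)) ^+ size J.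
Proof.
move=> uJ iJ.
have := @Rint_prod_out J (fun=> 1) (fun j p => 1 + z * (gadj r (p.1 i) p.2)%:R) uJ (bmeas_cst _ _).
have bp (j : 'I_n) : bmeas (fun p : config * point => 1 + z * (gadj r (p.1 i) p.2)%:R).
  apply: bmeasD; [exact: bmeas_cst|apply: bmeasM; [exact: bmeas_cst|exact: bmeas_gadj]].
move=> /(_ bp) h.
transitivity (\int[P]_w (1 * \prod_(j <- J) (1 + z * (gadj r (w i) (w j))%:R))).
  by apply: eq_Rintegral => w _; rewrite mul1r.
rewrite h //; last first.
  move=> w l j x y lJ jJ /=; rewrite setposN // (inj_eq val_inj).
  by apply: contraNneq iJ => ->.
rewrite -[RHS](Rint_cst P); apply: eq_Rintegral => w _; rewrite mul1r /=.
rewrite (eq_bigr (fun=> 1 + z * (pi * r ^+ 2))) => [|j _].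
  by rewrite big_const_seq count_predT iter_mulr_1.
rewrite RintegralD //; last 2 first.
- exact: (bmeas_integrable _ (bmeas_cst _ _)).
- by apply: bmeas_integrable; apply: bmeasM; [exact: bmeas_cst|exact: bmeas_gadj1].
by rewrite Rint_cst Rint_Zl ?gadj_area //; exact: bmeas_gadj1.
Qed.

Lemma Rint_cell_gen k (c : 'I_k.+1 * 'I_k.+1) (J : seq 'I_n) (z : R) : uniq J ->
  \int[P]_w \prod_(j <- J) (1 + z * (cell k (w j) == c)%:R) = (1 + z * k.+1%:R ^- 2) ^+ size J.
Proof.
move=> uJ.
have bc : bmeas (fun x : point => (cell k x == c)%:R : R).
  by apply: bmeas_bool; exact: measurable_cell.
have bc2 : bmeas (fun p : config * point => (cell k p.2 == c)%:R : R).
  exact: (bmeas_comp (g := snd) measurable_snd bc).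
have := @Rint_prod_out J (fun=> 1) (fun j p => 1 + z * (cell k p.2 == c)%:R) uJ (bmeas_cst _ _).
have bp (j : 'I_n) : bmeas (fun p : config * point => 1 + z * (cell k p.2 == c)%:R).
  apply: bmeasD; [exact: bmeas_cst|apply: bmeasM; [exact: bmeas_cst|exact: bc2]].
move=> /(_ bp) h.
transitivity (\int[P]_w (1 * \prod_(j <- J) (1 + z * (cell k (w j) == c)%:R))).
  by apply: eq_Rintegral => w _; rewrite mul1r.
rewrite h //.
rewrite -[RHS](Rint_cst P); apply: eq_Rintegral => w _; rewrite mul1r /=.
rewrite (eq_bigr (fun=> 1 + z * k.+1%:R ^- 2)) => [|j _].
  by rewrite big_const_seq count_predT iter_mulr_1.
rewrite RintegralD //; last 2 first.
- exact: (bmeas_integrable _ (bmeas_cst _ _)).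
- by apply: bmeas_integrable; apply: bmeasM; [exact: bmeas_cst|exact: bc].
by rewrite Rint_cst Rint_Zl ?unif2_cell.
Qed.

(** Given [w i] and [w k], each factor has mean [1 - 2 s] plus a cross term that vanishes unless the
    two sensors are within [2 r] in each coordinate. The coefficient [b] stands for the chance that
    a third ring meets both rings, and [2 p <= 1] keeps the factors nonnegative. *)
Lemma Rint_pair_gen (i k : 'I_n) (J : seq 'I_n) (p b s : R) : uniq J -> i \notin J -> k \notin J -> i != k ->
  0 <= b -> 0 <= p -> 2 * p <= 1 ->
  s = p * (pi * r ^+ 2) ->
  \int[P]_w \prod_(j <- J) (1 - p * (gadj r (w i) (w j))%:R - p * (gadj r (w k) (w j))%:R
     + b * ((gadj r (w i) (w j))%:R * (gadj r (w k) (w j))%:R)) <=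
  ((1 - s) ^+ 2) ^+ size J + 16 * r ^+ 2 *
    (((1 - s) ^+ 2 + b * (pi * r ^+ 2)) ^+ size J - ((1 - s) ^+ 2) ^+ size J).
Proof.
move=> uJ iJ kJ ik b0 p0 p1 hs.
pose f (x y z : R * R) : R := 1 - p * (gadj r x z)%:R - p * (gadj r y z)%:R +
   b * ((gadj r x z)%:R * (gadj r y z)%:R).
pose phi (p : config * point) := f (p.1 i) (p.1 k) p.2.
have bphi : bmeas phi.
  apply: bmeasD.
    apply: bmeasB; last by apply: bmeasM; [exact: bmeas_cst|exact: bmeas_gadj].
    apply: bmeasB; first exact: bmeas_cst.
    by apply: bmeasM; [exact: bmeas_cst|exact: bmeas_gadj].
  apply: bmeasM; [exact: bmeas_cst|apply: bmeasM; exact: bmeas_gadj].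
have := @Rint_prod_out J (fun=> 1) (fun=> phi) uJ (bmeas_cst _ _) (fun=> bphi).
move=> h.
rewrite [leLHS](_ : _ = \int[P]_w (1 * \prod_(j <- J) phi (w, w j))); last first.
  by apply: eq_Rintegral => w _; rewrite mul1r.
rewrite h //; last first.
  move=> w l j x y lJ jJ; rewrite /phi /= !setposN // (inj_eq val_inj).
    by apply: contraNneq kJ => ->.
  by apply: contraNneq iJ => ->.
have A0 : 0 <= pi * r ^+ 2 by rewrite mulr_ge0 ?pi_ge0 ?sqr_ge0.
have Ef w : \int[@unif2 R]_x phi (w, x) <= (1 - s) ^+ 2 + b * (pi * r ^+ 2) * (near_coord (2 * r) (w i) (w k))%:R.
  have Egg : \int[@unif2 R]_x ((gadj r (w i) x)%:R * (gadj r (w k) x)%:R) <=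
     (near_coord (2 * r) (w i) (w k))%:R * (pi * r ^+ 2).
    rewrite -(gadj_area (w i) r0 r1) -Rint_Zl; last exact: bmeas_gadj1.
    apply: Rint_le; first by apply: bmeasM; exact: bmeas_gadj1.
      by apply: bmeasM; [exact: bmeas_cst|exact: bmeas_gadj1].
    move=> x; case: (boolP (gadj r (w i) x)) => h1; rewrite ?mul0r ?mulr0 ?mul1r ?mulr1 //.
    by case: (boolP (gadj r (w k) x)) => h2; rewrite ?ler0n // (gadj_near h1 h2).
  have -> : \int[@unif2 R]_x phi (w, x) = 1 - 2 * s + b * \int[@unif2 R]_x ((gadj r (w i) x)%:R * (gadj r (w k) x)%:R).
    have bg u : (bmeas (fun x : point => (gadj r u x)%:R : R)) by exact: bmeas_gadj1.
    have bpg u : bmeas (fun x : point => p * (gadj r u x)%:R) by apply: bmeasM => //; exact: bmeas_cst.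
    have bgg : bmeas (fun x : point => (gadj r (w i) x)%:R * (gadj r (w k) x)%:R : R) by exact: bmeasM.
    rewrite /phi /f /= RintegralD //; last 2 first.
    - by apply: bmeas_integrable; apply: bmeasB => //; apply: bmeasB => //; exact: bmeas_cst.
    - by apply: bmeas_integrable; apply: bmeasM => //; exact: bmeas_cst.
    rewrite RintegralB //; last 2 first.
    - by apply: bmeas_integrable; apply: bmeasB => //; exact: bmeas_cst.
    - exact: bmeas_integrable.
    rewrite RintegralB //; last 2 first.
    - by apply: bmeas_integrable; exact: bmeas_cst.
    - exact: bmeas_integrable.
    by rewrite !Rint_Zl // Rint_cst !gadj_area // hs; ring.
  have : b * \int[@unif2 R]_x ((gadj r (w i) x)%:R * (gadj r (w k) x)%:R) <= b * ((near_coord (2 * r) (w i) (w k))%:R * (pi * r ^+ 2)).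
    by rewrite ler_wpM2l.
  have : 0 <= s ^+ 2 by exact: sqr_ge0.
  have -> : (1 - s) ^+ 2 = 1 - 2 * s + s ^+ 2 by ring.
  rewrite -[b * (pi * r ^+ 2) * _]mulrA [X in _ -> _ -> _ <= _ + b * X]mulrC. lra.
set q1 := (1 - s) ^+ 2 in Ef *; set q2 := q1 + b * (pi * r ^+ 2).
have q10 : 0 <= q1 by exact: sqr_ge0.
have q12 : q1 <= q2 by rewrite lerDl mulr_ge0.
have bn : bmeas (fun w : config => (near_coord (2 * r) (w i) (w k))%:R : R).
  by apply: bmeas_bool; apply: measurable_near_coord; exact: measurable_pos.
apply: (@le_trans _ _ (\int[P]_w (q1 ^+ size J + (q2 ^+ size J - q1 ^+ size J) * (near_coord (2 * r) (w i) (w k))%:R))).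
  apply: Rint_le.
  - apply: bmeasM; first exact: bmeas_cst.
    by apply: bmeas_prod => j; exact: bmeas_avg.
  - by apply: bmeasD; [exact: bmeas_cst|apply: bmeasM => //; exact: bmeas_cst].
  move=> w; rewrite mul1r.
  have phi0 : 0 <= \int[@unif2 R]_x phi (w, x).
    apply: Rintegral_ge0 => x _; rewrite /phi /f.
    by case: (gadj r _ _); case: (gadj r _ _); rewrite ?mulr1 ?mulr0; lra.
  rewrite big_const_seq count_predT iter_mulr_1.
  have := Ef w; case: (near_coord _ _ _); rewrite ?mulr1 ?mulr0 ?addr0 => E.
    by rewrite addrC subrK lerXn2r // nnegrE // (le_trans phi0).
  by rewrite lerXn2r // nnegrE.
rewrite RintegralD //; last 2 first.
- by apply: bmeas_integrable; exact: bmeas_cst.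
- by apply: bmeas_integrable; apply: bmeasM => //; exact: bmeas_cst.
rewrite Rint_cst Rint_Zl // lerD2l mulrC ler_wpM2r //.
  by rewrite subr_ge0 lerXn2r // nnegrE // (le_trans q10).
(* With [w i] fixed, a fresh position of [k] is that close with probability at most [16 r^2]. *)
rewrite (resample (ltn_ord k)) //.
rewrite -[leRHS](Rint_cst P); apply: Rint_le.
- exact: (resample_bmeas k bn).
- exact: bmeas_cst.
move=> w; have h2r : 0 <= 2 * r by rewrite mulr_ge0.
have := near_coord_area (w i) h2r.
rewrite (_ : (2 * (2 * r)) ^+ 2 = 16 * r ^+ 2); last by ring.
apply: le_trans; rewrite le_eqVlt; apply/orP; left; apply/eqP; apply: eq_Rintegral => x _.
by rewrite setposN // /setpos eqxx.
Qed.

End PositionProducts.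

(** * Isolated sensors and the second moment *)

Section Connectivity.
Variables (R : realType) (q n K Q : nat) (r : R) (S : {set 'I_n}).
Notation rings := {ffun 'I_n -> {set 'I_Q}}.
Notation config := (config R).

Definition key (A B : {set 'I_Q}) : bool := (q <= #|A :&: B|)%N.

Definition hconn (f : rings) (w : config) : bool := H_connected q r S f (fun i => clamp2 (w i)).

Lemma key_sym A B : key A B = key B A.
Proof. by rewrite /key finset.setIC. Qed.

Lemma secure_linkE (f : rings) (w : config) (i j : 'I_n) :
  secure_link q r f (fun i => clamp2 (w i)) i j = [&& i != j, key (f i) (f j) & gadj r (w i) (w j)].
Proof. by []. Qed.

(** A Boolean function of finitely many indicators is a polynomial in them: a sum over the
    assignments satisfying [phi], each tested by a product. *)
Lemma bmeas_finite_bool (I : finType) (b : I -> config -> bool) (phi : {ffun I -> bool} -> bool) :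
  (forall i, measurable_fun setT (b i)) ->
  bmeas (fun w : config => (phi [ffun i => b i w])%:R : R).
Proof.
move=> mb.
have -> : (fun w : config => (phi [ffun i => b i w])%:R : R) =
  (fun w => \sum_(g : {ffun I -> bool}) (phi g)%:R *
       \prod_i (if g i then (b i w)%:R else 1 - (b i w)%:R)).
  apply/funext => w; rewrite (bigD1 [ffun i => b i w]) //= [X in _ * X]big1 ?mulr1; last first.
    by move=> i _; rewrite ffunE; case: (b i w); rewrite ?subr0.
  rewrite big1 ?addr0 // => g gb.
  have [i gi] : exists i, g i != b i w.
    apply/existsP; rewrite -negb_forall; apply: contra gb => /forallP h.
    by apply/eqP/ffunP => i; rewrite ffunE; apply/eqP.
  rewrite (bigD1 i) //=; move: gi; case: (g i); case: (b i w) => //= _.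
    by rewrite mul0r mulr0.
  by rewrite subrr mul0r mulr0.
apply: bmeas_sum => g; apply: bmeasM; first exact: bmeas_cst.
apply: bmeas_prod => i; case: (g i); first exact: bmeas_bool.
by apply: bmeasB; [exact: bmeas_cst|exact: bmeas_bool].
Qed.

Lemma bmeas_hconn f : bmeas (fun w => (hconn f w)%:R : R).
Proof.
pose b (ij : 'I_n * 'I_n) (w : config) := gadj r (w ij.1) (w ij.2).
pose phi (g : {ffun 'I_n * 'I_n -> bool}) := [forall i : 'I_n, forall j : 'I_n,
     (i \notin S) ==> (j \notin S) ==> connect (fun i j => [&& i \notin S, j \notin S & [&& i != j, key (f i) (f j) & g (i, j)]]) i j].
have mb ij : measurable_fun setT (b ij) by apply: measurable_gadj; exact: measurable_pos.
have := @bmeas_finite_bool _ b phi mb; congr bmeas; apply/funext => w; congr (_%:R); congr nat_of_bool.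
apply: eq_forallb => i; apply: eq_forallb => j; congr (_ ==> (_ ==> _)).
by apply: eq_connect => x y; rewrite ffunE /H_edge secure_linkE.
Qed.

Lemma bmeas_not_hconn f : bmeas (fun w => (~~ hconn f w)%:R : R).
Proof.
have := bmeasB (bmeas_cst _ 1) (bmeas_hconn f); congr bmeas.
by apply/funext => w; case: (hconn f w); rewrite ?subrr ?subr0.
Qed.

(** The indicator is a real product with one factor per other sensor, so that [Er_prod_out] and
    [Rint_prod_out] can factor its mean. *)
Definition isolated (f : rings) (w : config) (i : 'I_n) : R :=
  \prod_(j <- enum (~: S :\ i)) (1 - (key (f i) (f j))%:R * (gadj r (w i) (w j))%:R).

Lemma iso01 f w i : isolated f w i = 0 \/ isolated f w i = 1.
Proof.
rewrite /isolated; elim: (enum _) => [|j s IH]; first by right; rewrite big_nil.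
rewrite big_cons; case: (key _ _); case: (gadj _ _ _); rewrite ?mulr0 ?mulr1 ?mul0r ?subr0 ?mul1r //.
by left; rewrite subrr mul0r.
Qed.

Lemma iso_conn f w i : hconn f w -> i \in ~: S -> (1 < #|~: S|)%N -> isolated f w i = 0.
Proof.
move=> /forallP/(_ i)/forallP h iS N2; have iS' : i \notin S by rewrite inE in iS.
have [j] : exists j, j \in ~: S :\ i.
  by apply/card_gt0P; have := cardsD1 i (~: S); rewrite iS add1n => E; rewrite -ltnS -E.
rewrite !inE => /andP[ji jS].
have := h j; rewrite iS' jS /= => /connectP[[|k p] /=]; first by move=> _ E; rewrite E eqxx in ji.
case/andP => /and3P[_ kS]; rewrite secure_linkE => /and3P[ik kk g] _ _.
rewrite /isolated big_enum /= (bigD1 k) /=; last by rewrite !inE kS eq_sym ik.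
by rewrite kk g mulr1 subrr mul0r.
Qed.

Hypotheses (q0 : (0 < q)%N) (K0 : (0 < K)%N) (KQ : (K <= #|'I_Q|)%N) (KP : (K ^ 2 <= #|'I_Q|)%N).
Variable p : R.
Hypothesis hp : forall A : {set 'I_Q}, #|A| = K -> Pk R K (fun X => (q <= #|X :&: A|)%N) = p.

Variable P : probability config R.
Hypothesis resample : forall (F : config -> R) j, (j < n)%N -> bmeas F ->
  \int[P]_w F w = \int[P]_w \int[@unif2 R]_x F (setpos w j x).
Hypotheses (r0 : 0 <= r) (r1 : r <= 1 / 2).

Notation Er := (@Er R 'I_Q n K).

Lemma bmeas_Er (Phi : rings -> config -> R) : (forall f, bmeas (Phi f)) ->
  bmeas (fun w => Er (fun f => Phi f w)).
Proof.
move=> b; apply: bmeasM; last exact: bmeas_cst.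
exact: bmeas_sum.
Qed.

Lemma Rint_Er (Phi : rings -> config -> R) : (forall f, bmeas (Phi f)) ->
  \int[P]_w Er (fun f => Phi f w) = Er (fun f => \int[P]_w Phi f w).
Proof.
move=> b; under eq_Rintegral do rewrite ErE mulrC.
rewrite Rint_Zl; last exact: bmeas_sum.
by rewrite ErE Rint_sum // mulrC.
Qed.

Lemma key_prob_ge0 : 0 <= p.
Proof.
have [A AK] : exists A : {set 'I_Q}, #|A| = K.
  have : (0 < #|[set A : {set 'I_Q} | #|A| == K]|)%N by rewrite card_draws bin_gt0.
  by case/card_gt0P => A; rewrite inE => /eqP ?; exists A.
by rewrite -(hp AK) Pk_ge0.
Qed.

Lemma bmeas_iso f i : bmeas (fun w => isolated f w i).
Proof.
apply: bmeas_prod => j; apply: bmeasB; first exact: bmeas_cst.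
by apply: bmeasM; [exact: bmeas_cst|exact: bmeas_gadj2].
Qed.

Lemma ok_card (f : rings) (i : 'I_n) : ok K f -> #|f i| = K.
Proof. by move/forallP/(_ i)/eqP. Qed.

(** Given the ring of [i], averaging another ring turns its factor into 1 minus [p] times the range
    indicator; [Rint_deg_gen] then integrates the positions. *)
Lemma mean_iso i : i \in ~: S ->
  \int[P]_w Er (fun f => isolated f w i) = (1 - p * (pi * r ^+ 2)) ^+ #|~: S|.-1.
Proof.
move=> iS.
have uJ : uniq (enum (~: S :\ i)) by exact: enum_uniq.
have iJ : i \notin enum (~: S :\ i) by rewrite mem_enum !inE eqxx.
have E w : Er (fun f => isolated f w i) = \prod_(j <- enum (~: S :\ i)) (1 + (- p) * (gadj r (w i) (w j))%:R).
  transitivity (Er (fun f => 1 * isolated f w i)); first by apply: Er_ext => f _; rewrite mul1r.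
  rewrite /isolated (@Er_prod_out R _ n K KQ _ (fun=> 1) (fun j f x => 1 - (key (f i) x)%:R * (gadj r (w i) (w j))%:R)) //.
    rewrite -[RHS](Er_cst n KQ); apply: Er_ext => f okf; rewrite mul1r; apply: eq_bigr => j _.
    rewrite mulNr -(hp (ok_card i okf)) /Pk mulrC -EkZ.
    rewrite -[X in X - _](Ek_cst KQ) /Ek -mulrBl -sumrB.
    by congr (_ / _); apply: eq_bigr => x _; rewrite /key finset.setIC mulrC.
  move=> f l j x y lJ jJ; rewrite updN //.
  by apply: contraTneq lJ => <-.
under eq_Rintegral => w _ do rewrite E.
rewrite (Rint_deg_gen resample r0 r1 _ uJ iJ) mulNr; congr (_ ^+ _).
by rewrite -cardE (cardsD1 i (~: S)) iS.
Qed.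

(** The factors between [i] and [k] are at most 1 and are dropped. The others concern third sensors
    only, which are independent given the rings and positions of [i] and [k]. *)
Lemma pair_iso_le (f : rings) w i k : i != k ->
  isolated f w i * isolated f w k <= \prod_(j <- enum (~: S :\: [set i; k]))
    ((1 - (key (f i) (f j))%:R * (gadj r (w i) (w j))%:R) *
     (1 - (key (f k) (f j))%:R * (gadj r (w k) (w j))%:R)).
Proof.
move=> ik; rewrite big_split /= /isolated !big_enum /=.
have t01 i' j : 0 <= (1 - (key (f i') (f j))%:R * (gadj r (w i') (w j))%:R : R) <= 1.
  by case: (key _ _); case: (gadj _ _ _); rewrite ?mulr0 ?mulr1 ?subr0 ?subrr ?lexx ?ler01.
have h (A B : {set 'I_n}) i' : B \subset A ->
   \prod_(j in A) (1 - (key (f i') (f j))%:R * (gadj r (w i') (w j))%:R) <=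
   \prod_(j in B) (1 - (key (f i') (f j))%:R * (gadj r (w i') (w j))%:R) :> R.
  move=> BA; rewrite (big_setID B) /= (finset.setIidPr BA) -[leRHS]mulr1 ler_wpM2l //.
    by apply: prodr_ge0 => j _; case/andP: (t01 i' j).
  by apply: prodr_ile1 => j _; exact: t01.
apply: ler_pM.
- by apply: prodr_ge0 => j _; case/andP: (t01 i j).
- by apply: prodr_ge0 => j _; case/andP: (t01 k j).
- by apply: h; apply/fintype.subsetP => j; rewrite !inE negb_or => /andP[/andP[-> _] ->].
- by apply: h; apply/fintype.subsetP => j; rewrite !inE negb_or => /andP[/andP[_ ->] ->].
Qed.

Definition pboth (A B : {set 'I_Q}) : R := Pk R K (fun X => (q <= #|X :&: A|)%N && (q <= #|X :&: B|)%N).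

(** An average over rings remains on the right because [pboth] depends on the overlap of the two
    rings. *)
Lemma mean_pair i k : i \in ~: S -> k \in ~: S -> i != k -> 2 * p <= 1 ->
  let s := p * (pi * r ^+ 2) in let J := (#|~: S| - 2)%N in
  \int[P]_w Er (fun f => isolated f w i * isolated f w k) <=
  Er (fun f => ((1 - s) ^+ 2) ^+ J + 16 * r ^+ 2 *
    (((1 - s) ^+ 2 + pboth (f i) (f k) * (pi * r ^+ 2)) ^+ J - ((1 - s) ^+ 2) ^+ J)).
Proof.
move=> iS kS ik p1 /=.
set W := ~: S :\: [set i; k].
have uJ : uniq (enum W) by exact: enum_uniq.
have iJ : i \notin enum W by rewrite mem_enum !inE eqxx.
have kJ : k \notin enum W by rewrite mem_enum !inE eqxx orbT.
have sJ : size (enum W) = (#|~: S| - 2)%N.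
  rewrite -cardE cardsD (finset.setIidPr _) ?cards2 ?ik //.
  by apply/fintype.subsetP => j; rewrite finset.in_set2 => /orP[]/eqP ->.
pose psi (a b x y : bool) : R := (1 - a%:R * x%:R) * (1 - b%:R * y%:R).
pose g f (w : config) j : R := 1 - p * (gadj r (w i) (w j))%:R - p * (gadj r (w k) (w j))%:R
     + pboth (f i) (f k) * ((gadj r (w i) (w j))%:R * (gadj r (w k) (w j))%:R).
have bg f j : bmeas (fun w => g f w j).
  have b l : bmeas (fun w : config => (gadj r (w l) (w j))%:R : R) by exact: bmeas_gadj2.
  apply: bmeasD.
    apply: bmeasB; last by apply: bmeasM => //; exact: bmeas_cst.
    by apply: bmeasB; [exact: bmeas_cst|apply: bmeasM => //; exact: bmeas_cst].
  by apply: bmeasM; [exact: bmeas_cst|apply: bmeasM].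
have bpsi f : bmeas (fun w : config => \prod_(j <- enum W) psi (key (f i) (f j)) (key (f k) (f j)) (gadj r (w i) (w j)) (gadj r (w k) (w j))).
  apply: bmeas_prod => j; apply: bmeasM; (apply: bmeasB; first exact: bmeas_cst);
    by apply: bmeasM; [exact: bmeas_cst|exact: bmeas_gadj2].
apply: (@le_trans _ _ (\int[P]_w Er (fun f => \prod_(j <- enum W) g f w j))).
  apply: Rint_le.
  - by apply: bmeas_Er => f; apply: bmeasM; exact: bmeas_iso.
  - by apply: bmeas_Er => f; exact: bmeas_prod.
  move=> w; apply: (@le_trans _ _ (Er (fun f => 1 * \prod_(j <- enum W) psi (key (f i) (f j)) (key (f k) (f j)) (gadj r (w i) (w j)) (gadj r (w k) (w j))))).
    by apply: Er_le => f okf; rewrite mul1r; exact: pair_iso_le.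
  rewrite (@Er_prod_out R _ n K KQ _ (fun=> 1) (fun j f x => psi (key (f i) x) (key (f k) x) (gadj r (w i) (w j)) (gadj r (w k) (w j)))) //.
    apply: Er_le => f okf; rewrite mul1r le_eqVlt; apply/orP; left; apply/eqP; apply: eq_bigr => j _.
    rewrite /g -{1}(hp (ok_card i okf)) -(hp (ok_card k okf)) /pboth /Pk.
    rewrite ![Ek _ _ * _]mulrC -!EkZ -[X in X - _ - _](Ek_cst KQ) /Ek -!mulrBl -mulrDl -!sumrB -big_split /=.
    congr (_ / _); apply: eq_bigr => x _; rewrite /psi /key !(finset.setIC x).
    by case: (q <= #|f i :&: x|)%N; case: (q <= #|f k :&: x|)%N; case: (gadj _ _ _); case: (gadj _ _ _);
       rewrite /= ?(mulr0, mulr1, mul0r, mul1r, subr0, addr0, subrr) //; ring.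
  move=> f l j x y lJ jJ; rewrite !updN //.
    by apply: contraTneq lJ => <-.
  by apply: contraTneq lJ => <-.
rewrite Rint_Er; last by move=> f; exact: bmeas_prod.
apply: Er_le => f okf; rewrite -sJ.
apply: (Rint_pair_gen resample r0 r1 uJ iJ kJ ik) => //; [exact: Pk_ge0|exact: key_prob_ge0].
Qed.

(** Given one ring, the overlap is dominated in exponential moments by a binomial variable with [K]
    trials of probability [K / Q]. *)
Lemma exp_inter i k (th : R) : i != k -> 0 <= th ->
  Er (fun f => expR (th * #|f i :&: f k|%:R)) <= expR ((expR th - 1) * (K%:R ^+ 2 / Q%:R)).
Proof.
move=> ik th0.
have Q0 : (0 < Q)%N by move: KQ; rewrite card_ord; apply: leq_trans.
rewrite (@Er_two R _ n K KQ i k (fun x y => expR (th * #|x :&: y|%:R))) //.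
rewrite -[leRHS](Ek_cst KQ); apply: Ek_le => x xK.
have e0 : 0 <= expR th - 1 by rewrite subr_ge0 -expR0 ler_expR.
have := @Ek_expr_inter R _ K KQ x (expR th - 1) e0; rewrite card_ord xK => E.
rewrite (@eq_Ek R _ K _ (fun X => (1 + (expR th - 1)) ^+ #|X :&: x|)); last first.
  move=> y _; rewrite (_ : 1 + (expR th - 1) = expR th); last by ring.
  by rewrite -expRM_natr finset.setIC.
apply: le_trans E _.
have -> : (expR th - 1) * (K%:R ^+ 2 / Q%:R) = ((expR th - 1) * (K%:R / Q%:R)) * K%:R by ring.
rewrite expRM_natr; apply: lerXn2r; rewrite ?nnegrE ?expR_ge0 ?addr_ge0 ?mulr_ge0 ?divr_ge0 ?ler0n //.
exact: expR_ge1Dx.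
Qed.

(* Second moment method: without isolated sensors [X = 0], so connectivity costs [(X / mu - 1) ^ 2 = 1]. *)
Lemma conn_upper (s th : R) (N := #|~: S|) : s = p * (pi * r ^+ 2) -> th = 4 * N%:R * s * q.+1%:R / K%:R ->
  (1 < N)%N -> 0 <= s -> 2 * s <= 1 -> 2 * p <= 1 ->
  \int[P]_w Er (fun f => (hconn f w)%:R) <=
  (N%:R * (1 - s) ^+ N.-1)^-1 +
   (1 - s) ^- 2 * (1 + 16 * r ^+ 2 * (expR (4 * N%:R * s * p) * expR ((expR th - 1) * (K%:R ^+ 2 / Q%:R)) - 1)) - 1.
Proof.
move=> hs hth N1 s0 s1 p1.
pose X f w := \sum_(i in ~: S) isolated f w i.
set mu := N%:R * (1 - s) ^+ N.-1.
have N0 : 0 < N%:R :> R by rewrite ltr0n ltnW.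
have s1' : 0 < 1 - s by lra.
have mu0 : 0 < mu by rewrite mulr_gt0 // exprn_gt0.
have bX f : bmeas (X f) by apply: bmeas_sum => i; exact: bmeas_iso.
have EX : \int[P]_w Er (fun f => X f w) = mu.
  transitivity (\int[P]_w \sum_(i in ~: S) Er (fun f => isolated f w i)).
    by apply: eq_Rintegral => w _; rewrite -Er_sum.
  rewrite Rint_sum; last by move=> i; apply: bmeas_Er => f; exact: bmeas_iso.
  rewrite (eq_bigr (fun=> (1 - s) ^+ N.-1)); last by move=> i iS; rewrite mean_iso // hs.
  by rewrite sumr_const -/N -[LHS]mulr_natl.
pose Y := ((1 - s) ^+ 2) ^+ (N - 2).
pose D := 16 * r ^+ 2 * (expR (4 * N%:R * s * p) * expR ((expR th - 1) * (K%:R ^+ 2 / Q%:R)) - 1).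
have p0 := key_prob_ge0.
have th0 : 0 <= th by rewrite hth divr_ge0 ?mulr_ge0.
have EX2 : \int[P]_w Er (fun f => X f w ^+ 2) <= mu + N%:R ^+ 2 * (Y * (1 + D)).
  have diag : \int[P]_w Er (fun f => \sum_(i in ~: S) isolated f w i * isolated f w i) = mu.
    rewrite -EX; apply: eq_Rintegral => w _; apply: Er_ext => f _; apply: eq_bigr => i _.
    by case: (iso01 f w i) => ->; rewrite ?mulr0 ?mulr1.
  have split2 f w : X f w ^+ 2 = \sum_(i in ~: S) isolated f w i * isolated f w i +
     \sum_(i in ~: S) \sum_(k in ~: S | k != i) isolated f w i * isolated f w k.
    rewrite expr2 /X mulr_suml -big_split /=; apply: eq_bigr => i iS.
    by rewrite mulr_sumr (bigD1 i).
  have bii f : bmeas (fun w => \sum_(i in ~: S) isolated f w i * isolated f w i).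
    by apply: bmeas_sum => i; apply: bmeasM; exact: bmeas_iso.
  have bik f : bmeas (fun w => \sum_(i in ~: S) \sum_(k in ~: S | k != i) isolated f w i * isolated f w k).
    by apply: bmeas_sum => i; apply: bmeas_sum => k; apply: bmeasM; exact: bmeas_iso.
  rewrite [leLHS](_ : _ = \int[P]_w (Er (fun f => \sum_(i in ~: S) isolated f w i * isolated f w i) +
     Er (fun f => \sum_(i in ~: S) \sum_(k in ~: S | k != i) isolated f w i * isolated f w k))); last first.
    apply: eq_Rintegral => w _.
    by rewrite -ErD; apply: Er_ext => f _.
  rewrite RintegralD //; last 2 first.
  - by apply: bmeas_integrable; exact: bmeas_Er.
  - by apply: bmeas_integrable; exact: bmeas_Er.
  rewrite diag lerD2l.
  rewrite (_ : \int[P]_w _ = \sum_(i in ~: S) \sum_(k in ~: S | k != i)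
      \int[P]_w Er (fun f => isolated f w i * isolated f w k)); last first.
    transitivity (\int[P]_w \sum_(i in ~: S) \sum_(k in ~: S | k != i) Er (fun f => isolated f w i * isolated f w k)).
      apply: eq_Rintegral => w _; rewrite Er_sum; apply: eq_bigr => i _; exact: Er_sum.
    rewrite Rint_sum; last first.
      by move=> i; apply: bmeas_sum => k; apply: bmeas_Er => f; apply: bmeasM; exact: bmeas_iso.
    apply: eq_bigr => i _; rewrite Rint_sum //.
    by move=> k; apply: bmeas_Er => f; apply: bmeasM; exact: bmeas_iso.
  have Y0 : 0 <= Y by rewrite exprn_ge0 // sqr_ge0.
  have D0 : 0 <= D.
    rewrite /D mulr_ge0 ?mulr_ge0 ?sqr_ge0 // subr_ge0 -expRD -[leLHS]expR0 ler_expR.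
    rewrite addr_ge0 ?mulr_ge0 ?divr_ge0 ?ler0n ?sqr_ge0 //.
    by rewrite subr_ge0 -[leLHS]expR0 ler_expR.
  have hpair i k : i \in ~: S -> k \in ~: S -> k != i ->
      \int[P]_w Er (fun f => isolated f w i * isolated f w k) <= Y * (1 + D).
    move=> iS kS ki; have ik : i != k by rewrite eq_sym.
    apply: le_trans (mean_pair iS kS ik p1) _; rewrite -hs -/N -/Y.
    apply: (@le_trans _ _ (Er (fun f => Y * (1 - 16 * r ^+ 2) +
        Y * (16 * r ^+ 2) * expR (4 * N%:R * s * p) * expR (th * #|f i :&: f k|%:R)))).
      apply: Er_le => f okf.
      set U : R := #|f i :&: f k|%:R.
      have hb : pboth (f i) (f k) * (pi * r ^+ 2) <= s * (p + q.+1%:R / K%:R * U).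
        have := @Pk_both_le R _ K KQ (f i) (f k) q (ok_card i okf) (ok_card k okf) q0 K0 KP.
        rewrite (hp (ok_card i okf)) finset.setIC -/U -/(pboth _ _) => h.
        rewrite hs [leRHS](_ : _ = p * (p + q.+1%:R / K%:R * U) * (pi * r ^+ 2)); last by ring.
        apply: ler_wpM2r => //.
        by rewrite mulr_ge0 ?pi_ge0 ?sqr_ge0.
      have U0 : 0 <= U by rewrite ler0n.
      (* Because of this lower bound, adding [x >= 0] to [(1 - s)^2] multiplies it by at most
         [1 + 4 x <= exp (4 x)]; this is the origin of the 4 in [th]. *)
      have q1 : 1 / 4 <= (1 - s) ^+ 2 by rewrite expr2; nra.
      have key1 : ((1 - s) ^+ 2 + pboth (f i) (f k) * (pi * r ^+ 2)) ^+ (N - 2) <=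
          Y * (expR (4 * N%:R * s * p) * expR (th * U)).
        have d0 : 0 <= s * (p + q.+1%:R / K%:R * U).
          by rewrite mulr_ge0 // addr_ge0 // mulr_ge0 // divr_ge0 ?ler0n.
        have b0 : 0 <= pboth (f i) (f k) * (pi * r ^+ 2).
          apply: mulr_ge0; [exact: Pk_ge0|by rewrite mulr_ge0 ?pi_ge0 ?sqr_ge0].
        apply: (@le_trans _ _ (((1 - s) ^+ 2 * expR (4 * (s * (p + q.+1%:R / K%:R * U)))) ^+ (N - 2))).
          apply: lerXn2r.
          - by rewrite nnegrE addr_ge0 // sqr_ge0.
          - by rewrite nnegrE; apply: mulr_ge0; [exact: sqr_ge0|exact: expR_ge0].
          apply: (@le_trans _ _ ((1 - s) ^+ 2 * (1 + 4 * (s * (p + q.+1%:R / K%:R * U))))).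
            move: hb d0 q1; move: (s * (p + _)) (pboth _ _ * _) ((1 - s) ^+ 2) => d b a; nra.
          by apply: ler_wpM2l; [exact: sqr_ge0|exact: expR_ge1Dx].
        rewrite exprMn -/Y ler_wpM2l // -expRM_natr -expRD ler_expR.
        have -> : 4 * N%:R * s * p + th * U = 4 * (s * (p + q.+1%:R / K%:R * U)) * N%:R.
          by rewrite hth; ring.
        by apply: ler_wpM2l; [rewrite mulr_ge0|rewrite ler_nat leq_subr].
      have r20 : 0 <= 16 * r ^+ 2 by rewrite mulr_ge0 ?sqr_ge0.
      have := ler_wpM2l r20 key1.
      set A := (_ + pboth _ _ * _) ^+ _; set e1 := expR (4 * _ * _ * _); set e2 := expR (th * U).
      by clearbody A e1 e2 Y; lra.
    rewrite ErD Er_cst // ErZ.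
    apply: (@le_trans _ _ (Y * (1 - 16 * r ^+ 2) + Y * (16 * r ^+ 2) * expR (4 * N%:R * s * p) *
        expR ((expR th - 1) * (K%:R ^+ 2 / Q%:R)))).
      rewrite lerD2l ler_wpM2l // ?mulr_ge0 ?expR_ge0 ?sqr_ge0 //.
      exact: exp_inter.
    by rewrite /D le_eqVlt; apply/orP; left; apply/eqP; ring.
  apply: (@le_trans _ _ (\sum_(i in ~: S) \sum_(k in ~: S) Y * (1 + D))).
    apply: ler_sum => i iS; rewrite [leRHS](bigD1 i) //=.
    apply: le_trans (_ : \sum_(k in ~: S | k != i) Y * (1 + D) <= _).
      by apply: ler_sum => k /andP[kS ki]; exact: hpair.
    by rewrite lerDr mulr_ge0 // addr_ge0.
  by rewrite !sumr_const -/N -!mulrnA -[leLHS]mulr_natl natrM expr2.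
have bX2 f : bmeas (fun w => X f w ^+ 2) by apply: bmeasX.
have bc f : bmeas (fun w => (X f w / mu - 1) ^+ 2).
  by apply: bmeasX; apply: bmeasB; [apply: bmeasM => //|]; exact: bmeas_cst.
apply: (@le_trans _ _ (\int[P]_w Er (fun f => (X f w / mu - 1) ^+ 2))).
  apply: Rint_le; [by apply: bmeas_Er => f; exact: bmeas_hconn|exact: bmeas_Er|].
  move=> w; apply: Er_le => f _; case: (boolP (hconn f w)) => h; last exact: sqr_ge0.
  rewrite (_ : X f w = 0) ?mul0r ?sub0r ?sqrrN ?expr1n //.
  by rewrite /X big1 // => i iS; exact: iso_conn.
have -> : \int[P]_w Er (fun f => (X f w / mu - 1) ^+ 2) =
   (\int[P]_w Er (fun f => X f w ^+ 2)) / mu ^+ 2 - 1.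
  have e w : Er (fun f => (X f w / mu - 1) ^+ 2) =
     mu ^- 2 * Er (fun f => X f w ^+ 2) - (2 / mu * Er (fun f => X f w) - 1).
    rewrite -[X in _ = _ - (_ - X)](Er_cst n KQ) -!ErZ.
    rewrite !ErE -!mulrBl -!sumrB; congr (_ / _); apply: eq_bigr => f _.
    by field; rewrite gt_eqF.
  under eq_Rintegral => w _ do rewrite e.
  have b1 : bmeas (fun w => Er (fun f => X f w ^+ 2)) by exact: bmeas_Er.
  have b2 : bmeas (fun w => Er (fun f => X f w)) by exact: bmeas_Er.
  rewrite RintegralB //; last 2 first.
  - by apply: bmeas_integrable; apply: bmeasM => //; exact: bmeas_cst.
  - by apply: bmeas_integrable; apply: bmeasB; [apply: bmeasM => //|]; exact: bmeas_cst.
  rewrite RintegralB //; last 2 first.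
  - by apply: bmeas_integrable; apply: bmeasM => //; exact: bmeas_cst.
  - by apply: bmeas_integrable; exact: bmeas_cst.
  rewrite !Rint_Zl // Rint_cst EX.
  by field; rewrite gt_eqF.
rewrite lerD2r ler_pdivrMr ?exprn_gt0 //; apply: le_trans EX2 _.
rewrite -/D; set Z := _ ^- 2 * _.
have -> : (mu^-1 + Z) * mu ^+ 2 = mu + Z * mu ^+ 2 by field; rewrite gt_eqF.
rewrite lerD2l /Z /mu exprMn /Y.
rewrite [leRHS](_ : _ = N%:R ^+ 2 * (((1 - s) ^+ N.-1) ^+ 2 * (1 - s) ^- 2 * (1 + D))); last by ring.
rewrite le_eqVlt; apply/orP; left; apply/eqP; congr (_ * (_ * _)).
(* The squared mean carries the exponent [2 (N - 1)], the pair bound [2 (N - 2)]; the difference is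
   the factor [(1 - s) ^- 2]. *)
have e k : (1 < k)%N -> (k.-1 * 2 = 2 * (k - 2) + 2)%N by clear; lia.
rewrite -!exprM (e _ N1).
by rewrite exprD mulfK // expf_neq0 // gt_eqF.
Qed.

End Connectivity.

(** * Cuts of a disconnected graph and their probabilities *)

Section Cuts.
Variables (R : realType) (q n K Q : nat) (r : R) (S : {set 'I_n}) (k : nat).
Notation rings := {ffun 'I_n -> {set 'I_Q}}.
Notation config := (config R).
Notation M := k.+1.
Notation V := (~: S).
Notation key := (@key q Q).
Notation hconn := (@hconn R q n Q r S).

Definition no_edge (f : rings) (w : config) (B B' : {set 'I_n}) : bool :=
  [forall u in B, forall v in B', gadj r (w u) (w v) ==> ~~ key (f u) (f v)].

(** Pairs within range, whatever their keys: the key matches that must all fail for [no_edge] to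
    hold. *)
Definition cut (w : config) (B B' : {set 'I_n}) : nat :=
  #|[set uv in finset.setX B B' | gadj r (w uv.1) (w uv.2)]|.

Definition in_cell (w : config) (c : 'I_M * 'I_M) : {set 'I_n} := [set j in V | cell k (w j) == c].

Definition linked (c d : 'I_M * 'I_M) : bool :=
  [&& c.1 <= d.1.+1, d.1 <= c.1.+1, c.2 <= d.2.+1 & d.2 <= c.2.+1]%N.

(** The grid of cells is connected already without wrap-around: each index can be lowered to 0 step
    by step. *)
Lemma linked_const (st : 'I_M * 'I_M -> bool) :
  (forall c d, linked c d -> st c -> st d) -> forall c d, st c = st d.
Proof.
move=> h; have sym c d : linked c d = linked d c.
  by rewrite /linked; apply/idP/idP => /and4P[-> -> -> ->].
have e c d : linked c d -> st c = st d.
  by move=> cd; apply/idP/idP; apply: h; rewrite // sym.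
suff e0 c : st c = st (ord0, ord0) by move=> c d; rewrite !e0.
case: c => c1 c2; transitivity (st (ord0, c2)).
  case: c1 => c1; elim: c1 => [|c1 IH] lc; first by congr (st (_, _)); exact/val_inj.
  by rewrite -(IH (ltnW lc)); apply: e; rewrite /linked /=; lia.
case: c2 => c2; elim: c2 => [|c2 IH] lc; first by congr (st (_, _)); exact/val_inj.
by rewrite -(IH (ltnW lc)); apply: e; rewrite /linked /=; lia.
Qed.

(** [A] is the component of a sensor [i] that does not reach some [j]. Both orientations are
    recorded because either side may turn out to be the sparse one. *)
Lemma not_hconn_cut f w : ~~ hconn f w ->
  exists A : {set 'I_n}, [/\ A \subset V, A != finset.set0, V :\: A != finset.set0,
     no_edge f w A (V :\: A) & no_edge f w (V :\: A) A].
Proof.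
rewrite /hconn negb_forall => /existsP[i]; rewrite negb_forall => /existsP[j].
rewrite !negb_imply => /and3P[iS jS nc].
pose e := H_edge q r S f (fun i => clamp2 (w i)).
pose A := [set l in V | connect e i l].
have iA : i \in A by rewrite !inE iS connect0.
have jA : j \in V :\: A by rewrite !inE jS andbT (negbTE nc).
have ne : no_edge f w A (V :\: A).
  apply/forall_inP => u; rewrite !inE => /andP[uS iu]; apply/forall_inP => v; rewrite !inE.
  case/andP => nv vS; apply/implyP => g; apply: contra nv => kuv.
  rewrite vS /=; case: (eqVneq u v) => [<- //|uv].
  by apply: connect_trans iu (connect1 _); rewrite /e /H_edge uS vS secure_linkE kuv g uv.
exists A; split => //.
- by apply/fintype.subsetP => u; rewrite !inE => /andP[].
- by apply/finset.set0Pn; exists i.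
- by apply/finset.set0Pn; exists j.
apply/forall_inP => u uV; apply/forall_inP => v vA; apply/implyP => g.
have /forall_inP/(_ v vA)/forall_inP/(_ u uV)/implyP := ne.
by rewrite gadj_sym key_sym => /(_ g).
Qed.

Lemma no_edgeS f (w : config) (B B' D D' : {set 'I_n}) : D \subset B -> D' \subset B' -> no_edge f w B B' -> no_edge f w D D'.
Proof.
move=> /fintype.subsetP h /fintype.subsetP h' /forall_inP ne; apply/forall_inP => u uD; apply/forall_inP => v vD.
by have /forall_inP := ne u (h u uD); apply; exact: h'.
Qed.

Definition cell_obstruction f w G : bool :=
  [exists cd : ('I_M * 'I_M) * ('I_M * 'I_M), exists BB : {set 'I_n} * {set 'I_n},
    [&& linked cd.1 cd.2, BB.1 \subset in_cell w cd.1, BB.2 \subset in_cell w cd.2,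
        (G <= #|BB.1|)%N, (G <= #|BB.2|)%N, [disjoint BB.1 & BB.2] & no_edge f w BB.1 BB.2]].

Definition small_obstruction f w G : bool :=
  [exists A : {set 'I_n}, [&& A \subset V, A != finset.set0,
     [forall c, (#|A :&: in_cell w c| < G)%N] & no_edge f w A (V :\: A)]].

(* Cut the graph into a component and the rest. If no two linked cells have [G] sensors on opposite
   sides, then the side which is sparse in one cell is sparse in all cells. *)
Lemma not_hconn_obstruction f (w : config) (G lo : nat) :
  (2 * G <= lo)%N -> (forall c, (lo <= #|in_cell w c|)%N) -> ~~ hconn f w ->
  cell_obstruction f w G || small_obstruction f w G.
Proof.
move=> Glo hlo /not_hconn_cut[A [AV A0 VA0 ne ne']].
case: (boolP (cell_obstruction f w G)) => //= nobs.
have dA c d : [disjoint A :&: in_cell w c & (V :\: A) :&: in_cell w d].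
  rewrite finset.disjoints_subset; apply/fintype.subsetP => u; rewrite !inE.
  by move=> /andP[-> _].
have obs c d (B B' : {set 'I_n}) : linked c d -> [disjoint B & B'] -> no_edge f w B B' ->
    (G <= #|B :&: in_cell w c|)%N -> (G <= #|B' :&: in_cell w d|)%N -> False.
  move=> cd dB nB g1 g2; move/negP: nobs; apply; apply/existsP; exists (c, d).
  apply/existsP; exists (B :&: in_cell w c, B' :&: in_cell w d) => /=.
  rewrite cd !finset.subsetIr g1 g2 /= (no_edgeS _ _ nB) ?finset.subsetIl // andbT.
  apply: disjointWl (finset.subsetIl _ _) _; apply: disjointWr (finset.subsetIl _ _) _.
  exact: dB.
have dAV : [disjoint A & V :\: A].
  by rewrite finset.disjoints_subset; apply/fintype.subsetP => u uA; rewrite !inE uA.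
have comp c : (#|in_cell w c| = #|A :&: in_cell w c| + #|(V :\: A) :&: in_cell w c|)%N.
  rewrite -(cardsID A (in_cell w c)) finset.setIC; congr (_ + _)%N; apply: eq_card => u.
  by rewrite !inE; case: (u \in S) => //=; case: (u \in A).
pose st c := (#|A :&: in_cell w c| < G)%N.
have hst c d : linked c d -> st c -> st d.
  rewrite /st => cd sc; rewrite ltnNge; apply/negP => gd.
  have dc : linked d c by move: cd; rewrite /linked => /and4P[-> -> -> ->].
  (* As [lo >= 2 G], a cell [c] with fewer than [G] sensors of [A] has at least [G] of the other
     side, and these face the [G] sensors of [A] in the adjacent cell [d]. *)
  apply: (obs d c A (V :\: A) dc dAV ne gd).
  by move: (hlo c) Glo sc; rewrite comp; clear; lia.
have cst := linked_const hst.
have lrefl c : linked c c by rewrite /linked !leqnSn.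
apply/existsP; case: (boolP (st (ord0, ord0))) => s0.
  by exists A; rewrite AV A0 ne andbT; apply/forallP => c; rewrite -/(st c) (cst c (ord0, ord0)).
exists (V :\: A); rewrite finset.subsetDl VA0 /=; apply/andP; split; last first.
  by apply: no_edgeS ne' => //; apply/fintype.subsetP => u; rewrite !inE; case: (u \in A); case: (u \in S).
apply/forallP => c; rewrite ltnNge; apply/negP => gc.
have : ~~ st c by rewrite (cst c (ord0, ord0)).
rewrite /st -leqNgt => gA; exact: (obs c c A (V :\: A) (lrefl c) dAV ne gA gc).
Qed.

Lemma cut_linked (w : config) c d (B B' : {set 'I_n}) : 3 <= r * M%:R -> linked c d ->
  B \subset in_cell w c -> B' \subset in_cell w d -> cut w B B' = (#|B| * #|B'|)%N.
Proof.
move=> rM /and4P[h1 h2 h3 h4] /fintype.subsetP hB /fintype.subsetP hB'.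
rewrite -cardsX; apply: eq_card => -[u v]; rewrite !inE /=.
case: (boolP ((u \in B) && (v \in B'))) => //= /andP[uB vB].
have := hB u uB; have := hB' v vB; rewrite !inE => /andP[_ /eqP cv] /andP[_ /eqP cu].
by apply: (@gadj_cells _ k) => //; rewrite cu cv.
Qed.

Definition deg w i : nat := #|[set j in V :\ i | gadj r (w i) (w j)]|.

(** The neighbours of a member of [A] lie in at most 441 cells, each with fewer than [G] sensors of
    [A]; so at least [d - 441 G] of them are outside [A]. *)
Lemma cut_small (w : config) (A : {set 'I_n}) (G d : nat) : r * M%:R <= 4 ->
  A \subset V -> (forall i, i \in V -> (d <= deg w i)%N) -> (forall c, (#|A :&: in_cell w c| < G)%N) ->
  (#|A| * (d - 441 * G) <= cut w A (V :\: A))%N.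
Proof.
move=> rM AV hd hs.
have -> : cut w A (V :\: A) = (\sum_(u in A) #|[set v in V :\: A | gadj r (w u) (w v)]|)%N.
  rewrite /cut -sum1_card (partition_big fst (mem A)) /=; last first.
    by case=> u v; rewrite !inE /= => /andP[/andP[]].
  apply: eq_bigr => u uA; rewrite -sum1_card (reindex_onto (fun v => (u, v)) snd) /=; last first.
    by case=> a b /andP[_ /eqP] /= ->.
  by apply: eq_bigl => v; rewrite !inE /= !eqxx uA /= !andbT.
rewrite -sum_nat_const; apply: leq_sum => u uA.
have uV := fintype.subsetP AV u uA.
rewrite leq_subLR.
apply: leq_trans (hd u uV) _.
have -> : deg w u = (#|[set v in V :\: A | gadj r (w u) (w v)]| + #|[set v in A :\ u | gadj r (w u) (w v)]|)%N.
  rewrite /deg -(cardsID A) addnC; congr (_ + _)%N; apply: eq_card => v; rewrite !inE.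
    case: (boolP (v \in A)) => vA /=; rewrite ?andbF //= ?andbT.
    by case: (eqVneq v u) => [vu|_] //; rewrite -vu (negbTE vA) in uA.
  case: (boolP (v \in A)) => vA /=; rewrite ?andbF //= ?andbT.
  by have := fintype.subsetP AV v vA; rewrite inE => ->; rewrite /= andbT.
rewrite addnC leq_add2r.
apply: (@leq_trans (\sum_(c in near_cells (cell k (w u))) #|A :&: in_cell w c|)%N).
  rewrite -sum1_card (partition_big (fun v : 'I_n => cell k (w v)) (mem (near_cells (cell k (w u))))) /=; last first.
    by move=> v; rewrite !inE /= => /andP[_ g]; have := gadj_near_cells rM g; rewrite inE.
  apply: leq_sum => c _; rewrite -sum1_card; rewrite [leqLHS]big_mkcond [leqRHS]big_mkcond /=.
  apply: leq_sum => v _; rewrite !inE.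
  case: (boolP (v \in A)) => vA; rewrite ?andbF //=.
  have := fintype.subsetP AV v vA; rewrite inE => ->.
  by case: (cell k (w v) == c); rewrite ?andbF //=; case: ifP.
apply: (@leq_trans (\sum_(c in near_cells (cell k (w u))) G)%N).
  by apply: leq_sum => c _; exact: ltnW.
by rewrite sum_nat_const leq_mul2r card_near_cells orbT.
Qed.

Hypotheses (q0 : (0 < q)%N) (K0 : (0 < K)%N) (KQ : (K <= #|'I_Q|)%N) (KP : (K ^ 2 <= #|'I_Q|)%N).
Variables (p e : R).
Hypothesis hp : forall A : {set 'I_Q}, #|A| = K -> Pk R K (fun X => (q <= #|X :&: A|)%N) = p.
Hypotheses (e0 : 0 <= e) (e1 : e * q.+1%:R <= 1).
Notation Er := (@Er R 'I_Q n K).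
Notation good f := (@good_rings R 'I_Q n K e f).
Notation pp := (1 - (1 - e * q.+1%:R) * p).

(** Each crossing pair in range is listed once, under its larger index, so that it is tested when
    the later ring is revealed. Disjointness of [B] and [B'] makes this orientation injective. *)
Lemma Er_cut (w : config) (B B' : {set 'I_n}) : [disjoint B & B'] ->
  Er (fun f => (good f && no_edge f w B B')%:R) <= pp ^+ cut w B B'.
Proof.
move=> dB.
pose F (i : 'I_n) := [set j : 'I_n | (j < i)%N &&
   (((i \in B) && (j \in B')) || ((i \in B') && (j \in B))) && gadj r (w i) (w j)].
have FE i j : (j \in F i) = (j < i)%N && (((i \in B) && (j \in B')) || ((i \in B') && (j \in B)))
    && gadj r (w i) (w j) by rewrite inE.
have h := @Er_no_edge R 'I_Q n K KQ q q0 K0 KP p e F hp e0 e1.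
have -> : cut w B B' = (\sum_i #|F i|)%N.
  transitivity #|[set ij : 'I_n * 'I_n | ij.2 \in F ij.1]|; last first.
    rewrite -sum1_card (partition_big fst xpredT) //=; apply: eq_bigr => i _.
    rewrite -sum1_card (reindex_onto (fun j => (i, j)) snd) /=; last by case=> a b /andP[_ /eqP] /= ->.
    by apply: eq_bigl => j; rewrite !inE /= !eqxx !andbT.
  pose g (uv : 'I_n * 'I_n) := if (uv.2 < uv.1)%N then uv else (uv.2, uv.1).
  have BN u : u \in B -> u \in B' -> False by move=> a b; have := disjointFr dB a; rewrite b.
  have gi : {in [set uv in finset.setX B B' | gadj r (w uv.1) (w uv.2)] &, injective g}.
    move=> [a b] [a' b']; rewrite !inE /= => /andP[/andP[aB bB] _] /andP[/andP[a'B b'B] _].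
    rewrite /g /=; case: ifP => _; case: ifP => _ [E1 E2]; subst => //.
      by case: (BN _ aB b'B).
    by case: (BN _ a'B bB).
  rewrite /cut -(card_in_imset gi); apply: eq_card => -[i j].
  rewrite [in RHS]inE; apply/imsetP/idP => [[[u v]]|].
    rewrite !inE /= => /andP[/andP[uB vB] guv]; rewrite /g /=.
    case: ltnP => uv [-> ->]; first by rewrite uv uB vB guv.
    rewrite uB vB gadj_sym guv orbT !andbT; move: uv; rewrite leq_eqVlt => /orP[/eqP/val_inj E|//].
    by case: (BN u) => //; rewrite E.
  rewrite FE => /andP[/andP[ji /orP[]/andP[iB jB]] g'].
    by exists (i, j); rewrite ?inE ?iB ?jB ?g' // /g /= ji.
  exists (j, i); first by rewrite !inE iB jB /= gadj_sym.
  by rewrite /g /= ltnNge (ltnW ji).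
apply: le_trans (h _); last by move=> i j; rewrite FE => /andP[/andP[]].
apply: Er_le => f _; rewrite ler_nat.
case: (boolP (good f && _)) => // /andP[-> /forall_inP ne]; rewrite lt0b /=.
apply/forallP => i; apply/forall_inP => j.
rewrite FE => /andP[/andP[_ /orP[]/andP[iB jB]] g].
  by have /forall_inP/(_ j jB)/implyP/(_ g) := ne i iB; rewrite -ltnNge.
by have /forall_inP/(_ i iB)/implyP := ne j jB; rewrite gadj_sym key_sym => /(_ g); rewrite -ltnNge.
Qed.

Lemma pp_range : 0 <= pp <= 1.
Proof.
have [A AK] : exists A : {set 'I_Q}, #|A| = K.
  have : (0 < #|[set A : {set 'I_Q} | #|A| == K]|)%N by rewrite card_draws bin_gt0.
  by case/card_gt0P => A; rewrite inE => /eqP ?; exists A.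
have p0 : 0 <= p by rewrite -(hp AK) Pk_ge0.
have p1 : p <= 1 by rewrite -(hp AK) Pk_le1.
have e0' : 0 <= e * q.+1%:R by rewrite mulr_ge0.
have e1' := e1.
by move: (e * _) e0' e1' => x *; apply/andP; split; nra.
Qed.

(** A union bound over [not_hconn_obstruction] on good rings: at most [M ^ 4] pairs of cells with
    [4 ^ H] pairs of subsets, each failing at least [G ^ 2] key matches, and all sparse sets [A],
    each failing at least [#|A| (d - 441 G)] of them. *)
Lemma Er_not_conn (w : config) (G lo H d : nat) :
  (2 * G <= lo)%N -> 3 <= r * M%:R -> r * M%:R <= 4 ->
  (forall i, i \in V -> (d <= deg w i)%N) ->
  (forall c, (lo <= #|in_cell w c| <= H)%N) ->
  Er (fun f => (~~ hconn f w)%:R) <=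
  Er (fun f => (~~ good f)%:R) + (M ^ 4)%:R * 4 ^+ H * pp ^+ (G ^ 2)
   + ((1 + pp ^+ (d - 441 * G)) ^+ #|V| - 1).
Proof.
move=> Glo rM1 rM2 hd hc.
have /andP[pp0 pp1] := pp_range.
set x := pp ^+ (d - 441 * G).
have x0 : 0 <= x by exact: exprn_ge0.
pose C1 (t : (('I_M * 'I_M) * ('I_M * 'I_M)) * ({set 'I_n} * {set 'I_n})) :=
   [&& linked t.1.1 t.1.2, t.2.1 \subset in_cell w t.1.1, t.2.2 \subset in_cell w t.1.2,
        (G <= #|t.2.1|)%N, (G <= #|t.2.2|)%N & [disjoint t.2.1 & t.2.2]].
pose C2 (A : {set 'I_n}) := [&& A \subset V, A != finset.set0 & [forall c, (#|A :&: in_cell w c| < G)%N]].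
have le1 f : (~~ hconn f w)%:R <= (~~ good f)%:R +
     \sum_(t | C1 t) (good f && no_edge f w t.2.1 t.2.2)%:R +
     \sum_(A | C2 A) (good f && no_edge f w A (V :\: A))%:R :> R.
  case: (boolP (good f)) => gf /=; last first.
    rewrite -[leLHS]addr0 -addrA lerD ?lern1 ?leq_b1 // addr_ge0 // sumr_ge0 //.
  case: (boolP (hconn f w)) => hcf /=; first by rewrite !addr_ge0 ?sumr_ge0.
  rewrite add0r; have hlo c : (lo <= #|in_cell w c|)%N by case/andP: (hc c).
  have /orP[] := not_hconn_obstruction Glo hlo hcf.
    move=> /existsP[cd /existsP[BB /and3P[a1 a2 /and4P[a3 a4 a5 /andP[a6 a7]]]]].
    rewrite (bigD1 (cd, BB)) /=; last by rewrite /C1 /= a1 a2 a3 a4 a5 a6.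
    by rewrite a7 -addrA lerDl addr_ge0 ?sumr_ge0.
  move=> /existsP[A /and4P[a1 a2 a3 a4]].
  rewrite [X in _ + X](bigD1 A) /=; last by rewrite /C2 a1 a2 a3.
  by rewrite a4 addrCA lerDl addr_ge0 ?sumr_ge0.
apply: (@le_trans _ _ (Er (fun f => (~~ good f)%:R +
     \sum_(t | C1 t) (good f && no_edge f w t.2.1 t.2.2)%:R +
     \sum_(A | C2 A) (good f && no_edge f w A (V :\: A))%:R))).
  by apply: Er_le => f _; exact: le1.
rewrite !ErD !Er_sum -!addrA lerD2l; apply: lerD.
  apply: (@le_trans _ _ (\sum_(t | C1 t) pp ^+ (G ^ 2))).
    apply: ler_sum => t /and5P[a1 a2 a3 a4 /andP[a5 a6]].
    apply: le_trans (Er_cut w a6) _; rewrite (cut_linked rM1 a1 a2 a3).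
    by apply: ler_wiXn2l => //; rewrite expnS expn1 leq_mul.
  rewrite sumr_const -[leLHS]mulr_natl; apply: ler_wpM2r; first exact: exprn_ge0.
  apply: (@le_trans _ _ (\sum_(t | C1 t) 1%N)%N%:R); first by rewrite sum1_card.
  rewrite -(pair_big_dep xpredT (fun cd BB => C1 (cd, BB)) (fun _ _ => 1%N)) /=.
  apply: (@le_trans _ _ (\sum_(cd : ('I_M * 'I_M) * ('I_M * 'I_M)) 4 ^ H)%N%:R); last first.
    rewrite sum_nat_const !card_prod !card_ord natrM [in leRHS](_ : (M ^ 4 = M * M * (M * M))%N) ?natrX //.
    by rewrite !expnS expn0; lia.
  rewrite ler_nat; apply: leq_sum => cd _.
  apply: (@leq_trans #|finset.setX (powerset (in_cell w cd.1)) (powerset (in_cell w cd.2))|).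
    rewrite sum1_card; apply: subset_leq_card; apply/fintype.subsetP => BB.
    by rewrite !inE /= => /and3P[_ h1 /andP[h2 _]]; rewrite h1 h2.
  rewrite cardsX !card_powerset -expnD (_ : 4 = 2 ^ 2)%N // -expnM leq_exp2l //.
  have /andP[_ h1] := hc cd.1; have /andP[_ h2] := hc cd.2; lia.
apply: (@le_trans _ _ (\sum_(A | C2 A) x ^+ #|A|)).
  apply: ler_sum => A /and3P[a1 a2 /forallP a3].
  apply: le_trans (Er_cut w _) _.
    by rewrite finset.disjoints_subset; apply/fintype.subsetP => u uA; rewrite !inE uA.
  by rewrite /x -exprM mulnC; apply: ler_wiXn2l => //; exact: cut_small.
(* Removing the empty set from the full sum over subsets accounts for the [- 1]. *)
rewrite -sum_subsets_exp [in leRHS](bigD1 finset.set0) ?finset.sub0set //= cards0 expr0 addrAC subrr add0r.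
rewrite [leLHS]big_mkcond [leRHS]big_mkcond /=; apply: ler_sum => A _.
rewrite /C2; case: (A \subset V) => //=; case: (A != finset.set0) => //=.
by case: ifP => // _; exact: exprn_ge0.
Qed.

End Cuts.

Lemma prod_indicator (R : comNzRingType) (I : finType) (B : {set I}) (b : pred I) (z : R) :
  \prod_(j <- enum B) (1 + z * (b j)%:R) = (1 + z) ^+ #|[set j in B | b j]|.
Proof.
rewrite big_enum /= -prodr_const (bigID b) /= [X in _ * X]big1 ?mulr1; last first.
  by move=> j /andP[_ /negbTE ->]; rewrite mulr0 addr0.
apply: eq_big => j; first by rewrite inE.
by case/andP => _ ->; rewrite mulr1.
Qed.

Lemma half_pow_le (R : realType) (m : nat) : (2 : R) ^- m <= expR (- (m%:R / 2)).
Proof.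
have h : (2 : R)^-1 <= expR (- (1 / 2)).
  by apply: le_trans (expR_ge1Dx _); lra.
have -> : - (m%:R / 2) = (- (1 / 2)) * m%:R :> R by lra.
by rewrite expRM_natr -exprVn; apply: lerXn2r; rewrite ?nnegrE ?invr_ge0 ?expR_ge0.
Qed.

Lemma exp_deg_bound (R : realType) (x : R) (m : nat) : 0 <= 1 + x -> (1 + x) ^+ m <= expR (x * m%:R).
Proof.
by move=> x0; rewrite expRM_natr; apply: lerXn2r; rewrite ?nnegrE ?expR_ge0 ?expR_ge1Dx.
Qed.

(** * Concentration of degrees, cell counts and ring overlaps *)

Section Tails.
Variables (R : realType) (q n K Q : nat) (r : R) (S : {set 'I_n}) (k : nat).
Notation rings := {ffun 'I_n -> {set 'I_Q}}.
Notation config := (config R).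
Notation M := k.+1.
Notation V := (~: S).
Notation hconn := (@hconn R q n Q r S).
Notation deg := (@deg R n r S).
Notation in_cell := (@in_cell R n S k).

Variable P : probability config R.
Hypothesis resample : forall (F : config -> R) j, (j < n)%N -> bmeas F ->
  \int[P]_w F w = \int[P]_w \int[@unif2 R]_x F (setpos w j x).
Hypotheses (r0 : 0 <= r) (r1 : r <= 1 / 2).

Lemma bmeas_deg (phi : nat -> bool) (i : 'I_n) : bmeas (fun w : config => (phi (deg w i))%:R : R).
Proof.
pose b (j : 'I_n) (w : config) := gadj r (w i) (w j).
have mb j : measurable_fun setT (b j) by apply: measurable_gadj; exact: measurable_pos.
have := @bmeas_finite_bool R _ b (fun g => phi #|[set j in V :\ i | g j]|) mb.
congr bmeas; apply/funext => w; congr (_%:R); congr nat_of_bool; congr phi.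
by apply: eq_card => j; rewrite !inE ffunE.
Qed.

Lemma bmeas_in_cell (phi : nat -> bool) c : bmeas (fun w : config => (phi #|in_cell w c|)%:R : R).
Proof.
pose b (j : 'I_n) (w : config) := cell k (w j) == c.
have mb j : measurable_fun setT (b j).
  exact: (measurableT_comp (measurable_cell c) (measurable_pos j)).
have := @bmeas_finite_bool R _ b (fun g => phi #|[set j in V | g j]|) mb.
congr bmeas; apply/funext => w; congr (_%:R); congr nat_of_bool; congr phi.
by apply: eq_card => j; rewrite !inE ffunE.
Qed.

(* Chernoff bounds, with the multiplicative tilt [1 - t] below the mean and [2] above it. *)
Lemma lower_tilt (t mean : R) (d m : nat) : 0 < t < 1 -> d%:R <= (1 - t) ^+ 2 * mean * m%:R ->
  0 <= mean <= 1 ->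
  (1 - t) ^- d * (1 + (- t) * mean) ^+ m <= expR (- (t ^+ 2 * mean * m%:R)).
Proof.
move=> /andP[t0 t1] hd /andP[mean0 mean1].
have t1' : 0 < 1 - t by lra.
have h1 : (1 - t) ^- d <= expR (t / (1 - t) * d%:R).
  rewrite expRM_natr -exprVn; apply: lerXn2r; rewrite ?nnegrE ?expR_ge0 ?invr_ge0 ?(ltW t1') //.
  rewrite [leLHS](_ : _ = 1 + t / (1 - t)); last by field; lra.
  exact: expR_ge1Dx.
have h2 : (1 + (- t) * mean) ^+ m <= expR (- t * mean * m%:R).
  by apply: exp_deg_bound; nra.
have p2 : 0 <= (1 + (- t) * mean) ^+ m by apply: exprn_ge0; nra.
apply: le_trans (ler_pM _ p2 h1 h2) _; first by rewrite invr_ge0 exprn_ge0 // ltW.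
rewrite -expRD ler_expR.
have : t / (1 - t) * d%:R <= t / (1 - t) * ((1 - t) ^+ 2 * mean * m%:R).
  by apply: ler_wpM2l => //; rewrite divr_ge0 // ltW.
(* In units of the mean, the threshold contributes [t (1 - t)] to the exponent and the moment [- t];
   together [- t^2]. *)
have -> : t / (1 - t) * ((1 - t) ^+ 2 * mean * m%:R) = t * (1 - t) * mean * m%:R by field; lra.
by move: (mean) (m%:R : R) => u v; nra.
Qed.

Lemma deg_tail i (d : nat) (t : R) : i \in V -> 0 < t < 1 ->
  d%:R <= (1 - t) ^+ 2 * (pi * r ^+ 2) * #|V|.-1%:R -> pi * r ^+ 2 <= 1 ->
  \int[P]_w (deg w i < d)%N%:R <= expR (- (t ^+ 2 * (pi * r ^+ 2) * #|V|.-1%:R)).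
Proof.
move=> iV t01 hd A1; have /andP[t0 t1] := t01.
have uJ : uniq (enum (V :\ i)) by exact: enum_uniq.
have iJ : i \notin enum (V :\ i) by rewrite mem_enum !inE eqxx.
have sJ : size (enum (V :\ i)) = #|V|.-1 by rewrite -cardE (cardsD1 i V) iV.
have A0 : 0 <= pi * r ^+ 2 by rewrite mulr_ge0 ?pi_ge0 ?sqr_ge0.
apply: le_trans (lower_tilt t01 hd _); last by rewrite A0.
rewrite -sJ -(Rint_deg_gen resample r0 r1 (- t) uJ iJ) -Rint_Zl; last first.
  apply: bmeas_prod => j; apply: bmeasD; first exact: bmeas_cst.
  by apply: bmeasM; [exact: bmeas_cst|exact: bmeas_gadj2].
apply: Rint_le.
- exact: (bmeas_deg (fun x => x < d)%N).
- apply: bmeasM; first exact: bmeas_cst.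
  apply: bmeas_prod => j; apply: bmeasD; first exact: bmeas_cst.
  by apply: bmeasM; [exact: bmeas_cst|exact: bmeas_gadj2].
move=> w; rewrite prod_indicator -/(deg w i).
have t1' : 0 < 1 - t by lra.
case: ltnP => [h|_]; last by rewrite mulr_ge0 ?invr_ge0 ?exprn_ge0 // ltW.
rewrite [leRHS]mulrC ler_pdivlMr ?exprn_gt0 // [leLHS]mul1r.
by apply: ler_wiXn2l; [exact: ltW|lra|exact: ltnW].
Qed.

Lemma cell_lower_tail c (lo : nat) : lo%:R <= M%:R ^- 2 * #|V|%:R / 4 :> R ->
  \int[P]_w (#|in_cell w c| < lo)%N%:R <= expR (- (M%:R ^- 2 * #|V|%:R / 4)).
Proof.
move=> hlo.
have uJ : uniq (enum V) by exact: enum_uniq.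
have M1 : (1 : R) <= M%:R by rewrite ler1n.
have a01 : 0 <= (M%:R ^- 2 : R) <= 1.
  by rewrite invr_ge0 exprn_ge0 ?ler0n //= invf_le1 ?exprn_gt0 ?ltr0n // exprn_ege1.
have t01 : 0 < (1 / 2 : R) < 1 by apply/andP; split; lra.
have hd : lo%:R <= (1 - 1 / 2) ^+ 2 * M%:R ^- 2 * #|V|%:R :> R.
  apply: le_trans hlo _; rewrite le_eqVlt; apply/orP; left; apply/eqP.
  by move: (M%:R ^- 2) (#|V|%:R) => a b; field.
apply: (@le_trans _ _ (expR (- ((1 / 2) ^+ 2 * M%:R ^- 2 * #|V|%:R)))); last first.
  rewrite ler_expR lerN2 le_eqVlt; apply/orP; left; apply/eqP.
  by move: (M%:R ^- 2) (#|V|%:R) => a b; field.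
apply: le_trans (lower_tilt t01 hd a01).
rewrite [in leRHS](cardE V) -(Rint_cell_gen resample c (- (1 / 2)) uJ) -Rint_Zl; last first.
  apply: bmeas_prod => j; apply: bmeasD; first exact: bmeas_cst.
  apply: bmeasM; [exact: bmeas_cst|apply: bmeas_bool].
  exact: (measurableT_comp (measurable_cell c) (measurable_pos j)).
apply: Rint_le.
- exact: (bmeas_in_cell (fun x => x < lo)%N).
- apply: bmeasM; first exact: bmeas_cst.
  apply: bmeas_prod => j; apply: bmeasD; first exact: bmeas_cst.
  apply: bmeasM; [exact: bmeas_cst|apply: bmeas_bool].
  exact: (measurableT_comp (measurable_cell c) (measurable_pos j)).
move=> w; rewrite (prod_indicator _ (fun j : 'I_n => cell k (w j) == c)) -/(in_cell w c).
have t1' : 0 < 1 - 1 / 2 :> R by lra.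
case: ltnP => [h|_]; last by rewrite mulr_ge0 ?invr_ge0 ?exprn_ge0 // ltW.
rewrite [leRHS]mulrC ler_pdivlMr ?exprn_gt0 // [leLHS]mul1r.
by apply: ler_wiXn2l; [exact: ltW|lra|exact: ltnW].
Qed.

Lemma cell_upper_tail c (H : nat) : 4 * (M%:R ^- 2 * #|V|%:R) <= H%:R :> R ->
  \int[P]_w (H < #|in_cell w c|)%N%:R <= expR (- (M%:R ^- 2 * #|V|%:R)).
Proof.
move=> hH.
have uJ : uniq (enum V) by exact: enum_uniq.
have a0 : 0 <= (M%:R ^- 2 : R) by rewrite invr_ge0 exprn_ge0 ?ler0n.
apply: (@le_trans _ _ (2 ^- H * (1 + 1 * M%:R ^- 2) ^+ #|V|)); last first.
  rewrite mul1r; apply: (@le_trans _ _ (expR (- (H%:R / 2)) * expR (M%:R ^- 2 * #|V|%:R))).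
    apply: ler_pM; rewrite ?invr_ge0 ?exprn_ge0 ?addr_ge0 //; first exact: half_pow_le.
    by apply: exp_deg_bound; rewrite addr_ge0.
  by rewrite -expRD ler_expR; move: hH; move: (M%:R ^- 2 * #|V|%:R) => u hH; lra.
rewrite [in leRHS](cardE V) -(Rint_cell_gen resample c 1 uJ) -Rint_Zl; last first.
  apply: bmeas_prod => j; apply: bmeasD; first exact: bmeas_cst.
  apply: bmeasM; [exact: bmeas_cst|apply: bmeas_bool].
  exact: (measurableT_comp (measurable_cell c) (measurable_pos j)).
apply: Rint_le.
- exact: (bmeas_in_cell (fun x => H < x)%N).
- apply: bmeasM; first exact: bmeas_cst.
  apply: bmeas_prod => j; apply: bmeasD; first exact: bmeas_cst.
  apply: bmeasM; [exact: bmeas_cst|apply: bmeas_bool].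
  exact: (measurableT_comp (measurable_cell c) (measurable_pos j)).
move=> w; rewrite (prod_indicator _ (fun j : 'I_n => cell k (w j) == c)) -/(in_cell w c).
case: ltnP => [h|_]; last by rewrite mulr_ge0 ?invr_ge0 ?exprn_ge0.
rewrite [leRHS]mulrC ler_pdivlMr ?exprn_gt0 // [leLHS]mul1r.
by apply: ler_weXn2l; [lra|exact: ltnW].
Qed.

Hypotheses (q0 : (0 < q)%N) (K0 : (0 < K)%N) (KQ : (K <= #|'I_Q|)%N) (KP : (K ^ 2 <= #|'I_Q|)%N).
Variables (p e : R).
Hypothesis hp : forall A : {set 'I_Q}, #|A| = K -> Pk R K (fun X => (q <= #|X :&: A|)%N) = p.
Hypotheses (e0 : 0 <= e) (e1 : e * q.+1%:R <= 1).
Notation Er := (@Er R 'I_Q n K).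
Notation good f := (@good_rings R 'I_Q n K e f).
Notation pp := (1 - (1 - e * q.+1%:R) * p).

(** Markov for [2 ^ #|X :&: W|]: its mean is at most [(1 + K / Q) ^ (n K)], and an overlap above
    [e K] makes it at least [exp (e K / 2)]. *)
Lemma Er_bad : Er (fun f => (~~ good f)%:R) <=
  n%:R * expR (n%:R * K%:R ^+ 2 / Q%:R - e * K%:R / 2).
Proof.
apply: (@Er_bad_rings R 'I_Q n K KQ e) => W WnK.
have c0 : 0 < expR (e * K%:R / 2) :> R by exact: expR_gt0.
apply: le_trans (Pk_markov (f := fun X => (1 + 1) ^+ #|X :&: W|) c0 _ _) _.
- by move=> X; rewrite exprn_ge0.
- move=> X _; rewrite -ltNge => h.
  rewrite (_ : 1 + 1 = 2 :> R) // -[leRHS]invrK -[leLHS]invrK.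
  rewrite lef_pV2 ?posrE ?invr_gt0 ?exprn_gt0 ?expR_gt0 //.
  apply: le_trans (half_pow_le _ _) _; rewrite -expRN ler_expR; lra.
rewrite expRD expRN ler_wpM2r ?invr_ge0 ?expR_ge0 //.
apply: le_trans (@Ek_expr_inter R _ K KQ W 1 ler01) _; rewrite mul1r card_ord.
have k0 : 0 <= K%:R / Q%:R :> R by rewrite divr_ge0 ?ler0n.
apply: le_trans (exp_deg_bound _ _) _; first by rewrite addr_ge0.
rewrite ler_expR.
apply: (@le_trans _ _ (K%:R / Q%:R * (n * K)%:R)); first by rewrite ler_wpM2l // ler_nat.
by rewrite natrM le_eqVlt; apply/orP; left; apply/eqP; ring.
Qed.

(** At positions with a low degree or an ill-filled cell the conditional probability is at most 1,
    hence at most one of the counts [D], [CL], [CH], whose means are the tail terms; elsewhere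
    [Er_not_conn] applies. *)
Lemma conn_lower (t : R) (G lo H d : nat) (N := #|V|) :
  0 < t < 1 -> pi * r ^+ 2 <= 1 ->
  (2 * G <= lo)%N -> 3 <= r * M%:R -> r * M%:R <= 4 ->
  d%:R <= (1 - t) ^+ 2 * (pi * r ^+ 2) * N.-1%:R ->
  lo%:R <= M%:R ^- 2 * N%:R / 4 :> R -> 4 * (M%:R ^- 2 * N%:R) <= H%:R :> R ->
  \int[P]_w Er (fun f => (~~ hconn f w)%:R) <=
   n%:R * expR (n%:R * K%:R ^+ 2 / Q%:R - e * K%:R / 2) +
   (M ^ 4)%:R * 4 ^+ H * pp ^+ (G ^ 2) + ((1 + pp ^+ (d - 441 * G)) ^+ N - 1) +
   (N%:R * expR (- (t ^+ 2 * (pi * r ^+ 2) * N.-1%:R)) +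
    (M ^ 2)%:R * (expR (- (M%:R ^- 2 * N%:R / 4)) + expR (- (M%:R ^- 2 * N%:R)))).
Proof.
move=> t01 A1 Glo rM1 rM2 hd hlo hH.
set B0 := _ + ((1 + _) ^+ N - 1).
pose D (w : config) : R := \sum_(i in V) (deg w i < d)%N%:R.
pose CL (w : config) : R := \sum_(c : 'I_M * 'I_M) (#|in_cell w c| < lo)%N%:R.
pose CH (w : config) : R := \sum_(c : 'I_M * 'I_M) (H < #|in_cell w c|)%N%:R.
have bD : bmeas D by apply: bmeas_sum => i; exact: (bmeas_deg (fun x => x < d)%N).
have bCL : bmeas CL by apply: bmeas_sum => c; exact: (bmeas_in_cell (fun x => x < lo)%N).
have bCH : bmeas CH by apply: bmeas_sum => c; exact: (bmeas_in_cell (fun x => H < x)%N).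
have D0 w : 0 <= D w by apply: sumr_ge0.
have CL0 w : 0 <= CL w by apply: sumr_ge0.
have CH0 w : 0 <= CH w by apply: sumr_ge0.
have /andP[pp0 pp1] := @pp_range R q K Q KQ p e hp e0 e1.
have B00 : 0 <= B0.
  apply: addr_ge0; first by apply: addr_ge0; rewrite ?mulr_ge0 ?expR_ge0 ?exprn_ge0.
  by rewrite subr_ge0 exprn_ege1 // lerDl exprn_ge0.
have bh f : bmeas (fun w => (~~ hconn f w)%:R : R) by exact: bmeas_not_hconn.
apply: (@le_trans _ _ (\int[P]_w (B0 + (D w + (CL w + CH w))))).
  apply: Rint_le.
  - exact: bmeas_Er.
  - by apply: bmeasD; [exact: bmeas_cst|apply: bmeasD => //; exact: bmeasD].
  move=> w.
  have le1 : Er (fun f => (~~ hconn f w)%:R) <= 1.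
    by rewrite -[leRHS](Er_cst n KQ); apply: Er_le => f _; rewrite lern1 leq_b1.
  have [/forall_inP gd|] := boolP [forall i in V, (d <= deg w i)%N]; last first.
    rewrite negb_forall => /existsP[i]; rewrite negb_imply -ltnNge => /andP[iV h].
    apply: le_trans le1 _; have : 1 <= D w.
      by rewrite /D (bigD1 i) //= h lerDl sumr_ge0.
    by have := CL0 w; have := CH0 w; move: B00; lra.
  have [/forallP gl|] := boolP [forall c, (lo <= #|in_cell w c|)%N]; last first.
    rewrite negb_forall => /existsP[c]; rewrite -ltnNge => h.
    apply: le_trans le1 _; have : 1 <= CL w.
      by rewrite /CL (bigD1 c) //= h lerDl sumr_ge0.
    by have := D0 w; have := CH0 w; move: B00; lra.
  have [/forallP gh|] := boolP [forall c, (#|in_cell w c| <= H)%N]; last first.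
    rewrite negb_forall => /existsP[c]; rewrite -ltnNge => h.
    apply: le_trans le1 _; have : 1 <= CH w.
      by rewrite /CH (bigD1 c) //= h lerDl sumr_ge0.
    by have := D0 w; have := CL0 w; move: B00; lra.
  have hc c : (lo <= #|in_cell w c| <= H)%N by rewrite gl gh.
  have := @Er_not_conn R q n K Q r S k q0 K0 KQ KP p e hp e0 e1 w G lo H d Glo rM1 rM2 gd hc.
  move/le_trans; apply; rewrite -[leLHS]addr0; apply: lerD; last by rewrite !addr_ge0.
  by rewrite /B0 !lerD2r Er_bad.
rewrite RintegralD //; last 2 first.
- by apply: bmeas_integrable; exact: bmeas_cst.
- by apply: bmeas_integrable; apply: bmeasD => //; exact: bmeasD.
rewrite RintegralD //; last 2 first.
- exact: bmeas_integrable.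
- by apply: bmeas_integrable; exact: bmeasD.
rewrite RintegralD //; last 2 first.
- exact: bmeas_integrable.
- exact: bmeas_integrable.
rewrite Rint_cst lerD2l mulrDr; apply: lerD; last apply: lerD.
- rewrite Rint_sum; last by move=> i; exact: (bmeas_deg (fun x => x < d)%N).
  rewrite [in leRHS]mulr_natl -sumr_const; apply: ler_sum => i iV; exact: deg_tail.
- rewrite Rint_sum; last by move=> c; exact: (bmeas_in_cell (fun x => x < lo)%N).
  apply: (@le_trans _ _ (\sum_(c : 'I_M * 'I_M) expR (- (M%:R ^- 2 * N%:R / 4)))).
    by apply: ler_sum => c _; exact: cell_lower_tail.
  by rewrite sumr_const card_prod card_ord mulnn -[leLHS]mulr_natl.
- rewrite Rint_sum; last by move=> c; exact: (bmeas_in_cell (fun x => H < x)%N).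
  apply: (@le_trans _ _ (\sum_(c : 'I_M * 'I_M) expR (- (M%:R ^- 2 * N%:R)))).
    by apply: ler_sum => c _; exact: cell_upper_tail.
  by rewrite sumr_const card_prod card_ord mulnn -[leLHS]mulr_natl.
Qed.

End Tails.

(** * Numerical estimates for the disconnected regime *)

Section RealBounds.
Variable R : realType.
Implicit Types (s p r x y : R).

Lemma expR_sub1_le x : 0 <= x -> expR x - 1 <= x * expR x.
Proof.
move=> x0; have := expR_ge1Dx (- x); rewrite expRN => h.
have e0 := expR_gt0 x; have : (1 + - x) * expR x <= 1.
  by apply: le_trans (ler_wpM2r (ltW e0) h) _; rewrite mulVf // gt_eqF.
by move: (expR x) => z; nra.
Qed.

Lemma sqr_le_exp x : 0 <= x -> x ^+ 2 <= 64 * expR (x / 4).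
Proof.
move=> x0; have h : x / 8 <= expR (x / 8) by apply: le_trans (expR_ge1Dx _); lra.
have h2 : (x / 8) ^+ 2 <= expR (x / 8) ^+ 2.
  by apply: lerXn2r; rewrite ?nnegrE ?expR_ge0 //; lra.
rewrite -expRM_natr (_ : x / 8 * 2%:R = x / 4) in h2; last by lra.
have : (x / 8) ^+ 2 = x ^+ 2 / 64 by field.
by move: h2; lra.
Qed.

Lemma one_sub_ge_exp s : 0 <= s < 1 -> expR (- (s / (1 - s))) <= 1 - s.
Proof.
move=> /andP[s0 s1]; have s1' : 0 < 1 - s by lra.
rewrite expRN -[leRHS]invrK lef_pV2 ?posrE ?invr_gt0 ?expR_gt0 //.
rewrite [leLHS](_ : _ = 1 + s / (1 - s)); first exact: expR_ge1Dx.
by field; lra.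
Qed.

(** The terms are the inverse mean, the loss from [(1 - s) ^- 2] and the correlation of pairs. The
    last is bounded uniformly in [r]: from [p r^2 <= s] one gets [16 r^2 (4 N s p) <= 64 N s^2]. *)
Lemma upper_bound_small (N : nat) s p r kap th b :
  (1 < N)%N -> 0 <= s -> 0 <= p -> 0 <= r -> r <= 1 / 2 -> 0 <= kap -> 0 <= th ->
  s = p * (pi * r ^+ 2) -> 0 < b < 1 -> s * N%:R <= b * ln N%:R ->
  s <= (1 - b) / 2 -> s <= 1 / 4 -> p <= 1 / 16 -> expR 1 * kap <= 1 -> th <= 1 ->
  (N%:R * (1 - s) ^+ N.-1)^-1 +
   (1 - s) ^- 2 * (1 + 16 * r ^+ 2 * (expR (4 * N%:R * s * p) * expR ((expR th - 1) * kap) - 1)) - 1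
  <= expR (- ((1 - b) / 2 * ln N%:R)) + 4 * s + 2 * (4096 * expR 1 * expR (- (ln N%:R / 2)) + 4 * expR 1 ^+ 2 * kap).
Proof.
move=> N1 s0 p0 r0 r1 kap0 th0 hs /andP[b0 b1] hsN sb s4 p16 ek th1.
set E := expR 1; set L := ln N%:R.
have N0 : 0 < N%:R :> R by rewrite ltr0n ltnW.
have NL : expR L = N%:R by rewrite lnK // posrE.
have L0 : 0 <= L by rewrite ln_ge0 // ler1n ltnW.
have s1 : 0 < 1 - s by lra.
have s01 : 0 <= s < 1 by apply/andP; split; lra.
have E1 : 1 <= E by apply: le_trans (expR_ge1Dx _); lra.
have part1 : (N%:R * (1 - s) ^+ N.-1)^-1 <= expR (- ((1 - b) / 2 * L)).
  rewrite expRN lef_pV2 ?posrE ?mulr_gt0 ?exprn_gt0 ?expR_gt0 //.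
  apply: (@le_trans _ _ (expR L * expR (- (s / (1 - s))) ^+ N)); last first.
    rewrite NL ler_wpM2l ?ler0n //.
    apply: (@le_trans _ _ ((1 - s) ^+ N)).
      by apply: lerXn2r; rewrite ?nnegrE ?expR_ge0 ?(ltW s1) // one_sub_ge_exp.
    by apply: ler_wiXn2l; rewrite ?(ltW s1) ?leq_pred //; lra.
  rewrite -expRM_natr -expRD ler_expR.
  (* Half of the gap [1 - b] absorbs the correction [1 / (1 - s)]; the other half remains as the
     exponent [(1 - b) / 2]. *)
  have : s / (1 - s) * N%:R <= (1 + b) / 2 * L.
    rewrite mulrAC ler_pdivrMr //; apply: le_trans hsN _.
    have hb : b <= (1 + b) / 2 * (1 - s) by have := sqr_ge0 (1 - b); nra.
    by rewrite -/L [leRHS](_ : _ = (1 + b) / 2 * (1 - s) * L); [exact: ler_wpM2r|ring].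
  by lra.
have part2 : (1 - s) ^- 2 <= 1 + 4 * s.
  by rewrite -[leLHS]mul1r ler_pdivrMr ?exprn_gt0 // expr2; nra.
set x := 4 * N%:R * s * p; set y := (expR th - 1) * kap.
have eth : 0 <= expR th - 1 by rewrite subr_ge0 -[leLHS]expR0 ler_expR.
have y0 : 0 <= y by rewrite mulr_ge0.
have yk : y <= E * kap.
  by apply: ler_wpM2r => //; rewrite lerBlDr (le_trans (_ : _ <= E)) ?ler_expR // lerDl.
have y1 : expR y <= E by rewrite ler_expR (le_trans yk).
have x0 : 0 <= x by rewrite !mulr_ge0 ?ler0n.
(* Here [N s^2 = (s N)^2 / N] with [s N <= L] and [L^2 <= 64 exp (L / 4)]. One factor [exp (L / 4)]
   is lost to [exp x] below, which leaves [exp (- L / 2)]. *)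
have hNs : N%:R * s ^+ 2 <= 64 * expR (- (L * (3 / 4))).
  have h0 : s * N%:R <= L by apply: le_trans hsN _; rewrite -/L; nra.
  have h1 : (s * N%:R) ^+ 2 <= L ^+ 2.
    by apply: lerXn2r => //; rewrite nnegrE // mulr_ge0 // ler0n.
  have h2 := sqr_le_exp L0.
  have -> : N%:R * s ^+ 2 = (s * N%:R) ^+ 2 / N%:R by field; rewrite gt_eqF.
  rewrite ler_pdivrMr // -[X in _ <= _ * X]NL -mulrA -expRD.
  by apply: le_trans h1 (le_trans h2 _); rewrite ler_wpM2l // ler_expR; lra.
have xL : x <= L / 4.
  have h1 : s * N%:R <= L by apply: le_trans hsN _; rewrite -/L; nra.
  rewrite /x (_ : 4 * N%:R * s * p = 4 * (s * N%:R) * p); last by ring.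
  have h0 : 0 <= s * N%:R by rewrite mulr_ge0 ?ler0n.
  by nra.
have pi1 : 1 <= pi :> R by have := @pi_ge2 R; lra.
have part3 : 16 * r ^+ 2 * (expR x * expR y - 1) <= 4096 * E * expR (- (L / 2)) + 4 * E ^+ 2 * kap.
  have -> : expR x * expR y - 1 = expR y * (expR x - 1) + (expR y - 1) by ring.
  rewrite mulrDr; apply: lerD.
    have hx := expR_sub1_le x0.
    apply: (@le_trans _ _ (16 * r ^+ 2 * (E * (x * expR (L / 4))))).
      rewrite ler_wpM2l ?mulr_ge0 ?sqr_ge0 //; apply: ler_pM => //; rewrite ?expR_ge0 //.
        by rewrite subr_ge0 -[leLHS]expR0 ler_expR.
      by apply: le_trans hx _; rewrite ler_wpM2l // ler_expR.
    have h1 : 16 * r ^+ 2 * x <= 64 * (N%:R * s ^+ 2).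
      rewrite /x (_ : 16 * r ^+ 2 * (4 * N%:R * s * p) = 64 * (N%:R * s) * (p * r ^+ 2)); last by ring.
      rewrite (_ : 64 * (N%:R * s ^+ 2) = 64 * (N%:R * s) * s); last by ring.
      rewrite ler_wpM2l ?mulr_ge0 ?ler0n // hs ler_wpM2l //.
      by have := sqr_ge0 r; nra.
    rewrite (_ : _ * (E * _) = (16 * r ^+ 2 * x) * (E * expR (L / 4))); last by ring.
    apply: (@le_trans _ _ (64 * (64 * expR (- (L * (3 / 4)))) * (E * expR (L / 4)))).
      rewrite ler_wpM2r ?mulr_ge0 ?expR_ge0 //.
      by apply: le_trans h1 _; rewrite ler_wpM2l.
    have -> : expR (- (L / 2)) = expR (- (L * (3 / 4))) * expR (L / 4).
      by rewrite -expRD; congr expR; lra.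
    by rewrite le_eqVlt; apply/orP; left; apply/eqP; ring.
  have r4 : 16 * r ^+ 2 <= 4.
    have : r ^+ 2 <= (1 / 2) ^+ 2 by apply: lerXn2r; rewrite ?nnegrE //; lra.
    by rewrite expr2; lra.
  have h1 : expR y - 1 <= E ^+ 2 * kap.
    apply: le_trans (expR_sub1_le y0) _.
    rewrite (_ : E ^+ 2 * kap = (E * kap) * E); last by ring.
    by apply: ler_pM => //; exact: expR_ge0.
  have h0 : 0 <= expR y - 1 by rewrite subr_ge0 -[leLHS]expR0 ler_expR.
  rewrite -[leRHS]mulrA; apply: ler_pM h0 r4 h1.
  by apply: mulr_ge0 => //; exact: sqr_ge0.
set D := 16 * _ * _ in part3 *; set B := 4096 * _ * _ + _ in part3 *.
have D0 : 0 <= D.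
  rewrite /D mulr_ge0 ?mulr_ge0 ?sqr_ge0 // subr_ge0 -expRD -[leLHS]expR0 ler_expR addr_ge0 //.
have : (1 - s) ^- 2 * (1 + D) <= (1 + 4 * s) * (1 + D) by rewrite ler_wpM2r ?addr_ge0.
by move: part1 part2; nra.
Qed.

End RealBounds.

(** * Choice of the parameters in the connected regime *)

Section LowerReal.
Variable R : realType.

Lemma pi_le4 : pi <= 4 :> R.
Proof. by have := @pihalf_lt2 R; lra. Qed.

Lemma truncn_bounds (x : R) : 0 <= x -> (Num.truncn x)%:R <= x < (Num.truncn x)%:R + 1.
Proof. by move=> x0; rewrite natr1 truncn_itv. Qed.

(** With [k.+1] the first integer above [3 / r], the product lies between 3 and [3 + r]. *)
Lemma grid_exists (r : R) : 0 < r -> r <= 1 / 2 -> exists k, 3 <= r * k.+1%:R <= 4.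
Proof.
move=> r0 r1; have /andP[k1 k2] := truncn_bounds (ltW (divr_gt0 (ltr0Sn R 2) r0)).
exists (Num.truncn (3 / r)).
have -> : (Num.truncn (3 / r)).+1%:R = (Num.truncn (3 / r))%:R + 1 :> R by rewrite natr1.
apply/andP; split.
  by rewrite [leRHS]mulrC -ler_pdivrMr //; exact: ltW.
apply: (@le_trans _ _ (r * (3 / r + 1))); first by rewrite ler_pM2l // lerD2r.
by rewrite mulrDr mulrCA mulfV ?gt_eqF // mulr1 mulr1; move: r1; clear; lra.
Qed.

(** Compares disc and cell by [9 <= r^2 M^2 <= 16] and [2 <= pi <= 4]; for [x] sensors, [u] is the
    mean number in a cell. *)
Lemma disc_cell_compare (r M x u : R) : 0 < r -> 3 <= r * M <= 4 -> 0 < x -> u * M ^+ 2 = x ->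
  [/\ 0 < u, pi * r ^+ 2 * x <= 64 * u & 9 * u <= pi * r ^+ 2 * x].
Proof.
move=> r0 /andP[M3 M4] x0 uM.
have M0 : 0 < M by rewrite -(pmulr_rgt0 _ r0); move: M3; clear; lra.
have M2 : 0 < M ^+ 2 by rewrite exprn_gt0.
have u0 : 0 < u by move: x0; rewrite -uM pmulr_lgt0.
have rM16 : r ^+ 2 * M ^+ 2 <= 16 by rewrite -exprMn expr2; move: M3 M4; clear; nra.
have rM9 : 9 <= r ^+ 2 * M ^+ 2 by rewrite -exprMn expr2; move: M3 M4; clear; nra.
have pi2 : 2 <= pi :> R := pi_ge2 R.
have pi4 := pi_le4.
have r20 : 0 < r ^+ 2 by rewrite exprn_gt0.
have e : pi * r ^+ 2 * x = pi * (r ^+ 2 * M ^+ 2) * u by rewrite -uM; ring.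
split => //; rewrite e ler_wpM2r ?(ltW u0) //.
  by move: rM16 rM9 pi2 pi4; clear; move: (r ^+ 2 * M ^+ 2) => y; nra.
by move: rM16 rM9 pi2 pi4; clear; move: (r ^+ 2 * M ^+ 2) => y; nra.
Qed.

(** The exponent is at most [ln n + e K / 4 - e K / 2], and [e K / 4 >= 2 ln n]. Here
    [K / P = o(1 / n)] and [K = omega(ln n)] act together. *)
Lemma ring_term_small (n N : nat) (K Q e : R) :
  (0 < N)%N -> (N <= n)%N -> 0 < e -> 0 <= K -> n%:R * K / Q <= e / 4 -> 8 / e * ln n%:R <= K ->
  n%:R * expR (n%:R * K ^+ 2 / Q - e * K / 2) <= expR (- ln N%:R).
Proof.
move=> N0 Nn e0 K0 hK1 hK2.
have n0 : 0 < n%:R :> R by rewrite ltr0n; apply: leq_trans Nn.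
have nL : n%:R = expR (ln n%:R) :> R by rewrite lnK // posrE.
have LnL : ln N%:R <= ln n%:R :> R by rewrite ler_ln ?posrE ?ltr0n ?ler_nat // (leq_trans N0).
rewrite [X in X * _]nL -expRD ler_expR.
have h1 : n%:R * K ^+ 2 / Q <= e / 4 * K.
  rewrite (_ : n%:R * K ^+ 2 / Q = n%:R * K / Q * K); last by ring.
  by rewrite ler_wpM2r.
have h2 : 8 * ln n%:R <= e * K.
  have := ler_wpM2l (ltW e0) hK2; rewrite mulrA (_ : e * (8 / e) = 8) //.
  by field; rewrite gt_eqF.
by move: h1 h2 LnL; clear; lra.
Qed.

Lemma pow_retention (dl p : R) (m : nat) : 0 <= dl <= 1 -> 0 <= p <= 1 ->
  (1 - (1 - dl) * p) ^+ m <= expR (- ((1 - dl) * p * m%:R)).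
Proof.
move=> /andP[d0 d1] /andP[p0 p1].
apply: le_trans (exp_deg_bound _ _) _; last by rewrite mulNr.
by move: d0 d1 p0 p1; clear; nra.
Qed.

(** The exponents of cells, subsets and missing links sum to [2 L + 10 u - 13 u <= - L]. The 13
    comes from [p G^2 / 2 >= (g^2 / 2) (p u) u] and [p u >= L / 128], hence the 256 in the
    hypothesis on [L]. *)
Lemma obstruction_term_small (M4 dl p g u L : R) (H G : nat) :
  0 <= M4 <= expR (2 * L) -> 0 <= dl <= 1 / 2 -> 0 <= p <= 1 -> 0 < g -> 0 < u -> 0 < L ->
  H%:R <= 5 * u -> g * u <= G%:R -> L <= 128 * (p * u) -> 13 * (16 * 16) <= L * g ^+ 2 -> L <= u ->
  M4 * 4 ^+ H * (1 - (1 - dl) * p) ^+ (G ^ 2) <= expR (- L).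
Proof.
move=> /andP[M40 hM4] /andP[d0 d1] /andP[p0 p1] g0 u0 L0 hH hG pu h13 uL.
have h2 : 4 ^+ H <= expR (10 * u).
  apply: (@le_trans _ _ (expR (2 * H%:R))); last by rewrite ler_expR; move: hH; clear; lra.
  rewrite expRM_natr; apply: lerXn2r; rewrite ?nnegrE ?expR_ge0 //.
  have h : 2 <= expR 1 :> R by apply: le_trans (expR_ge1Dx _); clear; lra.
  rewrite (_ : expR 2 = expR 1 * expR 1); last by rewrite -expRD; congr expR; lra.
  by move: h; clear; nra.
have h3 : (1 - (1 - dl) * p) ^+ (G ^ 2) <= expR (- (13 * u)).
  apply: le_trans (pow_retention _ _ _) _.
  - by rewrite d0; move: d1; clear; lra.
  - by rewrite p0.
  rewrite ler_expR lerN2.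
  have hG2 : (g * u) ^+ 2 <= (G ^ 2)%:R.
    by rewrite natrX; apply: lerXn2r; rewrite ?nnegrE ?ler0n // ltW // mulr_gt0.
  apply: (@le_trans _ _ (1 / 2 * p * (g * u) ^+ 2)); last first.
    apply: ler_pM => //; [by rewrite mulr_ge0|exact: sqr_ge0|].
    by rewrite ler_wpM2r //; move: d1; clear; lra.
  have g20 : 0 < g ^+ 2 by rewrite exprn_gt0.
  rewrite (_ : 1 / 2 * p * (g * u) ^+ 2 = 1 / 2 * g ^+ 2 * (p * u) * u); last by ring.
  rewrite ler_pM2r //.
  apply: (@le_trans _ _ (1 / 2 * g ^+ 2 * (L / 128))).
    by move: h13; clear; lra.
  rewrite ler_wpM2l //; first by rewrite mulr_ge0 ?(ltW g20).
  by move: pu; clear; lra.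
apply: (@le_trans _ _ (expR (2 * L) * expR (10 * u) * expR (- (13 * u)))).
  apply: ler_pM => //; first by rewrite mulr_ge0 ?exprn_ge0.
    by apply: exprn_ge0; move: d0 d1 p0 p1; clear; nra.
  by apply: ler_pM => //; rewrite exprn_ge0.
by rewrite -!expRD ler_expR; move: uL u0; clear; lra.
Qed.

(** The usable degree is at least [(1 - 4 dl) A N]: two [dl] go to the Chernoff bound, one to
    neighbours inside the sparse set, one to rounding. Rings and asymptotic ratio lose a factor
    [1 - dl] each, and the product of all three with [a] is at least [(1 - 6 dl) a = 1 + dl]. *)
Lemma small_cut_term (dl p a A L : R) (N d G : nat) :
  N%:R = expR L -> 0 < dl < 1 / 6 -> 0 <= p <= 1 -> dl * (1 + 6 * a) = a - 1 -> 1 < a -> 0 < A <= 1 -> 0 <= L ->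
  (1 - dl) * a * L <= p * (A * N%:R) -> 443 <= dl * (A * N%:R) ->
  (1 - dl) ^+ 2 * A * (N%:R - 1) <= d%:R + 1 -> 441 * G%:R <= dl * (A * N%:R) + 441 ->
  (1 + (1 - (1 - dl) * p) ^+ (d - 441 * G)) ^+ N - 1 <= expR (expR (- (dl * L))) - 1.
Proof.
move=> NL /andP[dl0 dl6] /andP[p0 p1] hdl a1 /andP[A0 A1] L0 hsN hd0 hd hG.
rewrite lerD2r.
have pp0 : 0 <= 1 - (1 - dl) * p by move: dl0 dl6 p0 p1; clear; nra.
have x0 : 0 <= (1 - (1 - dl) * p) ^+ (d - 441 * G) by exact: exprn_ge0.
apply: le_trans (exp_deg_bound _ _) _; first by rewrite addr_ge0.
rewrite ler_expR.
have AN0 : 0 <= A * N%:R by rewrite mulr_ge0 ?ler0n // ltW.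
have hT : (1 - 4 * dl) * (A * N%:R) <= (d - 441 * G)%:R.
  have h2 : (1 - 2 * dl) * (A * N%:R) - 1 <= (1 - dl) ^+ 2 * A * (N%:R - 1).
    rewrite (_ : (1 - dl) ^+ 2 * A * (N%:R - 1) =
       (1 - 2 * dl) * (A * N%:R) + dl ^+ 2 * (A * N%:R) - (1 - dl) ^+ 2 * A); last by ring.
    have h : (1 - dl) ^+ 2 * A <= 1 by rewrite expr2; move: dl0 dl6 A0 A1; clear; nra.
    have h' : 0 <= dl ^+ 2 * (A * N%:R) by rewrite mulr_ge0 ?sqr_ge0.
    by move: h h'; clear; lra.
  have h4 : 2 * (dl * (A * N%:R)) + 441 <= (1 - 2 * dl) * (A * N%:R) - 2.
    by move: hd0 dl6 AN0 dl0; clear; move: (A * N%:R) => y; nra.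
  have h5 : 441 * G%:R <= d%:R :> R by move: h2 h4 hd hG hd0; clear; lra.
  have hle : (441 * G <= d)%N by rewrite -(ler_nat R) natrM.
  by rewrite natrB // natrM; move: h2 hd hG hd0; clear; lra.
apply: (@le_trans _ _ (expR (- ((1 + dl) * L)) * expR L)); last first.
  by rewrite -expRD ler_expR; clear; lra.
rewrite -NL ler_wpM2r ?ler0n //; apply: le_trans (pow_retention _ _ _) _.
- by move: dl0 dl6; clear; lra.
- by rewrite p0.
rewrite ler_expR lerN2.
apply: (@le_trans _ _ ((1 - dl) * p * ((1 - 4 * dl) * (A * N%:R)))); last first.
  by rewrite ler_wpM2l // mulr_ge0 //; move: dl6 dl0; clear; lra.
apply: (@le_trans _ _ ((1 - dl) * (1 - 4 * dl) * ((1 - dl) * a * L))); last first.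
  rewrite (_ : (1 - dl) * p * _ = (1 - dl) * (1 - 4 * dl) * (p * (A * N%:R))); last by ring.
  by rewrite ler_wpM2l // mulr_ge0 //; move: dl6 dl0; clear; lra.
rewrite (_ : (1 - dl) * (1 - 4 * dl) * ((1 - dl) * a * L) = ((1 - dl) * (1 - 4 * dl) * (1 - dl) * a) * L); last by ring.
rewrite ler_wpM2r //.
have h1 : 1 - 6 * dl <= (1 - dl) * (1 - 4 * dl) * (1 - dl) by move: dl0 dl6; clear; nra.
have : (1 - 6 * dl) * a <= (1 - dl) * (1 - 4 * dl) * (1 - dl) * a.
  by rewrite ler_wpM2r //; move: a1; clear; lra.
by move: hdl; clear; lra.
Qed.

Lemma deg_term_small (dl A L : R) (N : nat) : N%:R = expR L -> 0 < dl < 1 / 6 -> 0 < A <= 1 -> 1 <= L ->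
  5 * L <= dl ^+ 2 * (A * N%:R) -> N%:R * expR (- (dl ^+ 2 * A * (N%:R - 1))) <= expR (- L).
Proof.
move=> NL /andP[dl0 dl6] /andP[A0 A1] L1 h; rewrite [X in X * _]NL -expRD ler_expR.
have h' : dl ^+ 2 * A <= 1 by rewrite expr2; move: dl0 dl6 A0 A1; clear; nra.
rewrite (_ : dl ^+ 2 * A * (N%:R - 1) = dl ^+ 2 * (A * N%:R) - dl ^+ 2 * A); last by ring.
by move: h h' L1; clear; lra.
Qed.

Lemma cell_term_small (L u M2 x : R) : x = expR L -> 0 <= M2 <= x -> 8 * L <= u -> 0 < u ->
  M2 * (expR (- (u / 4)) + expR (- u)) <= 2 * expR (- L).
Proof.
move=> xL /andP[M0 M2x] u8 u0.
apply: (@le_trans _ _ (expR L * (2 * expR (- (2 * L))))).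
  apply: ler_pM => //; rewrite ?addr_ge0 ?expR_ge0 // -?xL //.
  have h1 : expR (- (u / 4)) <= expR (- (2 * L)) by rewrite ler_expR; move: u8; clear; lra.
  have h2 : expR (- u) <= expR (- (2 * L)) by rewrite ler_expR; move: u8 u0; clear; lra.
  by move: h1 h2; clear; lra.
by rewrite mulrCA -expRD ler_wpM2l // ler_expR; clear; lra.
Qed.

(* [dl] solves [(1 - 6 dl) a = 1 + dl]. With [u] the mean number of sensors in a cell, [G] is about [g u],
   and [441 g u = 9 dl u] is at most the fraction [dl] of the mean degree [A N]. *)
Lemma lower_bound_small (n N q K Q : nat) (p r a dl e : R) :
  let g := dl / 49 in let L := ln N%:R in let A := pi * r ^+ 2 in
  (1 < N)%N -> (N <= n)%N -> 0 < p -> p <= 1 -> 0 < r -> r <= 1 / 2 ->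
  1 < a -> dl = (a - 1) / (1 + 6 * a) -> e = dl / q.+1%:R ->
  (1 - dl) * a * L <= p * A * N%:R ->
  n%:R * K%:R / Q%:R <= e / 4 -> 8 / e * ln n%:R <= K%:R ->
  128 * (8 * p) <= 1 -> 6 * p <= dl ^+ 2 -> 13 * (16 * 16) <= L * g ^+ 2 -> 100 <= L ->
  exists k G lo H d : nat,
  [/\ (2 * G <= lo)%N, 3 <= r * k.+1%:R, r * k.+1%:R <= 4,
    d%:R <= (1 - dl) ^+ 2 * A * N.-1%:R &
    [/\ lo%:R <= k.+1%:R ^- 2 * N%:R / 4 :> R,
    4 * (k.+1%:R ^- 2 * N%:R) <= H%:R :> R &
   n%:R * expR (n%:R * K%:R ^+ 2 / Q%:R - e * K%:R / 2) +
   (k.+1 ^ 4)%:R * 4 ^+ H * (1 - (1 - e * q.+1%:R) * p) ^+ (G ^ 2) +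
   ((1 + (1 - (1 - e * q.+1%:R) * p) ^+ (d - 441 * G)) ^+ N - 1) +
   (N%:R * expR (- (dl ^+ 2 * A * N.-1%:R)) +
    (k.+1 ^ 2)%:R * (expR (- (k.+1%:R ^- 2 * N%:R / 4)) + expR (- (k.+1%:R ^- 2 * N%:R)))) <=
   5 * expR (- L) + (expR (expR (- (dl * L))) - 1)]].
Proof.
move=> g L A N1 Nn p0 p1 r0 r1 a1 hdl he hsN hK1 hK2 p1024 pdl Lg L100.
have N0 : 0 < N%:R :> R by rewrite ltr0n ltnW.
have NL : N%:R = expR L by rewrite lnK // posrE.
have hdl' : dl * (1 + 6 * a) = a - 1 by rewrite hdl; field; move: a1; clear; lra.
have dl0 : 0 < dl by rewrite hdl divr_gt0 //; move: a1; clear; lra.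
have dl6 : dl < 1 / 6 by move: hdl' a1 dl0; clear; nra.
have dl1 : 0 < dl < 1 / 6 by rewrite dl0.
(* The overlap tolerance [e] is chosen so that the loss [e (q + 1)] in the link probability is
   [dl]. *)
have eq : e * q.+1%:R = dl by rewrite he mulrVK // unitfE pnatr_eq0.
have e0 : 0 < e by rewrite he divr_gt0 // ltr0n.
have L0 : 0 < L by move: L100; clear; lra.
have p01 : 0 <= p <= 1 by rewrite ltW.
have A01 : 0 < A <= 1.
  have pi2 : 2 <= pi :> R := pi_ge2 R.
  have pi4 := pi_le4.
  have r2 : r ^+ 2 <= 1 / 4 by rewrite expr2; move: r0 r1; clear; nra.
  have r20 : 0 < r ^+ 2 by rewrite exprn_gt0.
  by rewrite /A; apply/andP; split; move: pi2 pi4 r2 r20; clear; move: (r ^+ 2) => y; nra.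
rewrite eq -[p * A * _]mulrA in hsN *.
have [k hk] := grid_exists r0 r1; have /andP[M3 M4] := hk.
pose M : R := k.+1%:R.
have M0 : 0 < M by rewrite ltr0n.
have M2 : 0 < M ^+ 2 by rewrite exprn_gt0.
pose u : R := M ^- 2 * N%:R.
have uM : u * M ^+ 2 = N%:R by rewrite /u mulrAC mulVf ?mul1r // gt_eqF.
have [u0 u64 u9] := disc_cell_compare r0 hk N0 uM; rewrite -/A in u64 u9.
have AN0 : 0 < A * N%:R by case/andP: A01 => A0 _; rewrite mulr_gt0.
have sN : 5 / 6 * L <= p * (A * N%:R).
  apply: le_trans hsN; rewrite ler_wpM2r ?(ltW L0) //.
  by move: dl6 a1; clear; nra.
(* From [5 L / 6 <= p A N] and [A N <= 64 u]. With [1024 p <= 1] this yields [u >= 8 L], so the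
   cells are well filled. *)
have pu : L <= 128 * (p * u).
  have h : p * (A * N%:R) <= p * (64 * u) by rewrite ler_wpM2l // ltW.
  by move: h sN L0; clear; lra.
have u8 : 8 * L <= u.
  have h : 128 * (8 * p) * u <= 1 * u by rewrite ler_wpM2r // ltW.
  by move: h pu; clear; lra.
have u1 : 100 <= u by move: u8 L100; clear; lra.
have AN5 : 5 * L <= dl ^+ 2 * (A * N%:R).
  have h : 6 * p * (A * N%:R) <= dl ^+ 2 * (A * N%:R) by rewrite ler_wpM2r // ltW.
  by move: h sN; clear; lra.
have ANd : 443 <= dl * (A * N%:R).
  have h : dl ^+ 2 * (A * N%:R) <= 1 / 6 * (dl * (A * N%:R)).
    rewrite expr2 -mulrA; apply: ler_wpM2r; last exact: ltW.
    by apply: mulr_ge0; exact: ltW.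
  by move: h AN5 L100; clear; lra.
have g0 : 0 < g by rewrite divr_gt0.
have gu : g * u <= u / 294.
  have h : g <= 1 / 294 by rewrite /g; move: dl6; clear; lra.
  have h' : g * u <= 1 / 294 * u by rewrite ler_wpM2r // ltW.
  by move: h'; clear; lra.
have gd : 441 * (g * u) <= dl * (A * N%:R).
  rewrite (_ : 441 * (g * u) = dl * (9 * u)); last by rewrite /g; field.
  by rewrite ler_wpM2l // ltW.
(* [G] and [H] are rounded up, [lo] and [d] down; [2 G <= lo] survives because [g u <= u / 294] and
   [u >= 100]. *)
pose G := (Num.truncn (g * u)).+1; pose lo := Num.truncn (u / 4); pose H := (Num.truncn (4 * u)).+1.
pose d := Num.truncn ((1 - dl) ^+ 2 * A * N.-1%:R).
have /andP[G1 G2] := truncn_bounds (ltW (mulr_gt0 g0 u0)).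
have /andP[lo1 lo2] := truncn_bounds (ltW (divr_gt0 u0 (ltr0Sn R 3))).
have /andP[H1 H2] := truncn_bounds (ltW (mulr_gt0 (ltr0Sn R 3) u0)).
have dd0 : 0 <= (1 - dl) ^+ 2 * A * N.-1%:R.
  by apply: mulr_ge0; rewrite ?ler0n //; apply: mulr_ge0; [exact: sqr_ge0|case/andP: A01 => /ltW].
have /andP[d1 d2] := truncn_bounds dd0.
have GR : G%:R = (Num.truncn (g * u))%:R + 1 :> R by rewrite natr1.
have HR : H%:R = (Num.truncn (4 * u))%:R + 1 :> R by rewrite natr1.
exists k, G, lo, H, d; split => //.
  rewrite -(ler_nat R) natrM; rewrite -/lo in lo1 lo2.
  by move: GR G1 gu lo2 u1; clear; lra.
split => //; first by rewrite HR ltW.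
have pred : N.-1%:R = N%:R - 1 :> R.
  have <- : N.-1%:R + 1 = N%:R :> R by rewrite natr1 prednK // ltnW.
  by rewrite addrK.
have M2N : 0 <= ((k.+1 ^ 2)%:R : R) <= N%:R.
  rewrite ler0n natrX -/M -uM -[leLHS]mul1r ler_wpM2r ?(ltW M2) //.
  by move: u1; clear; lra.
have t1 := ring_term_small (ltnW N1) Nn e0 (ler0n R K) hK1 hK2.
have t2 : (k.+1 ^ 4)%:R * 4 ^+ H * (1 - (1 - dl) * p) ^+ (G ^ 2) <= expR (- L).
  apply: (@obstruction_term_small _ _ _ g u) => //.
  - rewrite ler0n /= (_ : (k.+1 ^ 4 = (k.+1 ^ 2) ^ 2)%N); last by rewrite -expnM.
    rewrite natrX mulrC expRM_natr -NL; case/andP: M2N => a0 b0.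
    by apply: lerXn2r; rewrite ?nnegrE ?ler0n.
  - by rewrite (ltW dl0) /=; move: dl6; clear; lra.
  - by rewrite HR; move: H1 u1; clear; lra.
  - by rewrite GR ltW.
  - by move: u8 L0; clear; lra.
have t3 : (1 + (1 - (1 - dl) * p) ^+ (d - 441 * G)) ^+ N - 1 <= expR (expR (- (dl * L))) - 1.
  apply: (@small_cut_term dl p a A) => //; first exact: ltW.
    by rewrite -pred; exact: ltW.
  by rewrite GR; move: gd G1; clear; lra.
have t4 : N%:R * expR (- (dl ^+ 2 * A * N.-1%:R)) <= expR (- L).
  rewrite pred; apply: deg_term_small => //; by move: L100; clear; lra.
have t5 := cell_term_small NL M2N u8 u0.
move: t1 t2 t3 t4 t5; rewrite -/L -/u; clear.
set x1 := n%:R * _; set x2 := _ * _ ^+ (G ^ 2); set x3 := _ ^+ N - 1; set x4 := N%:R * _; set x5 := _ * (_ + _).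
set x6 := expR (- L); set x7 := expR (expR _) - 1.
by clearbody x1 x2 x3 x4 x5 x6 x7; lra.
Qed.

End LowerReal.

(** Every integration variable lies in [[0, 1)], as does the default position [(0, 0)], so clamping
    changes nothing under the integral. *)
Lemma torus_int_clamp (R : realType) n (F : (nat -> R * R) -> \bar R) :
  torus_int n F = torus_int n (fun w => F (fun i => clamp2 (w i))).
Proof.
elim: n F => [|n IH] F /=.
  congr F; apply/funext => i; rewrite /clamp2 /= clamp_id //.
  by rewrite lexx ltr01.
apply: eq_integral => x; rewrite inE /= in_itv /= => hx.
apply: eq_integral => y; rewrite inE /= in_itv /= => hy.
rewrite IH; congr torus_int; apply/funext => w; congr F; apply/funext => i.
by case: (i == n) => //; rewrite /clamp2 /= !clamp_id.
Qed.

(* The cardinals in [p_s] and [conn_given_pos] are those of classical sets. *)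
Lemma card_mkset (T : finType) (b : pred T) : #|[set x | b x]%classic| = #|[set x | b x]|.
Proof. by apply: eq_card => x; rewrite [RHS]inE; apply/idP/idP; rewrite in_setE. Qed.

(** * From the averages of the model to expectations for a fixed captured set *)

Section Averages.
Variables (R : realType) (q n m K Q : nat) (r : R).
Hypotheses (mn : (m <= n)%N) (KQ : (K <= Q)%N).

(** By [Pk_card_ge] the inner probability is the same for every second ring, so the proportion among
    pairs is the probability for one fixed ring. *)
Lemma p_sE (A : {set 'I_Q}) : #|A| = K -> Pk R K (fun X => (q <= #|X :&: A|)%N) = p_s R q K Q.
Proof.
move=> AK.
have C0 : 'C(Q, K)%:R != 0 :> R by rewrite pnatr_eq0 -lt0n bin_gt0.
have cardK : #|[set A : {set 'I_Q} | #|A| == K]| = 'C(Q, K) by rewrite card_draws card_ord.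
rewrite /p_s !card_mkset cardK.
set c := Pk R K _.
rewrite -sum1_card natr_sum.
rewrite (eq_bigl (fun AB : {set 'I_Q} * {set 'I_Q} => (#|AB.2| == K) && ((#|AB.1| == K) && (q <= #|AB.1 :&: AB.2|)%N))); last first.
  by move=> AB; rewrite inE andbCA.
rewrite big_mkcond (eq_bigr (fun AB : {set 'I_Q} * {set 'I_Q} =>
   (#|AB.2| == K)%:R * (((#|AB.1| == K)%:R * (q <= #|AB.1 :&: AB.2|)%N%:R)) : R)); last first.
  by move=> AB _; case: (_ == K); case: (_ == K); case: (q <= _)%N; rewrite /= ?mul1r ?mul0r ?mulr0.
rewrite -(pair_big xpredT xpredT (fun X B : {set 'I_Q} => (#|B| == K)%:R * ((#|X| == K)%:R * (q <= #|X :&: B|)%N%:R) : R)) /=.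
rewrite exchange_big /=.
have E (B : {set 'I_Q}) : \sum_(X : {set 'I_Q}) (#|B| == K)%:R * ((#|X| == K)%:R * (q <= #|X :&: B|)%N%:R)
   = (#|B| == K)%:R * (c * 'C(Q, K)%:R) :> R.
  rewrite -mulr_sumr; case: (eqVneq #|B| K) => [BK|_]; last by rewrite !mul0r.
  rewrite !mul1r /c (Pk_card_ge R K q (etrans AK (esym BK))) /Pk /Ek card_ord mulfVK //.
  by rewrite [RHS]big_mkcond; apply: eq_bigr => X _; case: (_ == K); rewrite ?mul1r ?mul0r.
under eq_bigr => B _ do rewrite E.
rewrite -mulr_suml.
have -> : \sum_(B : {set 'I_Q}) (#|B| == K)%:R = 'C(Q, K)%:R :> R.
  rewrite -cardK -sum1_card natr_sum [RHS]big_mkcond; apply: eq_bigr => B _.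
  by rewrite inE; case: (_ == K).
by field.
Qed.

(* The coordinates below [n] are independent and uniform, in the form in which this is used. *)
Definition resampling (P : probability (config R) R) := forall (F : config R -> R) j, (j < n)%N -> bmeas F ->
  \int[P]_w F w = \int[P]_w \int[@unif2 R]_x F (setpos w j x).

Notation hconn := (@hconn R q n Q r).
Notation Er := (@Er R 'I_Q n K).

Lemma conn_given_posE (w : config R) :
  conn_given_pos q n m K Q r (fun i => clamp2 (w i)) =
  'C(n, m)%:R^-1 * \sum_(S : {set 'I_n} | #|S| == m) Er (fun f => (hconn S f w)%:R).
Proof.
rewrite /conn_given_pos !card_mkset card_draws card_ord (_ : #|_| = ('C(Q, K) ^ n)%N); last first.
  by rewrite -[Q in 'C(Q, _)]card_ord -card_ok.
by under [in RHS]eq_bigr => S _ do rewrite ErE card_ord; rewrite natrX invfM -mulr_suml; ring.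
Qed.

(** With the average over captured sets outermost, a bound that holds for each captured set
    suffices. *)
Lemma prob_H_connected_mean : exists P : probability (config R) R, resampling P /\
  prob_H_connected q n m K Q r =
  ('C(n, m)%:R^-1 * \sum_(S : {set 'I_n} | #|S| == m) \int[P]_w Er (fun f => (hconn S f w)%:R))%:E.
Proof.
have [P [Pint Pres]] := positions_exist R n; exists P; split => //.
rewrite /prob_H_connected torus_int_clamp.
have bE S : bmeas (fun w => Er (fun f => (hconn S f w)%:R)).
  by apply: bmeas_Er => f; exact: bmeas_hconn.
have bS : bmeas (fun w => \sum_(S : {set 'I_n} | #|S| == m) Er (fun f => (hconn S f w)%:R)).
  exact: bmeas_sum.
under [X in torus_int n X]funext => w do rewrite conn_given_posE.
rewrite (Pint (fun w => 'C(n, m)%:R^-1 * \sum_(S : {set 'I_n} | #|S| == m) Er (fun f => (hconn S f w)%:R))).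
- by rewrite Rint_Zl // Rint_sum.
- by apply: bmeasM => //; exact: bmeas_cst.
- move=> w; apply: mulr_ge0 => //; apply: sumr_ge0 => S _.
  by apply: Er_ge0 => f _; exact: ler0n.
Qed.

Lemma mean_le (x : {set 'I_n} -> R) (B : R) : (forall S : {set 'I_n}, #|S| = m -> x S <= B) ->
  'C(n, m)%:R^-1 * \sum_(S : {set 'I_n} | #|S| == m) x S <= B.
Proof.
move=> h; have C0 : 0 < 'C(n, m)%:R :> R by rewrite ltr0n bin_gt0.
rewrite ler_pdivrMl //; apply: le_trans (_ : _ <= \sum_(S : {set 'I_n} | #|S| == m) B) _.
  by apply: ler_sum => S /eqP; exact: h.
by rewrite -big_set /= sumr_const cardsE -[leLHS]mulr_natl -cardsE card_draws card_ord.
Qed.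

Lemma prob_H_connected_le B :
  (forall P (S : {set 'I_n}), resampling P -> #|~: S| = (n - m)%N -> \int[P]_w Er (fun f => (hconn S f w)%:R) <= B) ->
  (prob_H_connected q n m K Q r <= B%:E)%E.
Proof.
move=> h; have [P [Pres ->]] := prob_H_connected_mean; rewrite lee_fin.
by apply: mean_le => S Sm; apply: h => //; rewrite cardsCs finset.setCK card_ord Sm.
Qed.

Lemma Rint_hconnC (P : probability (config R) R) (S : {set 'I_n}) :
  \int[P]_w Er (fun f => (hconn S f w)%:R) = 1 - \int[P]_w Er (fun f => (~~ hconn S f w)%:R).
Proof.
have b1 : bmeas (fun w => Er (fun f => (~~ hconn S f w)%:R)).
  by apply: bmeas_Er => f; exact: bmeas_not_hconn.
rewrite -[X in _ = X - _](Rint_cst P) -RintegralB //; [|exact: (bmeas_integrable P (bmeas_cst _ 1))|exact: (bmeas_integrable P b1)].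
apply: eq_Rintegral => w _; rewrite -[X in _ = X - _](@Er_cst R 'I_Q n K) ?card_ord //.
rewrite -[in RHS]mulN1r -ErZ -ErD; apply: Er_ext => f _.
by case: hconn; rewrite ?mulr0 ?mulr1 ?addr0 ?subrr.
Qed.

Lemma prob_H_connected_ge B :
  (forall P (S : {set 'I_n}), resampling P -> #|~: S| = (n - m)%N -> \int[P]_w Er (fun f => (~~ hconn S f w)%:R) <= B) ->
  ((1 - B)%:E <= prob_H_connected q n m K Q r)%E.
Proof.
move=> h; have [P [Pres ->]] := prob_H_connected_mean; rewrite lee_fin.
rewrite -lerN2 -mulrN -sumrN.
apply: mean_le => S Sm; rewrite lerN2 Rint_hconnC lerD2l lerN2.
by apply: h => //; rewrite cardsCs finset.setCK card_ord Sm.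
Qed.

End Averages.

Lemma disc_area01 (R : realType) (r : R) : 0 <= r -> r <= 1 / 2 -> 0 <= pi * r ^+ 2 <= 1.
Proof.
move=> r0 r1; have pi2 : 2 <= pi :> R := pi_ge2 R.
have pi4 := pi_le4 R.
have r2 : r ^+ 2 <= 1 / 4 by rewrite expr2; move: r0 r1; clear; nra.
have r20 := sqr_ge0 r.
by apply/andP; split; move: pi2 pi4 r2 r20; clear; move: (r ^+ 2) => y; nra.
Qed.

(** * Explicit bounds for fixed [n] *)

Section FiniteBounds.
Variables (R : realType) (q n m K Q : nat) (r : R).
Hypotheses (q0 : (0 < q)%N) (qK : (q <= K)%N) (KQ : (K <= Q)%N) (mn : (m < n)%N).
Hypotheses (r0 : 0 <= r) (r1 : r <= 1 / 2).
Notation p := (p_s R q K Q).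
Notation N := (n - m)%N.
Notation kap := (K%:R ^+ 2 / Q%:R : R).

Lemma exists_ring : exists A : {set 'I_Q}, #|A| = K.
Proof.
have : (0 < #|[set A : {set 'I_Q} | #|A| == K]|)%N by rewrite card_draws card_ord bin_gt0.
by case/card_gt0P => A; rewrite inE => /eqP ?; exists A.
Qed.

Lemma p_s_ge0 : 0 <= p.
Proof. by have [A AK] := exists_ring; rewrite -(p_sE R q KQ AK) Pk_ge0. Qed.

Lemma p_s_le : p <= kap.
Proof.
have [A AK] := exists_ring; rewrite -(p_sE R q KQ AK).
by have := @Pk_ge_le_sq R 'I_Q K; rewrite card_ord; apply.
Qed.

Lemma prob_upper (b : R) (s : R := p * (pi * r ^+ 2)) (L : R := ln N%:R) :
  (1 < N)%N -> 0 < b < 1 -> s * N%:R <= b * L -> s <= (1 - b) / 2 -> s <= 1 / 4 ->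
  p <= 1 / 16 -> expR 1 * kap <= 1 -> kap <= 1 -> 4 * q.+1%:R * L <= K%:R ->
  (prob_H_connected q n m K Q r <=
   (expR (- ((1 - b) / 2 * L)) + 4 * s + 2 * (4096 * expR 1 * expR (- (L / 2)) + 4 * expR 1 ^+ 2 * kap))%:E)%E.
Proof.
move=> N1 b01 sN sb s4 p16 ek kap1 hK; apply: prob_H_connected_le; first exact: ltnW.
move=> P S res SN.
have [A0 A1] := andP (disc_area01 r0 r1).
have p0 := p_s_ge0.
have s0 : 0 <= s by apply: mulr_ge0.
have K0 : (0 < K)%N := leq_trans q0 qK.
have Q0 : (0 < Q)%N := leq_trans K0 KQ.
have KR : 0 < K%:R :> R by rewrite ltr0n.
have L0 : 0 <= L by rewrite ln_ge0 // ler1n ltnW.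
have kap0 : 0 <= kap :> R by rewrite divr_ge0 ?sqr_ge0.
pose th : R := 4 * N%:R * s * q.+1%:R / K%:R.
have th0 : 0 <= th by apply: divr_ge0 => //; do 2 (apply: mulr_ge0 => //); apply: mulr_ge0.
(* Here [K] has to dominate the logarithm: [s N <= L] reduces the claim to [4 (q + 1) L <= K]. *)
have th1 : th <= 1.
  rewrite /th ler_pdivrMr // mul1r; apply: le_trans hK.
  rewrite (_ : 4 * N%:R * s * q.+1%:R = 4 * q.+1%:R * (s * N%:R)); last by ring.
  rewrite ler_wpM2l ?mulr_ge0 ?ler0n //; apply: le_trans sN _.
  by rewrite -[leRHS]mul1r ler_wpM2r //; case/andP: b01 => _ /ltW.
have hp (A : {set 'I_Q}) : #|A| = K -> Pk R K (fun X : {set 'I_Q} => q <= #|X :&: A|)%N = p by exact: p_sE.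
have := @conn_upper R q n K Q r S q0 K0 _ _ p hp P res r0 r1 s th.
rewrite !card_ord SN => h; apply: le_trans (h _ _ _ _ _ _ _ _) _ => //.
- rewrite -(ler_nat R) natrX; move: kap1; rewrite ler_pdivrMr ?ltr0n // mul1r; exact.
- by move: s4; lra.
- by move: p16; lra.
- exact: upper_bound_small.
Qed.

Lemma prob_lower (a : R) (dl : R := (a - 1) / (1 + 6 * a)) (e : R := dl / q.+1%:R) (L : R := ln N%:R) :
  (1 < N)%N -> 1 < a -> 0 < p -> 0 < r -> (1 - dl) * a * L <= p * (pi * r ^+ 2) * N%:R ->
  n%:R * K%:R / Q%:R <= e / 4 -> 8 / e * ln n%:R <= K%:R -> kap <= 1 ->
  128 * (8 * p) <= 1 -> 6 * p <= dl ^+ 2 -> 13 * (16 * 16) <= L * (dl / 49) ^+ 2 -> 100 <= L ->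
  ((1 - (5 * expR (- L) + (expR (expR (- (dl * L))) - 1)))%:E <= prob_H_connected q n m K Q r)%E.
Proof.
move=> N1 a1 p0 r0' sN hnK hK kap1 p1024 pdl hL L100.
apply: prob_H_connected_ge => //; first exact: ltnW.
move=> P S res SN.
have [A0 A1] := andP (disc_area01 r0 r1).
have K0 : (0 < K)%N := leq_trans q0 qK.
have Q0 : (0 < Q)%N := leq_trans K0 KQ.
have hdl' : dl * (1 + 6 * a) = a - 1 by rewrite /dl; field; move: a1; lra.
have dl0 : 0 < dl by rewrite divr_gt0 //; move: a1; lra.
have dl6 : dl < 1 / 6 by move: hdl' a1 dl0; clearbody dl; nra.
have e0 : 0 <= e by rewrite divr_ge0 ?ler0n ?ltW.
have edl : e * q.+1%:R = dl by rewrite mulrVK // unitfE pnatr_eq0.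
have p1 : p <= 1 by move: p1024; lra.
have hp (A : {set 'I_Q}) : #|A| = K -> Pk R K (fun X : {set 'I_Q} => q <= #|X :&: A|)%N = p by exact: p_sE.
have [k [G [lo [H [d [Glo M3 M4 hd [hlo hH hB]]]]]]] :=
  @lower_bound_small R n N q K Q p r a dl e N1 (leq_subr _ _) p0 p1 r0' r1 a1 erefl erefl sN hnK hK p1024 pdl hL L100.
have := @conn_lower R q n K Q r S k P res r0 r1 q0 K0 _ _ p e hp e0 _ dl G lo H d.
rewrite !card_ord SN => h; apply: le_trans (h _ _ _ _ _ _ _ _ _ _ _) hB => //.
- rewrite -(ler_nat R) natrX; move: kap1; rewrite ler_pdivrMr ?ltr0n // mul1r; exact.
- by rewrite edl; move: dl6; lra.
- by rewrite dl0 /=; move: dl6; lra.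
Qed.

Lemma prob_H_connected_ge0 : (0%:E <= prob_H_connected q n m K Q r)%E.
Proof.
rewrite [leLHS](_ : _ = (1 - 1)%:E); last by rewrite subrr.
apply: prob_H_connected_ge => //; first exact: ltnW.
move=> P S res SN; rewrite -[leRHS](Rint_cst P); apply: Rint_le; [| exact: bmeas_cst|].
  by apply: bmeas_Er => f; exact: bmeas_not_hconn.
move=> w; rewrite -[leRHS](@Er_cst R 'I_Q n K) ?card_ord //; apply: Er_le => f _.
by case: hconn.
Qed.

Lemma prob_H_connected_le1 : (prob_H_connected q n m K Q r <= 1%:E)%E.
Proof.
apply: prob_H_connected_le => //; first exact: ltnW.
move=> P S res SN; rewrite -[leRHS](Rint_cst P); apply: Rint_le; [| exact: bmeas_cst|].
  by apply: bmeas_Er => f; exact: bmeas_hconn.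
move=> w; rewrite -[leRHS](@Er_cst R 'I_Q n K) ?card_ord //; apply: Er_le => f _.
by case: hconn.
Qed.

End FiniteBounds.

Local Open Scope classical_set_scope.
Local Open Scope ring_scope.

Lemma expRN_cvg0 (R : realType) (u : nat -> R) (c : R) : 0 < c -> u @ \oo --> +oo ->
  (fun n => expR (- (c * u n))) @ \oo --> (0 : R).
Proof.
move=> c0 uoo; apply/cvgr0Pnorm_lt => e e0.
near=> n; rewrite ger0_norm ?expR_ge0 //.
rewrite -[e]lnK ?posrE // ltr_expR -ltrN2 opprK -ltr_pdivrMl //.
by near: n; apply: cvgry_gt.
Unshelve. all: by end_near.
Qed.

(** * Passage to the limit *)

Section Limits.
Variables (R : realType) (q : nat) (K P m : nat -> nat) (r : nat -> R) (a : R).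
Hypothesis q0 : (0 < q)%N.
Hypothesis qKP : forall n, (q <= K n)%N /\ (K n <= P n)%N.
Hypothesis mn : forall n, (0 < n)%N -> (m n < n)%N.
Hypothesis r0 : forall n, 0 <= r n.
Hypothesis r1 : forall n, r n <= 1 / 2.
Hypothesis K_ln : (fun n => (K n)%:R / ln (n%:R : R)) @ \oo --> +oo.
Hypothesis kap_cvg : (fun n => (K n)%:R ^+ 2 / (P n)%:R : R) @ \oo --> (0:R).
Hypothesis KPn : (fun n => ((K n)%:R / (P n)%:R) / (1 / n%:R) : R) @ \oo --> (0:R).
Hypothesis a0 : 0 < a.
Hypothesis ratio : (fun n => (p_s R q (K n) (P n) * pi * r n ^+ 2)
             / (a * ln ((n - m n)%:R : R) / (n - m n)%:R)) @ \oo --> (1:R).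

Let p n := p_s R q (K n) (P n).
Let N n := (n - m n)%N.
Let s n := p n * (pi * r n ^+ 2).
Let L n : R := ln (N n)%:R.
Let rho n := s n / (a * L n / (N n)%:R).

Let p_ge0 n : 0 <= p n. Proof. by case: (qKP n) => _ KP; exact: p_s_ge0. Qed.

Let p_le n : p n <= (K n)%:R ^+ 2 / (P n)%:R.
Proof. by case: (qKP n) => qK KP; exact: p_s_le. Qed.

Let rho_cvg : rho @ \oo --> (1 : R).
Proof.
rewrite (_ : rho = (fun n => (p_s R q (K n) (P n) * pi * r n ^+ 2)
             / (a * ln ((n - m n)%:R : R) / (n - m n)%:R))) //.
by apply/funext => n; rewrite /rho /s mulrA.
Qed.

Let p_cvg0 : p @ \oo --> (0 : R).
Proof.
apply: (@squeeze_cvgr _ _ _ _ (fun=> 0) (fun n => (K n)%:R ^+ 2 / (P n)%:R)) => //.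
  by apply: nearW => n; rewrite p_ge0 p_le.
exact: cvg_cst.
Qed.

Let s_ge0 n : 0 <= s n.
Proof. by apply: mulr_ge0 => //; case/andP: (disc_area01 (r0 n) (r1 n)). Qed.

Let s_cvg0 : s @ \oo --> (0 : R).
Proof.
apply: (@squeeze_cvgr _ _ _ _ (fun=> 0) p) => //; last exact: cvg_cst.
apply: nearW => n; rewrite s_ge0 /= -[leRHS]mulr1 ler_wpM2l //.
by case/andP: (disc_area01 (r0 n) (r1 n)).
Qed.

(** Division by zero yields 0: for [N n <= 1] the logarithm vanishes, hence [rho n = 0], which is
    excluded once [rho] is near 1. *)
Let near_N2 : \forall n \near \oo, (1 < N n)%N.
Proof.
have h : \forall n \near \oo, 1 / 2 < rho n.
  by apply: (cvgr_gt _ rho_cvg); lra.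
near=> n; have : 1 / 2 < rho n by near: n.
apply: contraTT; rewrite -leqNgt -leNgt => N1.
rewrite /rho (_ : L n = 0); first by rewrite mulr0 mul0r invr0 mulr0.
by rewrite /L; move: N1; case: (N n) => [|[|]] // _; rewrite ?ln1 ?ln0.
Unshelve. all: by end_near.
Qed.

Let L_gt0 n : (1 < N n)%N -> 0 < L n.
Proof. by move=> N1; rewrite ln_gt0 // ltr1n. Qed.

Let rhoE n : (1 < N n)%N -> s n * (N n)%:R = rho n * a * L n.
Proof.
move=> N1; have L0 := L_gt0 N1; have N0 : 0 < (N n)%:R :> R by rewrite ltr0n ltnW.
by rewrite /rho; field; rewrite !gt_eqF.
Qed.

(** Divergence of [N] is extracted from the ratio: [s] tends to 0, whereas [s N = rho a L] is
    eventually at least [a ln 2 / 2]. *)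
Let L_cvg : L @ \oo --> +oo.
Proof.
apply/cvgryPge => B.
have c0 : 0 < a * ln 2 / 2 / expR B.
  by rewrite !divr_gt0 ?mulr_gt0 ?expR_gt0 ?ln_gt0 // ltr1n.
have h : \forall n \near \oo, 1 / 2 < rho n.
  by apply: (cvgr_gt _ rho_cvg); lra.
have h' : \forall n \near \oo, s n < a * ln 2 / 2 / expR B.
  by apply: (cvgr_lt _ s_cvg0).
near=> n.
have N1 : (1 < N n)%N by near: n.
have N0 : 0 < (N n)%:R :> R by rewrite ltr0n ltnW.
have rn : 1 / 2 < rho n by near: n.
have sn : s n < a * ln 2 / 2 / expR B by near: n.
rewrite -ler_expR /L lnK ?posrE //.
rewrite ltr_pdivlMr ?expR_gt0 // in sn.
have l2 : ln 2 <= L n by rewrite ler_ln ?posrE // ler_nat.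
have l0 : 0 < ln 2 :> R by rewrite ln_gt0 // ltr1n.
have e : a * ln 2 / 2 <= s n * (N n)%:R.
  rewrite rhoE // (_ : a * ln 2 / 2 = 1 / 2 * a * ln 2); last by ring.
  by apply: ler_pM => //; rewrite ?ler_wpM2r ?mulr_ge0 ?(ltW a0) ?(ltW l0) ?(ltW rn).
have sgt : 0 < s n.
  by rewrite -(pmulr_lgt0 _ N0); apply: lt_le_trans e; rewrite !mulr_gt0.
by rewrite -(ler_pM2l sgt); apply: ltW; apply: lt_le_trans sn e.
Unshelve. all: by end_near.
Qed.

Let near_ratio_le b : a < b -> \forall n \near \oo, s n * (N n)%:R <= b * L n.
Proof.
move=> ab; have h : \forall n \near \oo, rho n <= b / a.
  by apply: (cvgr_le _ rho_cvg); rewrite ltr_pdivlMr // mul1r.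
near=> n; have N1 : (1 < N n)%N by near: n.
rewrite rhoE // ler_wpM2r ?(ltW (L_gt0 N1)) // -ler_pdivlMr //.
by near: n.
Unshelve. all: by end_near.
Qed.

Let near_ratio_ge b : b < a -> \forall n \near \oo, b * L n <= s n * (N n)%:R.
Proof.
move=> ab; have h : \forall n \near \oo, b / a <= rho n.
  by apply: (cvgr_ge _ rho_cvg); rewrite ltr_pdivrMr // mul1r.
near=> n; have N1 : (1 < N n)%N by near: n.
rewrite rhoE // ler_wpM2r ?(ltW (L_gt0 N1)) // -ler_pdivrMr //.
by near: n.
Unshelve. all: by end_near.
Qed.

Let near_K c : \forall n \near \oo, c * ln n%:R <= (K n)%:R :> R.
Proof.
have h : \forall n \near \oo, c <= (K n)%:R / ln (n%:R : R) by apply: (cvgry_ge K_ln).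
near=> n; rewrite -ler_pdivlMr; first by near: n.
by rewrite ln_gt0 // ltr1n; near: n; exact: nbhs_infty_gt.
Unshelve. all: by end_near.
Qed.

Let near_nK (e : R) : 0 < e -> \forall n \near \oo, n%:R * (K n)%:R / (P n)%:R <= e.
Proof.
move=> e0; have h : \forall n \near \oo, ((K n)%:R / (P n)%:R) / (1 / n%:R) <= e.
  exact: (cvgr_le _ KPn).
near=> n; rewrite (_ : _ / _ = ((K n)%:R / (P n)%:R) / (1 / n%:R)); first by near: n.
by rewrite div1r invrK; ring.
Unshelve. all: by end_near.
Qed.

Let near_kap (e : R) : 0 < e -> \forall n \near \oo, (K n)%:R ^+ 2 / (P n)%:R <= e.
Proof. by move=> e0; exact: (cvgr_le _ kap_cvg). Qed.

Let near_p (e : R) : 0 < e -> \forall n \near \oo, p n <= e.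
Proof. by move=> e0; exact: (cvgr_le _ p_cvg0). Qed.

Let near_s (e : R) : 0 < e -> \forall n \near \oo, s n <= e.
Proof. by move=> e0; exact: (cvgr_le _ s_cvg0). Qed.

Let near_L (e : R) : \forall n \near \oo, e <= L n.
Proof. exact: (cvgry_ge L_cvg). Qed.

Let near_mn : \forall n \near \oo, (m n < n)%N.
Proof. by near=> n; apply: mn; near: n; exact: nbhs_infty_gt. Unshelve. all: by end_near. Qed.

Lemma prob_cvg0 : a < 1 -> (fun n => prob_H_connected q n (m n) (K n) (P n) (r n)) @ \oo --> ((0:R)%:E).
Proof.
(* The midpoint of [a] and 1: eventually [s N <= b L], with room left below 1. *)
move=> a1; pose b := (1 + a) / 2.
have a0R := a0.
have b01 : 0 < b < 1 by rewrite /b; apply/andP; split; move: a0R a1; lra.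
have ab : a < b by rewrite /b; lra.
have /andP[b0 b1] := b01.
pose B n := expR (- ((1 - b) / 2 * L n)) + 4 * s n +
  2 * (4096 * expR 1 * expR (- (L n / 2)) + 4 * expR 1 ^+ 2 * ((K n)%:R ^+ 2 / (P n)%:R)).
have B0 : B @ \oo --> (0 : R).
  rewrite [X in _ --> X](_ : 0 = 0 + 4 * 0 + 2 * (4096 * expR 1 * 0 + 4 * expR 1 ^+ 2 * 0) :> R); last by ring.
  apply: cvgD; first apply: cvgD.
  - by apply: expRN_cvg0 => //; rewrite divr_gt0 // subr_gt0.
  - by apply: cvgM => //; exact: cvg_cst.
  - apply: cvgM; first exact: cvg_cst.
    apply: cvgD; apply: cvgM => //; try exact: cvg_cst.
    under eq_fun do rewrite mulrC.
    by apply: expRN_cvg0 => //; rewrite invr_gt0.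
apply: (@squeeze_cvge _ _ _ _ (fun=> 0%:E) _ (fun n => (B n)%:E)); last 2 first.
- exact: cvg_cst.
- by apply: cvg_EFin => //; exact: nearW.
have E1 : 0 < 1 / expR 1 :> R by rewrite divr_gt0 ?expR_gt0.
have b1' : 0 < (1 - b) / 2 by lra.
near=> n.
have [qK KQ] := qKP n.
have mn' : (m n < n)%N by near: n.
rewrite prob_H_connected_ge0 //=.
have N1 : (1 < N n)%N by near: n.
apply: prob_upper => //.
- by near: n; exact: near_ratio_le.
- by near: n; exact: near_s.
- by near: n; apply: near_s; lra.
- by near: n; apply: near_p; lra.
- by rewrite mulrC -ler_pdivlMr ?expR_gt0 //; near: n; apply: near_kap.
- by near: n; apply: near_kap.
- apply: le_trans (_ : 4 * q.+1%:R * ln n%:R <= _); last by near: n; exact: near_K.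
  rewrite ler_wpM2l ?mulr_ge0 ?ler0n // ler_ln ?posrE ?ltr0n ?ler_nat ?leq_subr //.
    by rewrite ltnW.
  exact: leq_ltn_trans mn'.
Unshelve. all: by end_near.
Qed.

Lemma prob_cvg1 : 1 < a -> (fun n => prob_H_connected q n (m n) (K n) (P n) (r n)) @ \oo --> ((1:R)%:E).
Proof.
move=> a1; pose dl := (a - 1) / (1 + 6 * a); pose e := dl / q.+1%:R.
have dl0 : 0 < dl by rewrite divr_gt0 //; lra.
have e0 : 0 < e by rewrite divr_gt0 // ltr0n.
pose B n := 1 - (5 * expR (- L n) + (expR (expR (- (dl * L n))) - 1)).
have B1 : B @ \oo --> (1 : R).
  rewrite [X in _ --> X](_ : 1 = 1 - (5 * 0 + (expR 0 - 1)) :> R); last by rewrite expR0; ring.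
  apply: cvgB; first exact: cvg_cst.
  apply: cvgD.
    apply: cvgM; first exact: cvg_cst.
    under eq_fun do rewrite -[L _]mul1r.
    exact: expRN_cvg0.
  apply: cvgB; last exact: cvg_cst.
  by apply: continuous_cvg; [exact: continuous_expR|exact: expRN_cvg0].
apply: (@squeeze_cvge _ _ _ _ (fun n => (B n)%:E) _ (fun=> 1%:E)); last 2 first.
- by apply: cvg_EFin => //; exact: nearW.
- exact: cvg_cst.
have g0 : 0 < (dl / 49) ^+ 2 by rewrite exprn_gt0 // divr_gt0.
near=> n.
have [qK KQ] := qKP n.
have mn' : (m n < n)%N by near: n.
rewrite prob_H_connected_le1 //= andbT.
have N1 : (1 < N n)%N by near: n.
(* The slack [dl a] turns the asymptotic ratio into an inequality; positivity of [p n] and [r n] is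
   then read off from it. *)
have hs : (1 - dl) * a * L n <= s n * (N n)%:R.
  near: n; apply: near_ratio_ge; rewrite -subr_gt0; rewrite (_ : _ - _ = dl * a); last by ring.
  exact: mulr_gt0.
have s0 : 0 < s n * (N n)%:R.
  apply: lt_le_trans hs; rewrite !mulr_gt0 ?L_gt0 //.
  by rewrite subr_gt0 /dl ltr_pdivrMr; lra.
have p0 : 0 < p n.
  rewrite lt_def p_ge0 andbT; apply: contraTneq s0 => p0.
  by rewrite /s p0 !mul0r ltxx.
have rn0 : 0 < r n.
  rewrite lt_def r0 andbT; apply: contraTneq s0 => rn0.
  by rewrite /s rn0 expr0n /= !mulr0 mul0r ltxx.
apply: prob_lower => //.
- by near: n; apply: near_nK; rewrite divr_gt0.
- by near: n; exact: near_K.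
- by near: n; apply: near_kap.
- have : p n <= 1 / 1024 by near: n; apply: near_p; lra.
  by rewrite /p; lra.
- have : p n <= dl ^+ 2 / 6 by near: n; apply: near_p; rewrite divr_gt0 // exprn_gt0.
  by rewrite /p -/dl; lra.
- by rewrite -ler_pdivrMr //; near: n; exact: near_L.
- by near: n; exact: near_L.
Unshelve. all: by end_near.
Qed.

End Limits.

Theorem theorem4 (R : realType) (q : nat) (K P m : nat -> nat) (r : nat -> R)
  (a : R) :
  (0 < q)%N ->
  (forall n, (q <= K n)%N /\ (K n <= P n)%N) ->
  (forall n, (0 < n)%N -> (m n < n)%N) ->
  (forall n, 0 <= r n) ->
  (forall n, r n <= 1 / 2) ->
  (* K_n = omega(ln n) *)
  ((fun n => (K n)%:R / ln (n%:R : R)) @ \oo --> +oo) ->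
  (* K_n^2 / P_n = o(1) *)
  ((fun n => (K n)%:R ^+ 2 / (P n)%:R : R) @ \oo --> (0:R)) ->
  (* K_n / P_n = o(1/n) *)
  ((fun n => ((K n)%:R / (P n)%:R) / (1 / n%:R) : R) @ \oo --> (0:R)) ->
  0 < a ->
  (* p_s * pi r_n^2 ~ a ln(n-m)/(n-m) *)
  ((fun n => (p_s R q (K n) (P n) * pi * r n ^+ 2)
             / (a * ln ((n - m n)%:R : R) / (n - m n)%:R)) @ \oo --> (1:R)) ->
  (a < 1 -> (fun n => prob_H_connected q n (m n) (K n) (P n) (r n)) @ \oo --> ((0:R)%:E))
  /\
  (1 < a -> (fun n => prob_H_connected q n (m n) (K n) (P n) (r n)) @ \oo --> ((1:R)%:E)).
Proof.
move=> q0 qKP mn r0 r1 K_ln kap_cvg KPn a0 ratio.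
by split; [exact: prob_cvg0|exact: prob_cvg1].
Qed.
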